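(* Let $v\in S_{p+1}$ be indecomposable of length $n-1$. For $0\le m\le n-p-1$ let $v^{[m]}=1^m\times v\times 1^{n-p-1-m}\in S_n$, and for $j\ge0$ let $\nu_v(j)=\mathfrak{S}_{1^j\times v}(1,q,q^2,\dots)$. Then $$\sum_{j\ge0}\nu_v(j)\,t^j=\frac{\sum_{m=0}^{n-p-1}a_{v^{[m]}}(q)\,t^m}{(t;q)_n}.$$
   Context: $1^j$ denotes the identity of $S_j$; for $u\in S_a$, $v\in S_b$, $u\times v\in S_{a+b}$ is given by $(u\times v)(i)=u(i)$ for $i\le a$ and $(u\times v)(a+j)=a+v(j)$. A permutation is indecomposable if it is not $u\times v$ with both factors in symmetric groups of positive size. $\mathfrak{S}_w$ is the Schubert polynomial ($\mathfrak{S}_{w_0}=x_1^{n-1}\cdots x_{n-1}$, $\mathfrak{S}_{ws_i}=\partial_i\mathfrak{S}_w$ when $w(i)>w(i+1)$), which is stable under $S_n\subset S_{n+1}$. $(t;q)_n=\prod_{i=1}^n(1-tq^{i-1})$. The $q$-divided symmetrization is $\langle f\rangle_n^q=\sum_{w\in S_n}T_w\big(f/\prod_{j=1}^{n-1}(qx_j-x_{j+1})\big)$, $T_j(g)=(q-1)\partial_j(x_jg)+s_jg$, $\partial_jg=(g-s_jg)/(x_j-x_{j+1})$, $T_w=T_{j_1}\cdots T_{j_\ell}$ for a reduced word; for $w\in S_n$ of length $n-1$, $a_w(q)=\langle\mathfrak{S}_w\rangle_n^q$ ($q$ an indeterminate). *)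

(* Defs.v *)
From HB Require Import structures.
From mathcomp Require Import all_boot all_order all_algebra all_fingroup.
From mathcomp Require Import mpoly.
From Stdlib Require Import ClassicalEpsilon.

Set Implicit Arguments.
Unset Strict Implicit.
Unset Printing Implicit Defensive.

Import GRing.Theory.

(* Permutations.  Positions 1..k of the paper are 0..k-1 here ('I_k). *)

Definition pnat (k : nat) (u : 'S_k) : nat -> nat :=
  fun i => match insub i with Some j => val (u j) | None => i end.

(* The permutation of 'I_N given by a nat function g (used only for g   *)
(* that do restrict to a bijection of {0,..,N-1}); 1 otherwise.        *)
Definition mkperm (N : nat) (g : nat -> nat) : 'S_N :=
  insubd (1%g : 'S_N) [ffun i : 'I_N => insubd i (g i)].

Definition ptimes (a b : nat) (u : 'S_a) (v : 'S_b) : 'S_(a + b) :=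
  mkperm (a + b) (fun i => if (i < a)%N then pnat u i else (a + pnat v (i - a))%N).

Definition perm_length (k : nat) (w : 'S_k) : nat :=
  #|[set ij : 'I_k * 'I_k | ((ij.1 < ij.2)%N && (w ij.2 < w ij.1)%N)]|.

Definition indecomposable (k : nat) (v : 'S_k) : Prop :=
  ~ exists (a b : nat) (u : 'S_a.+1) (w : 'S_b.+1),
      (a.+1 + b.+1)%N = k /\ pnat v =1 pnat (ptimes u w).

Definition sref (k i : nat) : 'S_k :=
  mkperm k (fun x => if x == i then i.+1 else if x == i.+1 then i else x).

Definition w0 (k : nat) : 'S_k := mkperm k (fun i => (k.-1 - i)%N).

Definition vshift (n p m : nat) (v : 'S_p.+1) : 'S_n :=
  mkperm n (pnat (ptimes (ptimes (1%g : 'S_m) v) (1%g : 'S_(n - p.+1 - m)))).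

Local Open Scope ring_scope.

(* Coefficient ring Q[q]; q is the polynomial variable 'X.            *)
Notation Rq := {poly rat}.

Definition xv (k i : nat) : {mpoly Rq[k]} :=
  match insub i with Some j => 'X_j | None => 0 end.

Definition ddiff (k i : nat) (f : {mpoly Rq[k]}) : {mpoly Rq[k]} :=
  match excluded_middle_informative
          (exists g : {mpoly Rq[k]},
              (xv k i - xv k i.+1) * g = f - msym (sref k i) f) with
  | left H => proj1_sig (constructive_indefinite_description _ H)
  | right _ => 0
  end.

Definition xdelta (k : nat) : {mpoly Rq[k]} :=
  \prod_(i < k) 'X_i ^+ (k.-1 - i).

(* Schubert polynomials: S_(w0) = xdelta, S_(w s_i) = \partial_i S_w when *)
(* w(i) > w(i+1); computed by going up along ascents.                   *)
Fixpoint schub_fuel (k fuel : nat) (w : 'S_k) : {mpoly Rq[k]} :=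
  match fuel with
  | 0 => xdelta k
  | f.+1 =>
      if w == w0 k then xdelta k else
      match [pick i : 'I_k | (i.+1 < k)%N && (pnat w i < pnat w i.+1)%N] with
      | Some i => ddiff i (schub_fuel f (sref k i * w)%g)
      | None => xdelta k
      end
  end.

Definition schubert (k : nat) (w : 'S_k) : {mpoly Rq[k]} :=
  schub_fuel 'C(k, 2) w.

Definition nu (p : nat) (v : 'S_p.+1) (j : nat) : Rq :=
  (schubert (ptimes (1%g : 'S_j) v)).@[fun i : 'I_(j + p.+1) => 'X ^+ i].

(* Rational functions in x_1..x_n over Q[q] (hence over Q(q)).        *)
Notation Frac n := {fraction {mpoly Rq[n]}}.

Definition xF (n i : nat) : Frac n := tofrac (xv n i).
Definition qF (n : nat) : Frac n := tofrac ('X%:MP_[n]).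

Definition sF (n i : nat) (g : Frac n) : Frac n :=
  let r := generic_quotient.repr g in
  tofrac (msym (sref n i) (frac r).1) / tofrac (msym (sref n i) (frac r).2).

Definition ddF (n i : nat) (g : Frac n) : Frac n :=
  (g - sF i g) / (xF n i - xF n i.+1).

Definition Tj (n i : nat) (g : Frac n) : Frac n :=
  (qF n - 1) * ddF i (xF n i * g) + sF i g.

(* T_w = T_(j1) ... T_(jl) for a reduced word: T_w = T_(w s_i) T_i at a descent i *)
Fixpoint Tw_fuel (n fuel : nat) (w : 'S_n) (g : Frac n) : Frac n :=
  match fuel with
  | 0 => g
  | f.+1 =>
      if w == 1%g then g else
      match [pick i : 'I_n | (i.+1 < n)%N && (pnat w i.+1 < pnat w i)%N] with
      | Some i => Tw_fuel f (sref n i * w)%g (Tj i g)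
      | None => g
      end
  end.

Definition Tw (n : nat) (w : 'S_n) (g : Frac n) : Frac n := Tw_fuel 'C(n, 2) w g.

Definition qdsym (n : nat) (f : Frac n) : Frac n :=
  \sum_(w : 'S_n) Tw w (f / \prod_(j < n.-1) (qF n * xF n j - xF n j.+1)).

Definition aw (n : nat) (w : 'S_n) : Frac n := qdsym (tofrac (schubert w)).

Definition tq (n : nat) : {poly Rq} := \prod_(i < n) (1 - ('X ^+ i)%:P * 'X).

(* Main.v *)
Require Import Defs.
From HB Require Import structures.
From mathcomp Require Import all_boot all_order all_algebra all_fingroup.
From mathcomp Require Import mpoly.
From mathcomp Require Import zify ring.
From Stdlib Require Import ClassicalEpsilon.

(* Write y_i = x_1 + ... + x_i.  Both the principal specialization and every
   q-divided symmetrization attached to a Young subgroup kill the multiples of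
   y_i (q x_i - x_(i+1)), and modulo these relations each polynomial is a
   combination of squarefree products y_I, because
   [b-a+2] y_i y_[a..b] = [b-a+2] y_(a-1) y_[a..b]
                          + [i-a+1] (y_(b+1) - y_(a-1)) y_[a..b].
   The coefficient of y_I is detected by the alternating sum Lam I over the
   Young subgroup generated by the s_i, i in I.  On a Schubert polynomial S_w,
   Lam I sees only the words of divided differences with letters in I, so it
   vanishes unless w lies in that subgroup and w has no trivial factor on a
   nontrivial block; for w = 1^k x v with v indecomposable, I must therefore be
   an interval of size n-1 = length v, and Lam I (S_w) is an a_(v^[s]).
   Evaluating at (1, q, q^2, ...) gives
     [n-1]! nu_v(k) = sum_s a_(v^[s]) [k-s+1] ... [k-s+n-1],
   and the q-binomial theorem turns this into the claimed series. *)

Set Implicit Arguments.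
Unset Strict Implicit.
Unset Printing Implicit Defensive.

Import GRing.Theory Defs.
Local Open Scope ring_scope.

(** * Permutations of nat and divided differences *)

(** The two sides meet through [redu]: its coefficients are chosen before the functional, so one
    expansion of S_w serves the evaluation at powers of q and every [Lam J] alike. There is one
    asymmetry: [Lam J] also kills the multiples of y_N, whereas y_N evaluates to [N+1]. The flag of
    [good] records this, and for the evaluation S_w is embedded in so many variables that y_N never
    arises. The expansion divides by quantum integers, hence the nonzero multiplier in [redu]. The
    link with a_w is the identity sum_w T_w(g) = sum_w w(g prod_{i<j} (q x_i - x_j)/(x_i - x_j)).
    The adjacent factors cancel the denominator of the symmetrization, which is why [Lam] multiplies
    by the nonadjacent ones only. The factor [n-1]! comes from symmetrizing the adjacent product
    itself: sum_w T_w(1) = [n]!, while that product reduces to [n] times the full y-product. *)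

Definition swapn (i x : nat) : nat :=
  if x == i then i.+1 else if x == i.+1 then i else x.

Lemma swapnK i : involutive (swapn i).
Proof. by move=> x; rewrite /swapn; do !case: eqP => //; lia. Qed.

Lemma swapn_l i : swapn i i = i.+1.
Proof. by rewrite /swapn eqxx. Qed.

Lemma swapn_r i : swapn i i.+1 = i.
Proof. by rewrite /swapn eqxx; case: eqP; lia. Qed.

Lemma swapn_id i x : x != i -> x != i.+1 -> swapn i x = x.
Proof. by rewrite /swapn => /negbTE -> /negbTE ->. Qed.

Lemma swapn_lt k i x : (i.+1 < k)%N -> (swapn i x < k)%N = (x < k)%N.
Proof. by rewrite /swapn => lik; do !case: eqP => //; lia. Qed.

Lemma pnatE k (u : 'S_k) (i : 'I_k) : pnat u i = val (u i).
Proof. by rewrite /pnat valK. Qed.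

Lemma pnat_ord k (u : 'S_k) i (lik : (i < k)%N) : pnat u i = val (u (Ordinal lik)).
Proof. by rewrite -pnatE. Qed.

Lemma pnat_ge k (u : 'S_k) i : (k <= i)%N -> pnat u i = i.
Proof. by move=> h; rewrite /pnat insubF // ltnNge h. Qed.

Lemma pnat_lt k (u : 'S_k) i : (pnat u i < k)%N = (i < k)%N.
Proof.
case: (ltnP i k) => h; first by rewrite (pnat_ord _ h) ltn_ord.
by rewrite pnat_ge // ltnNge h.
Qed.

Lemma pnatM k (u w : 'S_k) x : pnat (u * w)%g x = pnat w (pnat u x).
Proof.
case: (ltnP x k) => h; last by rewrite !pnat_ge // pnat_ge.
by rewrite (pnat_ord _ h) permM !(pnat_ord u h) pnatE.
Qed.

Lemma pnat1 k x : pnat (1%g : 'S_k) x = x.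
Proof.
case: (ltnP x k) => h; last by rewrite pnat_ge.
by rewrite (pnat_ord _ h) perm1.
Qed.

Lemma pnat_permP k (u w : 'S_k) : pnat u =1 pnat w -> u = w.
Proof.
by move=> e; apply/permP => i; apply/val_inj; rewrite -!pnatE e.
Qed.

Lemma pnatVK k (u : 'S_k) : cancel (pnat u) (pnat u^-1%g).
Proof. by move=> x; rewrite -pnatM mulgV pnat1. Qed.

Lemma pnat_inj k (u : 'S_k) : injective (pnat u).
Proof. exact: can_inj (pnatVK u). Qed.

Lemma mkpermE N g : (forall i, i < N -> g i < N)%N ->
  (forall i j, (i < N)%N -> (j < N)%N -> g i = g j -> i = j) ->
  forall i, (i < N)%N -> pnat (mkperm N g) i = g i.
Proof.
move=> gN ginj i lti; rewrite (pnat_ord _ lti) /mkperm.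
set f := finfun _.
have fE (j : 'I_N) : val (f j) = g j.
  by rewrite ffunE /insubd insubT ?gN.
have finj : injectiveb f.
  apply/injectiveP => a b eab; apply/val_inj/ginj; rewrite ?ltn_ord //.
  by have := congr1 val eab; rewrite !fE.
transitivity (val (f (Ordinal lti))); last exact: fE.
by rewrite /insubd insubT /= -pvalE.
Qed.

Lemma pnat_sref k i x : (i.+1 < k)%N -> pnat (sref k i) x = swapn i x.
Proof.
move=> lik; case: (ltnP x k) => h; last first.
  by rewrite pnat_ge // swapn_id //; lia.
rewrite /sref mkpermE // => [j|a b] ltj.
  by have := swapn_lt j lik; rewrite /swapn => ->.
by move=> ltb e; apply: (can_inj (swapnK i)).
Qed.

Lemma sref_tperm k i (l1 : (i < k)%N) (l2 : (i.+1 < k)%N) :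
  sref k i = tperm (Ordinal l1) (Ordinal l2).
Proof.
apply/permP => x; apply: val_inj; rewrite -pnatE pnat_sref //.
case: tpermP => [->|->|n1 n2] /=; rewrite ?swapn_l ?swapn_r //.
rewrite swapn_id //; [apply/eqP => e; apply: n1 | apply/eqP => e; apply: n2];
  exact: val_inj.
Qed.

Lemma srefK k i : (i.+1 < k)%N -> (sref k i * sref k i = 1)%g.
Proof.
by move=> l; apply: pnat_permP => x; rewrite pnatM !pnat_sref // swapnK pnat1.
Qed.

Lemma odd_sref k i : (i.+1 < k)%N -> odd_perm (sref k i).
Proof.
move=> l; rewrite (sref_tperm (ltnW l) l) odd_tperm -val_eqE /=.
by rewrite neq_ltn ltnSn.
Qed.

Lemma sref_comm k i j : (i.+1 < k)%N -> (j.+1 < k)%N ->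
  (i.+1 < j)%N || (j.+1 < i)%N ->
  (sref k i * sref k j = sref k j * sref k i)%g.
Proof.
move=> li lj h; apply: pnat_permP => x; rewrite !pnatM !pnat_sref //.
by rewrite /swapn; do !case: eqP; lia.
Qed.

Lemma sref_braid k i : (i.+2 < k)%N ->
  (sref k i * (sref k i.+1 * sref k i) = sref k i.+1 * (sref k i * sref k i.+1))%g.
Proof.
move=> li; apply: pnat_permP => x; rewrite !pnatM !pnat_sref ?(ltnW li) //.
by rewrite /swapn; do !case: eqP; lia.
Qed.

Lemma xvE k (i : 'I_k) : xv k i = 'X_i.
Proof. by rewrite /xv valK. Qed.

Lemma xv_ord k i (l : (i < k)%N) : xv k i = 'X_(Ordinal l).
Proof. by rewrite -xvE. Qed.

Lemma xv_ge k i : (k <= i)%N -> xv k i = 0.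
Proof. by move=> h; rewrite /xv insubF // ltnNge h. Qed.

Lemma msym_xv k (w : 'S_k) i : msym w (xv k i) = xv k (pnat w i).
Proof.
case: (ltnP i k) => h; last by rewrite pnat_ge // xv_ge // msym0.
by rewrite (xv_ord h) /msym mmapX mmap1U (pnat_ord _ h) xvE.
Qed.

Lemma mpoly_morph_ext n (S : comNzRingType) (f g : {rmorphism {mpoly Rq[n]} -> S}) :
  (forall c, f c%:MP = g c%:MP) ->
  (forall i, (i < n)%N -> f (xv n i) = g (xv n i)) -> f =1 g.
Proof.
move=> hc hx p; rewrite (mpolyE p) !rmorph_sum /=; apply: eq_bigr => m _.
rewrite -mul_mpolyC !rmorphM /= hc mpolyXE_id !rmorph_prod /=.
by congr (_ * _); apply: eq_bigr => i _; rewrite !rmorphXn /= -xvE hx.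
Qed.

Lemma dhomog_xv k i : xv k i \is 1.-homog.
Proof.
case: (ltnP i k) => h; last by rewrite xv_ge // dhomog0.
by rewrite (xv_ord h) dhomogX /= mdeg1.
Qed.

Lemma xv_inj k i j : (i < k)%N -> xv k i = xv k j -> i = j.
Proof.
move=> li /(congr1 (mcoeff U_(Ordinal li))); rewrite (xv_ord li) mcoeffX eqxx.
case: (ltnP j k) => lj; last by rewrite xv_ge // mcoeff0 => /eqP; rewrite oner_eq0.
rewrite (xv_ord lj) mcoeffX; case: eqP => [/mnmP/(_ (Ordinal li))|_ /eqP]; last by rewrite oner_eq0.
rewrite !mnmE eqxx; case: eqP => [/(congr1 val) /= e _ _|_ h]; [by [] | by []].
Qed.

Lemma xv_sub_neq0 k i j : (i < k)%N -> i != j -> xv k i - xv k j != 0.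
Proof. by move=> li; apply: contraNneq => /subr0_eq /(xv_inj li) ->. Qed.

Lemma xvS_neq0 k i : (i.+1 < k)%N -> xv k i - xv k i.+1 != 0.
Proof. by move=> l; apply: xv_sub_neq0; rewrite ?(ltnW l) // neq_ltn ltnSn. Qed.

(** Peel off one variable x_j and use the twisted Leibniz rule x_j f - s(x_j) s(f) = (x_j - s(x_j))
    f + s(x_j) (f - s(f)), whose first bracket is a constant multiple of x_i - x_{i+1}. The degree
    of the quotient is tracked in the same induction. *)
Lemma ddiff_mono k i (m : 'X_{1..k}) d : (i.+1 < k)%N -> mdeg m = d ->
  exists2 g : {mpoly Rq[k]}, g \is d.-1.-homog &
    (xv k i - xv k i.+1) * g = 'X_[m] - msym (sref k i) 'X_[m].
Proof.
move=> lik; elim: d m => [|d IH] m dm.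
  exists 0; first exact: dhomog0.
  have -> : m = 0%MM by apply/eqP; rewrite -mdeg_eq0 dm.
  by rewrite mpolyX0 msym1 subrr mulr0.
have [j mj] : exists j, (0 < m j)%N.
  apply/existsP; apply: contra_eqT dm; rewrite negb_exists => /forallP h.
  rewrite mdegE big1 // => j _; have := h j; lia.
have em : m = (U_(j) + (m - U_(j)))%MM.
  apply/mnmP => l; rewrite !mnmE; case: eqP => [<-|]; lia.
have [|g hg eg] := IH (m - U_(j))%MM.
  by move: dm; rewrite {1}em mdegD mdeg1; lia.
rewrite em mpolyXD; set f := 'X_[m - _] in eg *.
have hf : f \is d.-homog.
  rewrite dhomogX /=; apply/eqP; move: dm; rewrite {1}em mdegD mdeg1; lia.
rewrite msymM -!xvE msym_xv pnat_sref //.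
have [c ec] : exists c : Rq, xv k j - xv k (swapn i j) = (xv k i - xv k i.+1) * c%:MP.
  rewrite /swapn; case: eqP => [->|_]; first by exists 1; rewrite mulr1.
  case: eqP => [->|_]; first by exists (-1); rewrite mpolyCN mulrN1 opprB.
  by exists 0; rewrite mulr0 subrr.
exists (c%:MP * f + xv k (swapn i j) * g).
  rewrite mul_mpolyC /= rpredD ?rpredZ //.
  (* [d.-1] truncates at 0: there [f] is constant, and [g] has to be shown to be 0 for its product
     with a variable to stay in degree 0. *)
  case: d hf hg {IH dm} => [|d] hf hg.
    have -> : g = 0.
      move: eg; have -> : f = (f@_0%MM)%:MP.
        apply/mpolyP => m'; rewrite mcoeffC; case: eqP => [->|/eqP nm].
          by rewrite mulr1.
        by rewrite mulr0 (dhomog_nemf_coeff hf) //= mdeg_eq0.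
      rewrite /msym mmapC subrr => /eqP; rewrite mulf_eq0 (negbTE (xvS_neq0 lik)).
      by move/eqP.
    by rewrite mulr0 dhomog0.
  by rewrite -[d.+1]add1n dhomogM // dhomog_xv.
have -> : xv k j * f - xv k (swapn i j) * msym (sref k i) f
  = (xv k j - xv k (swapn i j)) * f + xv k (swapn i j) * (f - msym (sref k i) f) by ring.
rewrite ec -eg; ring.
Qed.

Lemma ddiff_homog_exists k i d (f : {mpoly Rq[k]}) : (i.+1 < k)%N -> f \is d.-homog ->
  exists2 g : {mpoly Rq[k]}, g \is d.-1.-homog &
    (xv k i - xv k i.+1) * g = f - msym (sref k i) f.
Proof.
move=> lik /dhomogP hd; rewrite (mpolyE f) big_seq.
apply: (big_ind (fun F => exists2 g : {mpoly Rq[k]}, g \is d.-1.-homog &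
   (xv k i - xv k i.+1) * g = F - msym (sref k i) F)).
- by exists 0; rewrite ?dhomog0 // msym0 subrr mulr0.
- move=> F1 F2 [g1 h1 e1] [g2 h2 e2]; exists (g1 + g2); first exact: rpredD.
  by rewrite mulrDr e1 e2 msymD opprD addrACA.
move=> m hm; have [g hg eg] := ddiff_mono lik (hd m hm).
exists (f@_m *: g); first exact: rpredZ.
by rewrite msymZ -scalerBr -eg scalerAr.
Qed.

Lemma ddiff_exists k i (f : {mpoly Rq[k]}) : (i.+1 < k)%N ->
  exists g : {mpoly Rq[k]}, (xv k i - xv k i.+1) * g = f - msym (sref k i) f.
Proof.
move=> lik; rewrite (mpolyE f).
apply: (big_ind (fun F => exists g : {mpoly Rq[k]},
   (xv k i - xv k i.+1) * g = F - msym (sref k i) F)).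
- by exists 0; rewrite msym0 subrr mulr0.
- move=> F1 F2 [g1 e1] [g2 e2]; exists (g1 + g2).
  by rewrite mulrDr e1 e2 msymD opprD addrACA.
move=> m hm; have [g hg eg] := ddiff_mono lik (erefl (mdeg m)).
by exists (f@_m *: g); rewrite msymZ -scalerBr -eg scalerAr.
Qed.

Lemma ddiffP k i (f : {mpoly Rq[k]}) : (i.+1 < k)%N ->
  (xv k i - xv k i.+1) * ddiff i f = f - msym (sref k i) f.
Proof.
move=> lik; rewrite /ddiff; case: excluded_middle_informative => [H|[]].
  by case: constructive_indefinite_description.
exact: ddiff_exists.
Qed.


(** Multiplied by a b, both composites of two commuting divided differences become F - sF - tF +
    stF. *)
Lemma comm_alg (R : idomainType) (a b F sF tF stF D sD E tE X Y : R) :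
  a != 0 -> b != 0 ->
  a * X = D - sD -> b * D = F - tF -> b * sD = sF - stF ->
  b * Y = E - tE -> a * E = F - sF -> a * tE = tF - stF -> X = Y.
Proof.
move=> a0 b0 e1 e2 e3 e4 e5 e6; apply: (mulfI (mulf_neq0 a0 b0)).
have -> : a * b * X = b * (a * X) by ring.
have -> : a * b * Y = a * (b * Y) by ring.
rewrite e1 e4; have -> : b * (D - sD) = b * D - b * sD by ring.
have -> : a * (E - tE) = a * E - a * tE by ring.
rewrite e2 e3 e5 e6; ring.
Qed.

(** A threefold divided difference, multiplied by the Vandermonde product of its three variables, is
    the alternating sum over S_3; this sum is the same for both reduced words of the longest
    element. *)
Lemma braid_alg (R : comNzRingType) (a b c F sF tF tsF stF stsF D tD stD E sE X : R) :
  (a - b) * X = E - sE -> (b - c) * E = D - tD -> (a - c) * sE = D - stD ->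
  (a - b) * D = F - sF -> (a - c) * tD = tF - tsF -> (b - c) * stD = stF - stsF ->
  (a - b) * (a - c) * (b - c) * X = F - sF - tF + tsF + stF - stsF.
Proof.
move=> e1 e2 e3 e4 e5 e6.
have -> : (a - b) * (a - c) * (b - c) * X = (a - c) * (b - c) * ((a - b) * X) by ring.
rewrite e1.
have -> : (a - c) * (b - c) * (E - sE) = (a - c) * ((b - c) * E) - (b - c) * ((a - c) * sE) by ring.
rewrite e2 e3.
have -> : (a - c) * (D - tD) - (b - c) * (D - stD) =
  (a - b) * D - (a - c) * tD + (b - c) * stD by ring.
rewrite e4 e5 e6; ring.
Qed.

Lemma braid_alg2 (R : idomainType) (a b c F sF tF tsF stF stsF D tD stD E sE X
    D' sD' tsD' E' tE' X' : R) :
  a - b != 0 -> b - c != 0 -> a - c != 0 ->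
  (a - b) * X = E - sE -> (b - c) * E = D - tD -> (a - c) * sE = D - stD ->
  (a - b) * D = F - sF -> (a - c) * tD = tF - tsF -> (b - c) * stD = stF - stsF ->
  (b - c) * X' = E' - tE' -> (a - b) * E' = D' - sD' -> (a - c) * tE' = D' - tsD' ->
  (b - c) * D' = F - tF -> (a - c) * sD' = sF - stF -> (a - b) * tsD' = tsF - stsF ->
  X = X'.
Proof.
move=> n1 n2 n3 e1 e2 e3 e4 e5 e6 f1 f2 f3 f4 f5 f6.
apply: (mulfI (mulf_neq0 (mulf_neq0 n1 n3) n2)).
rewrite (braid_alg e1 e2 e3 e4 e5 e6).
have neg (x y z t : R) : (x - y) * z = t -> (y - x) * - z = t by move=> <-; ring.
have neg' (x y z u v : R) : (x - y) * z = u - v -> (y - x) * z = - u - - v.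
  by move=> e; rewrite -(opprB x) mulNr e; ring.
(* The second word is the first one with [a] and [c] exchanged; the exchange reverses all
   differences, whence the signs on [D'] and [X']. *)
have := @braid_alg R c b a F tF sF stF tsF stsF (- D') (- sD') (- tsD') E' tE' (- X').
move=> /(_ (neg _ _ _ _ f1) (neg' _ _ _ _ _ f2) (neg' _ _ _ _ _ f3)).
move=> /(_ (neg _ _ _ _ f4) (neg _ _ _ _ f5) (neg _ _ _ _ f6)).
have -> : (c - b) * (c - a) * (b - a) * - X' = (a - b) * (a - c) * (b - c) * X' by ring.
by move=> ->; ring.
Qed.


(** * Polynomial rings behind an opaque interface *)

Definition RA : idomainType := {poly rat}.
Definition PA (k : nat) : idomainType := {mpoly Rq[k]}.
Definition qA : RA := 'X.
Definition cst (k : nat) : {rmorphism RA -> PA k} := @mpolyC k Rq.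
Definition xA (k i : nat) : PA k := xv k i.
Definition sy (k : nat) (w : 'S_k) : {rmorphism PA k -> PA k} := @msym k Rq w.
Definition mm (k : nat) (S : comNzRingType) (f : {rmorphism RA -> S}) (h : nat -> S) :
  {rmorphism PA k -> S} := @mmap k Rq S f (fun i => h (val i)).
Definition hom (k d : nat) (f : PA k) : bool := (f : {mpoly Rq[k]}) \is d.-homog.
Definition dd (k i : nat) (f : PA k) : PA k := @ddiff k i f.
Lemma dd_char k i (f g : PA k) : (i.+1 < k)%N ->
  (xA k i - xA k i.+1) * g = f - sy (sref k i) f -> dd i f = g.
Proof.
by move=> l e; apply: (mulfI (xvS_neq0 l)); exact: (etrans (ddiffP f l) (esym e)).
Qed.

Lemma ddP k i (f : PA k) : (i.+1 < k)%N ->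
  (xA k i - xA k i.+1) * dd i f = f - sy (sref k i) f.
Proof. exact: ddiffP. Qed.

Lemma hom_dd k i d (f : PA k) : (i.+1 < k)%N -> hom d f -> hom d.-1 (dd i f).
Proof.
move=> l hf; have [g hg eg] := ddiff_homog_exists l hf.
by rewrite (dd_char l eg).
Qed.

Lemma mm_c k (S : comNzRingType) f h c : @mm k S f h (cst k c) = f c.
Proof. exact: mmapC. Qed.

Lemma mm_x k (S : comNzRingType) f h i : (i < k)%N -> @mm k S f h (xA k i) = h i.
Proof. by move=> l; rewrite /xA (xv_ord l); rewrite [LHS]mmapX mmap1U. Qed.

Lemma PA_ext k (S : comNzRingType) (f g : {rmorphism PA k -> S}) :
  (forall c, f (cst k c) = g (cst k c)) ->
  (forall i, (i < k)%N -> f (xA k i) = g (xA k i)) -> f =1 g.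
Proof. exact: mpoly_morph_ext. Qed.

Lemma xA_sub_neq0 k i j : (i < k)%N -> i != j -> xA k i - xA k j != 0.
Proof. exact: xv_sub_neq0. Qed.

Lemma cst_inj k : injective (cst k).
Proof.
by move=> a b /(congr1 (mcoeff 0%MM)); rewrite [LHS]mcoeffC [RHS]mcoeffC eqxx !mulr1.
Qed.

Lemma RA_char0 n : (n.+1)%:R != 0 :> RA.
Proof.
rewrite -[_%:R]/(n.+1%:R : {poly rat}) -polyC_natr polyC_eq0.
by rewrite Num.Theory.pnatr_eq0.
Qed.

Lemma sy_x k (w : 'S_k) i : sy w (xA k i) = xA k (pnat w i).
Proof. exact: msym_xv. Qed.

Lemma sy_c k (w : 'S_k) c : sy w (cst k c) = cst k c.
Proof. exact: mmapC. Qed.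

Lemma sy1 k (f : PA k) : sy 1%g f = f.
Proof. exact: msym1m. Qed.

Lemma syM k (u w : 'S_k) (f : PA k) : sy (u * w)%g f = sy w (sy u f).
Proof. exact: msymMm. Qed.

Lemma hom0 k d : hom d (0 : PA k).
Proof. exact: dhomog0. Qed.

Lemma homD k d (f g : PA k) : hom d f -> hom d g -> hom d (f + g).
Proof. exact: rpredD. Qed.

Lemma homM k d e (f g : PA k) : hom d f -> hom e g -> hom (d + e) (f * g).
Proof. exact: dhomogM. Qed.

Lemma hom_c k c : hom 0 (cst k c).
Proof. by rewrite -[cst k c]mulr1 /hom mul_mpolyC rpredZ // dhomog1. Qed.

Lemma hom_x k i : hom 1 (xA k i).
Proof. exact: dhomog_xv. Qed.

(** Monomials are presented as words of indices instead of exponent vectors, because the later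
    reductions consume one variable at a time. *)
Lemma hom_ind k d (P : PA k -> Prop) : P 0 -> (forall f g, P f -> P g -> P (f + g)) ->
  (forall c s, size s = d -> all (fun i => i < k)%N s -> P (cst k c * \prod_(i <- s) xA k i)) ->
  forall f, hom d f -> P f.
Proof.
move=> P0 PD Pm f /dhomogP hf; rewrite [f]mpolyE big_seq.
apply: (big_ind P) => // m /hf /= dm; rewrite -mul_mpolyC.
have -> : 'X_[m] = \prod_(i <- flatten [seq nseq (m i) (val i) | i <- enum 'I_k]) xv k i.
  rewrite big_flatten big_map big_enum /= mpolyXE_id; apply: eq_bigr => i _.
  rewrite -xvE; elim: (m i) => [|e IH]; first by rewrite big_nil.
  by rewrite /= big_cons exprS IH.
apply: Pm.
  rewrite size_flatten /shape -map_comp sumnE big_map big_enum /= -dm mdegE.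
  by apply: eq_bigr => i _; rewrite size_nseq.
apply/allP => j /flatten_mapP[i _]; rewrite mem_nseq => /andP[_ /eqP ->].
exact: ltn_ord.
Qed.

(** Antisymmetry and 2 != 0 kill every monomial with equal exponents at two related indices. In a
    surviving monomial [m], orient each related pair towards its smaller exponent: the exponents
    below [m i] at indices related to [i] are distinct, so at most [m i] pairs start at [i], and the
    degree bounds the number of pairs. *)
Lemma anti_zero k d (E : rel 'I_k) (f : PA k) : (forall i j, E i j = E j i) -> transitive E ->
  (forall i j, i != j -> E i j -> sy (tperm i j) f = - f) -> hom d f ->
  (d < #|[set ij : 'I_k * 'I_k | (ij.1 < ij.2)%N && E ij.1 ij.2]|)%N -> f = 0.
Proof.
move=> sE tE anti /dhomogP hf hd; rewrite [f]mpolyE big_seq big1 // => m hm.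
have minj i j : E i j -> i != j -> m i != m j.
  move=> e nij; apply: contraL hm => /eqP emij; rewrite -mcoeff_eq0.
  have := congr1 (mcoeff m) (anti i j nij e); rewrite [sy _ _]/(msym _ _) mcoeff_sym mcoeffN.
  have -> : [multinom m (tperm i j l) | l < k] = m.
    by apply/mnmP => l; rewrite mnmE; case: tpermP => [->|->|].
  move/eqP; rewrite -subr_eq0 opprK -mulr2n -mulr_natr mulf_eq0.
  by rewrite (negbTE (RA_char0 1)) orbF.
suff : (#|[set ij : 'I_k * 'I_k | (ij.1 < ij.2)%N && E ij.1 ij.2]| <= mdeg m)%N.
  by rewrite (hf m hm) leqNgt hd.
set A := [set ij : _ | _].
pose B := [set ij : 'I_k * 'I_k | (m ij.2 < m ij.1)%N && E ij.1 ij.2].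
have AB : (#|A| <= #|B|)%N.
  pose g (p : 'I_k * 'I_k) := if (m p.2 < m p.1)%N then p else (p.2, p.1).
  rewrite -(@card_in_imset _ _ g A).
    apply: subset_leq_card; apply/subsetP => _ /imsetP[[a b] + ->].
    rewrite !inE /g /= => /andP[ab eab]; case: (ltnP (m b) (m a)) => [h|h] /=; first by rewrite h.
    have nab : a != b by rewrite -val_eqE neq_ltn ab.
    by rewrite ltn_neqAle h (minj a b eab nab) (sE b a) eab.
  move=> [a b] [c e]; rewrite !inE /g /= => /andP[ab _] /andP[ce _].
  do 2 case: ifP => _ //=.
  - by case=> ? ?; subst; move: ab ce; lia.
  - by case=> ? ?; subst; move: ab ce; lia.
  by case=> -> ->.
apply: leq_trans AB _; rewrite mdegE.
have -> : #|B| = (\sum_(i < k) #|[set j : 'I_k | (m j < m i)%N && E i j]|)%N.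
  rewrite -sum1dep_card (eq_bigr (fun i : 'I_k => \sum_(j < k | (m j < m i)%N && E i j) 1%N)).
    by rewrite pair_big_dep.
  by move=> i _; rewrite sum1dep_card.
apply: leq_sum => i _; set D := [set j | _].
rewrite cardE -(size_map m) -(size_iota 0 (m i)); apply: uniq_leq_size.
  rewrite map_inj_in_uniq ?enum_uniq // => a b; rewrite !mem_enum !inE.
  move=> /andP[la ea] /andP[lb eb] eab; apply/eqP; apply: contraT => nab.
  have := minj a b _ nab; rewrite eab eqxx; apply; apply: (tE i); by rewrite ?[E a i]sE.
by move=> x /mapP[j]; rewrite mem_enum !inE => /andP[l _] ->; rewrite mem_iota.
Qed.


(* An abstract copy of {mpoly {poly rat}[k]}, k : nat: over a variable family,
   unification cannot unfold the ring operations of polynomials. *)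
Record polyFamily := PolyFamily {
  pR : idomainType;
  pq : pR;
  pP : nat -> idomainType;
  pcst : forall k, {rmorphism pR -> pP k};
  px : forall k, nat -> pP k;
  psy : forall k, 'S_k -> {rmorphism pP k -> pP k};
  pmm : forall k (S : comNzRingType), {rmorphism pR -> S} -> (nat -> S) ->
    {rmorphism pP k -> S};
  phom : forall k, nat -> pP k -> bool;
  pdd : forall k, nat -> pP k -> pP k;
  pspec : {rmorphism pR -> pR};
  pspecq : pspec pq = 1;
  pddP : forall k i (f : pP k), (i.+1 < k)%N ->
    (px k i - px k i.+1) * pdd i f = f - psy (sref k i) f;
  phom_dd : forall k i d (f : pP k), (i.+1 < k)%N -> phom d f -> phom d.-1 (pdd i f);
  pmm_c : forall k (S : comNzRingType) f h c, @pmm k S f h (pcst k c) = f c;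
  pmm_x : forall k (S : comNzRingType) f h i, (i < k)%N -> @pmm k S f h (px k i) = h i;
  pext : forall k (S : comNzRingType) (f g : {rmorphism pP k -> S}),
    (forall c, f (pcst k c) = g (pcst k c)) ->
    (forall i, (i < k)%N -> f (px k i) = g (px k i)) -> f =1 g;
  px_sub_neq0 : forall k i j, (i < k)%N -> i != j -> px k i - px k j != 0;
  pcst_inj : forall k, injective (pcst k);
  pchar0 : forall n, (n.+1)%:R != 0 :> pR;
  psy_x : forall k (w : 'S_k) i, psy w (px k i) = px k (pnat w i);
  psy_c : forall k (w : 'S_k) c, psy w (pcst k c) = pcst k c;
  psy1 : forall k (f : pP k), psy 1%g f = f;
  psyM : forall k (u w : 'S_k) (f : pP k), psy (u * w)%g f = psy w (psy u f);
  phom0 : forall k d, phom d (0 : pP k);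
  phomD : forall k d (f g : pP k), phom d f -> phom d g -> phom d (f + g);
  phomM : forall k d e (f g : pP k), phom d f -> phom e g -> phom (d + e) (f * g);
  phom_c : forall k c, phom 0 (pcst k c);
  phom_x : forall k i, phom 1 (px k i);
  phom_ind : forall k d (P : pP k -> Prop), P 0 -> (forall f g, P f -> P g -> P (f + g)) ->
    (forall c s, size s = d -> all (fun i => i < k)%N s ->
       P (pcst k c * \prod_(i <- s) px k i)) ->
    forall f, phom d f -> P f;
  panti_zero : forall k d (E : rel 'I_k) (f : pP k), (forall i j, E i j = E j i) ->
    transitive E -> (forall i j, i != j -> E i j -> psy (tperm i j) f = - f) ->
    phom d f ->
    (d < #|[set ij : 'I_k * 'I_k | (ij.1 < ij.2)%N && E ij.1 ij.2]|)%N -> f = 0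
}.

(** Specialization at q = 1, kept as an endomorphism of the coefficient ring. It serves to show that
    quantum integers and [Lam J (adjprod J)] are nonzero. *)
Definition specA : {rmorphism RA -> RA} := (@polyC rat \o horner_eval (1 : rat))%FUN.

Lemma specA_q : specA qA = 1.
Proof. by rewrite /specA /= /horner_eval hornerX. Qed.

Definition mpolyFamily : polyFamily :=
  @PolyFamily RA qA PA cst xA sy mm hom dd specA specA_q (fun k i f l => ddP f l) (fun k i d f l => hom_dd l)
    mm_c mm_x PA_ext xA_sub_neq0 cst_inj RA_char0 sy_x sy_c sy1 syM hom0 homD homM
    hom_c hom_x hom_ind anti_zero.

(** * Inversions *)

Lemma card_ltn_pairs k : #|[set ij : 'I_k * 'I_k | (ij.1 < ij.2)%N]| = 'C(k, 2).
Proof.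
rewrite -bin2_sum big_mkord -sum1dep_card.
rewrite (eq_bigr (fun j : 'I_k => \sum_(i < k | (i < j)%N) 1%N)); last first.
  move=> j _; transitivity (\sum_(0 <= i < j) 1)%N.
    by rewrite sum_nat_const_nat subn0 muln1.
  by rewrite (big_nat_widen 0 j k) 1?ltnW // big_mkord.
rewrite (exchange_big_dep predT) //= pair_big_dep /=; exact: eq_bigl.
Qed.

Definition asc k (w : 'S_k) (i : nat) := (pnat w i < pnat w i.+1)%N.

Lemma asc_sref k (w : 'S_k) i : (i.+1 < k)%N -> ~~ asc w i -> asc (sref k i * w)%g i.
Proof.
move=> l; rewrite /asc !pnatM !pnat_sref // swapn_l swapn_r -leqNgt leq_eqVlt.
by case/orP => // /eqP/pnat_inj/eqP; rewrite gtn_eqF.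
Qed.

(** Products apply the left factor first, so [sref k i * w] is the classical w s_i. Its inversions
    are those of [w] with positions swapped, together with the new pair (i, i+1). *)
Lemma perm_lengthS k (w : 'S_k) i : (i.+1 < k)%N -> asc w i ->
  perm_length (sref k i * w)%g = (perm_length w).+1.
Proof.
move=> l h; set s := sref k i.
pose f (p : 'I_k * 'I_k) := (s p.1, s p.2).
have sE (x : 'I_k) : nat_of_ord (s x) = swapn i x by rewrite -(pnat_sref x l) pnatE.
have finj : injective f.
  by move=> [a b] [c d] [/perm_inj -> /perm_inj ->].
pose a0 : 'I_k := Ordinal (ltnW l); pose b0 : 'I_k := Ordinal l.
have sa : s a0 = b0 by apply: val_inj; rewrite /= sE swapn_l.
have sb : s b0 = a0 by apply: val_inj; rewrite /= sE swapn_r.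
have h' : (w a0 < w b0)%N by rewrite -[val (w a0)]pnatE -[val (w b0)]pnatE.
have ss x : s (s x) = x by apply: val_inj; rewrite /= !sE swapnK.
pose A := [set ij : 'I_k * 'I_k | ((ij.1 < ij.2)%N && (w ij.2 < w ij.1)%N)].
pose B := [set ij : 'I_k * 'I_k | ((ij.1 < ij.2)%N && ((s * w)%g ij.2 < (s * w)%g ij.1)%N)].
rewrite /perm_length -/A -/B.
have -> : B = (a0, b0) |: f @: A.
  apply/setP => -[a b]; rewrite !inE /=; apply/idP/idP => [/andP[ab wab]|].
    case: eqP => //= ne; apply/imsetP; exists (f (a, b)); last by rewrite /f /= !ss.
    rewrite !permM in wab; rewrite inE /= wab andbT !sE.
    have : ~ (a = i :> nat /\ b = i.+1 :> nat).
      by case=> ea eb; apply: ne; congr (_, _); apply: val_inj.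
    by rewrite /swapn; do !case: eqP; lia.
  case/orP => [/eqP[-> ->]|/imsetP[[c d]]].
    by rewrite /= ltnSn !permM sa sb.
  rewrite inE /= => /andP[cd wcd] [-> ->]; rewrite !permM !ss wcd andbT !sE.
  have : ~ (c = i :> nat /\ d = i.+1 :> nat).
    case=> ec ed; have ec' : c = a0 by exact: val_inj.
    have ed' : d = b0 by exact: val_inj.
    by move: wcd h'; rewrite ec' ed'; lia.
  by rewrite /swapn; do !case: eqP; lia.
rewrite cardsU1 card_imset //; case: imsetP => // -[[c d]].
rewrite inE /= => /andP[cd _] [/(congr1 val) /= ec /(congr1 val) /= ed].
move: ec ed cd; rewrite !sE /swapn; do !case: eqP; lia.
Qed.

Lemma perm_length_asc k (w : 'S_k) i : (i.+1 < k)%N -> asc w i ->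
  (perm_length w < 'C(k, 2))%N.
Proof.
move=> l h; rewrite -card_ltn_pairs; apply: proper_card; apply/properP; split.
  by apply/subsetP => p; rewrite !inE => /andP[].
exists (Ordinal (ltnW l), Ordinal l); rewrite !inE /= ltnSn //=.
by rewrite -leqNgt ltnW // -[val (w (Ordinal (ltnW l)))]pnatE -[val (w (Ordinal l))]pnatE.
Qed.

Lemma noasc_decr k (w : 'S_k) : (forall i, (i.+1 < k)%N -> ~~ asc w i) ->
  forall a b, (a < b < k)%N -> (pnat w b < pnat w a)%N.
Proof.
move=> h a b /andP[ab bk]; elim: b ab bk => // b IH ab bk.
have hb : (pnat w b.+1 < pnat w b)%N.
  have := h b bk; rewrite /asc -leqNgt leq_eqVlt => /orP[/eqP/pnat_inj|//]; lia.
have [->//|ne] := eqVneq a b; apply: ltn_trans hb (IH _ _); lia.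
Qed.

Lemma perm_length_noasc k (w : 'S_k) : (forall i, (i.+1 < k)%N -> ~~ asc w i) ->
  perm_length w = 'C(k, 2).
Proof.
move=> h; rewrite -card_ltn_pairs /perm_length; apply: eq_card => -[a b].
rewrite !inE /=; case: (ltnP a b) => //= ab.
by have := @noasc_decr _ _ h a b; rewrite ab ltn_ord !pnatE => ->.
Qed.

(** Schubert polynomials are computed downwards from the longest element, so their properties are
    proved by downward induction on the length, which is at most ['C(k, 2)]. *)
Lemma asc_ind k (P : 'S_k -> Prop) :
  (forall w, (forall u, (perm_length w < perm_length u)%N -> P u) -> P w) -> forall w, P w.
Proof.
move=> h w; have [n] := ubnP ('C(k, 2) - perm_length w); elim: n w => // n IH w hn.
apply: h => u hu; apply: IH.
have le : (perm_length w < 'C(k, 2))%N.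
  apply: leq_trans hu _; rewrite -card_ltn_pairs; apply: subset_leq_card.
  by apply/subsetP => p; rewrite !inE => /andP[].
lia.
Qed.

Lemma pnat_w0 k i : (i < k)%N -> pnat (w0 k) i = (k.-1 - i)%N.
Proof. by move=> l; rewrite /w0 mkpermE // => [j|a b]; lia. Qed.

Lemma noasc_w0 k i : (i.+1 < k)%N -> ~~ asc (w0 k) i.
Proof. by move=> l; rewrite /asc !pnat_w0 //; lia. Qed.

Lemma mulg_srefK k i (w : 'S_k) : (i.+1 < k)%N -> (sref k i * (sref k i * w) = w)%g.
Proof. by move=> l; rewrite mulgA srefK // mul1g. Qed.

Lemma perm_length_desc k (w : 'S_k) i : (i.+1 < k)%N -> ~~ asc w i ->
  perm_length w = (perm_length (sref k i * w)%g).+1.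
Proof.
by move=> l h; rewrite -(perm_lengthS l (asc_sref l h)) mulg_srefK.
Qed.

(** The Lehmer code. *)
Definition code k (w : 'S_k) (i : nat) : nat :=
  \sum_(j < k) ((i < j) && (pnat w j < pnat w i))%N.

Lemma code_le_asc k (w : 'S_k) i : (i.+1 < k)%N -> asc w i -> (code w i <= code w i.+1)%N.
Proof.
move=> l h; apply: leq_sum => j _; move: h; rewrite /asc.
have [->|ne] := eqVneq (j : nat) i.+1; first by lia.
have := ltn_ord j; lia.
Qed.

Lemma code_lt_desc k (w : 'S_k) i : (i.+1 < k)%N -> ~~ asc w i -> (code w i.+1 < code w i)%N.
Proof.
move=> l h; have h' : (pnat w i.+1 < pnat w i)%N.
  by move: h; rewrite /asc -leqNgt leq_eqVlt => /orP[/eqP/pnat_inj|//]; lia.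
rewrite /code (bigD1 (Ordinal l)) //= [X in (_ < X)%N](bigD1 (Ordinal l)) //=.
rewrite ltnn ltnSn h' /= add0n add1n ltnS; apply: leq_sum => j _; lia.
Qed.

Lemma code_swap k (w : 'S_k) i j : (i.+1 < k)%N -> asc w i ->
  code (sref k i * w)%g j = if j == i then (code w i.+1).+1
                            else if j == i.+1 then code w i else code w j.
Proof.
move=> l; rewrite /asc => h.
have cE : code (sref k i * w)%g j =
    (\sum_(t < k) ((j < swapn i t) && (pnat w t < pnat w (swapn i j))))%N.
  rewrite /code (reindex_inj (@perm_inj _ (sref k i))) /=.
  apply: eq_bigr => t _; rewrite !pnatM !pnat_sref //.
  by rewrite -[nat_of_ord _]/(val (sref k i t)) -pnatE pnat_sref // swapnK.
rewrite cE; case: eqP => [->|ni].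
  rewrite swapn_l (bigD1 (Ordinal (ltnW l))) //= swapn_l ltnSn h /= add1n; congr S.
  rewrite /code [RHS](bigD1 (Ordinal (ltnW l))) //= ltnNge leqnSn /= add0n.
  apply: eq_bigr => t; rewrite -val_eqE /= /swapn => nt.
  by case: eqP nt => // _ _; case: eqP => [->|]; lia.
case: eqP => [->|nj].
  rewrite swapn_r; apply: eq_bigr => t _; rewrite /swapn.
  case: eqP => [->|?]; first by lia.
  case: eqP => [->|]; lia.
rewrite swapn_id; try exact/eqP; apply: eq_bigr => t _; rewrite /swapn.
case: eqP => [->|?]; first by lia.
case: eqP => [->|]; lia.
Qed.

Lemma asc_all1 k (w : 'S_k) : (forall i, (i.+1 < k)%N -> asc w i) -> w = 1%g.
Proof.
move=> na; have incr a b : (a < b < k)%N -> (pnat w a < pnat w b)%N.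
  case/andP; elim: b => // b IH ab bk; have hb := na b bk.
  have [->//|ne] := eqVneq a b; apply: ltn_trans hb; apply: IH; lia.
have ge a : (a < k)%N -> (a <= pnat w a)%N.
  by elim: a => // a IH l; have := incr a a.+1; rewrite ltnSn l => /(_ isT); have := IH (ltnW l); lia.
have le a : (a < k)%N -> (pnat w (k.-1 - a) <= k.-1 - a)%N.
  elim: a => [|a IH] l; first by have := pnat_lt w (k.-1 - 0); lia.
  have := incr (k.-1 - a.+1)%N (k.-1 - a)%N; have := IH (ltnW l); lia.
apply: pnat_permP => x; rewrite pnat1; case: (ltnP x k) => lx; last exact: pnat_ge.
have := ge x lx; have := le (k.-1 - x)%N; have -> : (k.-1 - (k.-1 - x) = x)%N by lia.
lia.
Qed.

Lemma perm_length0 k (w : 'S_k) : perm_length w = 0%N -> w = 1%g.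
Proof.
move=> h; apply: asc_all1 => i l.
by case: (boolP (asc w i)) => // /(perm_length_desc l); rewrite h.
Qed.

Lemma perm_length1 k : perm_length (1%g : 'S_k) = 0%N.
Proof.
by apply: eq_card0 => p; rewrite !inE !perm1; apply/negP => /andP[a b]; move: (ltn_trans a b); rewrite ltnn.
Qed.

Lemma perm_length_allasc k (w : 'S_k) : (forall i, (i.+1 < k)%N -> asc w i) -> perm_length w = 0%N.
Proof. by move/asc_all1 ->; rewrite perm_length1. Qed.

(** Expresses that [w] is 1^m x u up to trailing fixed points, without any equation between the
    sizes [a] and [b]. This avoids casts between symmetric groups. *)
Definition shifted m a b (w : 'S_b) (u : 'S_a) : Prop :=
  (forall x, pnat w (m + x) = m + pnat u x)%N /\ (forall x, (x < m)%N -> pnat w x = x).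

Lemma perm_length_nat k (w : 'S_k) K : (k <= K)%N ->
  perm_length w = (\sum_(0 <= j < K) \sum_(0 <= i < j) (pnat w j < pnat w i))%N.
Proof.
move=> kK; rewrite (big_cat_nat (n := k)) //= [X in (_ + X)%N]big1_seq ?addn0.
  rewrite /perm_length -sum1dep_card.
  rewrite (eq_bigl (fun p : 'I_k * 'I_k => predT p.2 && ((p.1 < p.2)%N && (w p.2 < w p.1)%N))) //.
  rewrite big_mkord.
  rewrite (eq_bigr (fun j : 'I_k => \sum_(i < k | (i < j)%N && (w j < w i)%N) 1%N)); last first.
    move=> j _; rewrite big_mkord (big_ord_widen k (fun i => nat_of_bool (pnat w j < pnat w i)%N)) 1?ltnW //.
    rewrite big_mkcondr /=; apply: eq_bigr => i _.
    by rewrite -[val (w j)]pnatE -[val (w i)]pnatE; case: ltnP.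
  rewrite (exchange_big_dep predT) //= pair_big_dep /=; apply: eq_bigl => -[a b] /=.
  by [].
move=> j /andP[_]; rewrite mem_index_iota => /andP[kj _].
rewrite big1_seq // => i /andP[_]; rewrite mem_index_iota => /andP[_ ij].
rewrite (pnat_ge _ kj); case: (ltnP i k) => lik; last by rewrite pnat_ge //; lia.
have := pnat_lt w i; lia.
Qed.

Lemma perm_length_shifted m a b (w : 'S_b) (u : 'S_a) : shifted m w u ->
  perm_length w = perm_length u.
Proof.
case=> h1 h2; rewrite (perm_length_nat w (K := m + (a + b))) ?(perm_length_nat u (K := a + b)); try lia.
rewrite (big_cat_nat (n := m)) //=; last lia.
rewrite [X in (X + _)%N]big1_seq ?add0n; last first.
  move=> j /andP[_]; rewrite mem_index_iota => /andP[_ jm].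
  rewrite big1_seq // => i /andP[_]; rewrite mem_index_iota => /andP[_ ij].
  by rewrite !h2 //; lia.
rewrite -{1}(add0n m) big_addn addKn; apply: eq_bigr => j _.
rewrite (big_cat_nat (n := m)) //=; last lia.
rewrite [X in (X + _)%N]big1_seq ?add0n; last first.
  move=> i /andP[_]; rewrite mem_index_iota => /andP[_ im].
  by rewrite addnC h1 h2 //; lia.
rewrite -{1}(add0n m) big_addn addnK; apply: eq_bigr => i _.
by rewrite ![(_ + m)%N]addnC !h1 ltn_add2l.
Qed.

(** * Schubert polynomials *)

Section Schubert.
Variable S : polyFamily.
Local Notation RA := (pR S).
Local Notation PA k := (pP S k).
Local Notation q := (pq S).
Local Notation cst := (pcst S).
Local Notation x := (px S).
Local Notation sy := (psy S).
Local Notation hom d f := (phom d f).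
Local Notation dd i f := (pdd i f).

Lemma homN k d (f : PA k) : hom d f -> hom d (- f).
Proof. by move=> h; rewrite -mulN1r -(rmorph1 (cst k)) -rmorphN; apply: (phomM (d := 0)); rewrite ?phom_c. Qed.

Lemma homB k d (f g : PA k) : hom d f -> hom d g -> hom d (f - g).
Proof. by move=> h1 h2; apply: phomD => //; apply: homN. Qed.

Lemma homZ k d c (f : PA k) : hom d f -> hom d (cst k c * f).
Proof. by move=> h; apply: (phomM (d := 0)); rewrite ?phom_c. Qed.

Lemma hom1 k : hom 0 (1 : PA k).
Proof. by rewrite -(rmorph1 (cst k)) phom_c. Qed.

Lemma hom_sum k d (I : Type) (r : seq I) (P : pred I) (F : I -> PA k) :
  (forall i, P i -> hom d (F i)) -> hom d (\sum_(i <- r | P i) F i).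
Proof.
by move=> h; apply: (big_ind (fun f => hom d f)) => [|a b|//]; [exact: phom0 | exact: phomD].
Qed.

Lemma hom_prod k (I : Type) (r : seq I) (P : pred I) (F : I -> PA k) (d : I -> nat) :
  (forall i, P i -> hom (d i) (F i)) ->
  hom (\sum_(i <- r | P i) d i)%N (\prod_(i <- r | P i) F i).
Proof.
move=> h; elim: r => [|a r IH]; first by rewrite !big_nil hom1.
by rewrite !big_cons; case: ifP => // ha; apply: phomM => //; apply: h.
Qed.

Lemma hom_prod1 k (I : Type) (r : seq I) (P : pred I) (F : I -> PA k) :
  (forall i, P i -> hom 1 (F i)) -> hom (count P r) (\prod_(i <- r | P i) F i).
Proof. by move=> h; rewrite -sum1_count; apply: hom_prod. Qed.

Lemma homX k d e (f : PA k) : hom d f -> hom (d * e) (f ^+ e).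
Proof.
move=> h; elim: e => [|e IH]; first by rewrite muln0 hom1.
by rewrite exprS mulnS phomM.
Qed.

Lemma xB_hom k i j : hom 1 (x k i - x k j).
Proof. by rewrite homB ?phom_x. Qed.

Lemma mm_hom a b (f : {rmorphism PA a -> PA b}) d p :
  (forall c, f (cst a c) = cst b c) -> (forall i, (i < a)%N -> hom 1 (f (x a i))) ->
  hom d p -> hom d (f p).
Proof.
move=> fc fx; move: p; apply: phom_ind => [|g h|c s hs hl]; rewrite ?rmorph0 ?rmorphD ?phom0 //.
  exact: phomD.
rewrite rmorphM rmorph_prod fc; apply: homZ; rewrite -hs big_seq -count_predT.
rewrite -(@eq_in_count _ (mem s)) => [|i //].
by apply: hom_prod1 => i /(allP hl); apply: fx.
Qed.

Lemma hom_sy k d (w : 'S_k) (f : PA k) : hom d f -> hom d (sy w f).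
Proof. by apply: mm_hom => [c|i _]; rewrite ?psy_c // psy_x phom_x. Qed.

Lemma hom0_const k (f : PA k) : hom 0 f -> exists c, f = cst k c.
Proof.
move: f; apply: phom_ind => [|f g [c ->] [e ->]|c s /size0nil -> _].
- by exists 0; rewrite rmorph0.
- by exists (c + e); rewrite rmorphD.
by exists c; rewrite big_nil mulr1.
Qed.

Lemma xS_neq0 k i : (i.+1 < k)%N -> x k i - x k i.+1 != 0.
Proof. by move=> l; apply: px_sub_neq0; rewrite ?(ltnW l) // neq_ltn ltnSn. Qed.

Lemma PA_char0 k n : (n.+1)%:R != 0 :> PA k.
Proof. by rewrite -(rmorph_nat (cst k)) -(rmorph0 (cst k)) (inj_eq (@pcst_inj S k)) pchar0. Qed.

Section DD.
Variables (k i : nat).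
Hypothesis l : (i.+1 < k)%N.
Implicit Types f g : PA k.

Lemma dd_uniq f g : (x k i - x k i.+1) * g = f - sy (sref k i) f -> dd i f = g.
Proof. by move=> e; apply: (mulfI (xS_neq0 l)); rewrite pddP. Qed.

Lemma syK2 f : sy (sref k i) (sy (sref k i) f) = f.
Proof. by rewrite -psyM srefK // psy1. Qed.

Lemma sy_sx j : sy (sref k i) (x k j) = x k (swapn i j).
Proof. by rewrite psy_x pnat_sref. Qed.

Lemma sy_dd f : sy (sref k i) (dd i f) = dd i f.
Proof.
apply: (mulfI (xS_neq0 l)); rewrite pddP //.
have := congr1 (sy (sref k i)) (pddP f l).
rewrite rmorphM !rmorphB /= !sy_sx swapn_l swapn_r syK2 => e.
by rewrite -(opprB (x k i.+1)) mulNr e opprB.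
Qed.

Lemma dd_inv f : sy (sref k i) f = f -> dd i f = 0.
Proof. by move=> e; apply: dd_uniq; rewrite e subrr mulr0. Qed.

Lemma dd0_inv f : dd i f = 0 -> sy (sref k i) f = f.
Proof. by move=> e; have := pddP f l; rewrite e mulr0 => /esym /subr0_eq. Qed.

Lemma dd_dd f : dd i (dd i f) = 0.
Proof. by apply: dd_inv; rewrite sy_dd. Qed.

Lemma ddB f g : dd i (f - g) = dd i f - dd i g.
Proof. apply: dd_uniq; rewrite mulrBr !pddP // rmorphB /=; ring. Qed.

End DD.

Lemma dd_comm k i j (f : PA k) : (i.+1 < k)%N -> (j.+1 < k)%N ->
  (i.+1 < j)%N || (j.+1 < i)%N -> dd i (dd j f) = dd j (dd i f).
Proof.
move=> li lj h.
have cs a b : (a.+1 < k)%N -> (b.+1 < k)%N -> (a.+1 < b)%N || (b.+1 < a)%N ->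
    sy (sref k b) (x k a - x k a.+1) = x k a - x k a.+1.
  by move=> la lb hab; rewrite rmorphB /= !sy_sx // !swapn_id //; lia.
have h' : (j.+1 < i)%N || (i.+1 < j)%N by rewrite orbC.
apply: (comm_alg (xS_neq0 li) (xS_neq0 lj) (pddP _ li) (pddP _ lj) _ (pddP _ lj) (pddP _ li)).
  by rewrite -{1}(cs j i) // -rmorphM pddP // rmorphB.
rewrite -{1}(cs i j) // -rmorphM pddP // rmorphB; congr (_ - _).
by rewrite -!psyM sref_comm.
Qed.

Lemma dd_braid k i (f : PA k) : (i.+2 < k)%N ->
  dd i (dd i.+1 (dd i f)) = dd i.+1 (dd i (dd i.+1 f)).
Proof.
move=> l; have l' := ltnW l.
set s := sref k i; set t := sref k i.+1.
set a := x k i; set b := x k i.+1; set c := x k i.+2.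
have sa : sy s a = b by rewrite sy_sx // swapn_l.
have sb : sy s b = a by rewrite sy_sx // swapn_r.
have sC : sy s c = c by rewrite sy_sx // swapn_id //; lia.
have ta : sy t a = a by rewrite sy_sx // swapn_id //; lia.
have tb : sy t b = c by rewrite sy_sx // swapn_l.
have tc : sy t c = b by rewrite sy_sx // swapn_r.
have nab : a - b != 0 by apply: xS_neq0.
have nbc : b - c != 0 by apply: xS_neq0.
have nac : a - c != 0 by apply: px_sub_neq0; lia.
have sP g : (a - b) * dd i g = g - sy s g by apply: pddP.
have tP g : (b - c) * dd i.+1 g = g - sy t g by apply: pddP.
have bs g : sy s (sy t (sy s g)) = sy t (sy s (sy t g)).
  by rewrite -!psyM /s /t sref_braid.
have tab : sy t (a - b) = a - c by rewrite rmorphB /= ta tb.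
have sbc : sy s (b - c) = a - c by rewrite rmorphB /= sb sC.
have sac : sy s (a - c) = b - c by rewrite rmorphB /= sa sC.
have tac : sy t (a - c) = a - b by rewrite rmorphB /= ta tc.
have e3 g : (a - c) * sy t (dd i g) = sy t g - sy t (sy s g).
  by rewrite -tab -rmorphM sP rmorphB.
have e3' g : (a - c) * sy s (dd i.+1 g) = sy s g - sy s (sy t g).
  by rewrite -sbc -rmorphM tP rmorphB.
have e6 g : (b - c) * sy s (sy t (dd i g)) = sy s (sy t g) - sy s (sy t (sy s g)).
  by rewrite -sac -rmorphM e3 rmorphB.
have e6' g : (a - b) * sy t (sy s (dd i.+1 g)) = sy t (sy s g) - sy s (sy t (sy s g)).
  by rewrite bs -tac -rmorphM e3' rmorphB.
have e4 : (a - c) * sy s (dd i.+1 (dd i f)) = dd i f - sy s (sy t (dd i f)).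
  by rewrite e3' sy_dd.
have e4' : (a - c) * sy t (dd i (dd i.+1 f)) = dd i.+1 f - sy t (sy s (dd i.+1 f)).
  by rewrite e3 sy_dd.
exact: (braid_alg2 nab nbc nac (sP _) (tP _) e4 (sP _) (e3 _) (e6 _)
                   (tP _) (sP _) e4' (tP _) (e3' _) (e6' _)).
Qed.

(** From here to [schubertA]: the definitions of [xdelta], [schub_fuel] and [schubert] over the
    abstract family; [schub_fuelAE] identifies the two versions. *)
Definition xdel k : PA k := \prod_(i < k) x k i ^+ (k.-1 - i).

Fixpoint schub_fuelA (k fuel : nat) (w : 'S_k) : PA k :=
  match fuel with
  | 0 => xdel k
  | f.+1 =>
      if w == w0 k then xdel k else
      match [pick i : 'I_k | (i.+1 < k)%N && (pnat w i < pnat w i.+1)%N] with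
      | Some i => dd i (schub_fuelA f (sref k i * w)%g)
      | None => xdel k
      end
  end.

Definition schubertA (k : nat) (w : 'S_k) : PA k := schub_fuelA 'C(k, 2) w.

Lemma schub_fuel_noasc k f (w : 'S_k) : (forall i, (i.+1 < k)%N -> ~~ asc w i) ->
  schub_fuelA f w = xdel k.
Proof.
case: f => //= f h; case: ifP => // _; case: pickP => // i /andP[l].
by have := h _ l; rewrite /asc => /negbTE ->.
Qed.

Variant schub_pick_spec k (w : 'S_k) : Prop :=
| SchubTop of (forall i, (i.+1 < k)%N -> ~~ asc w i)
| SchubAsc i of (i.+1 < k)%N & asc w i & (forall f, schub_fuelA f.+1 w = dd i (schub_fuelA f (sref k i * w)%g)).

Lemma schub_pickP k (w : 'S_k) : schub_pick_spec w.
Proof.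
case E: [pick i : 'I_k | (i.+1 < k)%N && (pnat w i < pnat w i.+1)%N] => [i|].
  have [l h] : (i.+1 < k)%N /\ asc w i.
    by move: E; case: pickP => // j /andP[? ?] [<-].
  apply: (SchubAsc l h) => f /=; rewrite E; case: eqP => // e.
  by move: (noasc_w0 l); rewrite -e h.
apply: SchubTop => i l; move: E; case: pickP => // /(_ (Ordinal (ltnW l))) /=.
by rewrite l /= => e _; rewrite /asc e.
Qed.

Lemma schub_fuel_eq k (w : 'S_k) f1 f2 : ('C(k, 2) - perm_length w <= f1)%N ->
  ('C(k, 2) - perm_length w <= f2)%N -> schub_fuelA f1 w = schub_fuelA f2 w.
Proof.
elim: f1 f2 w => [|f1 IH] f2 w h1 h2; case: (schub_pickP w) => [na|i l h e].
- by rewrite !schub_fuel_noasc.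
- by have := perm_length_asc l h; lia.
- by rewrite !schub_fuel_noasc.
have lt := perm_length_asc l h.
case: f2 h2 => [|f2] h2; first lia.
by rewrite !e; congr pdd; apply: IH; rewrite (perm_lengthS l h); lia.
Qed.

Lemma schubert_top k (w : 'S_k) : (forall i, (i.+1 < k)%N -> ~~ asc w i) ->
  schubertA w = xdel k.
Proof. exact: schub_fuel_noasc. Qed.

Lemma schubert_step k (w : 'S_k) : (forall i, (i.+1 < k)%N -> ~~ asc w i) \/
  exists i, [/\ (i.+1 < k)%N, asc w i & schubertA w = dd i (schubertA (sref k i * w)%g)].
Proof.
case: (schub_pickP w) => [na|i l h e]; [by left|right; exists i; split=> //].
rewrite /schubertA; have lt := perm_length_asc l h.
case E: 'C(k, 2) => [|f]; first lia.
rewrite e; congr pdd; apply: schub_fuel_eq; rewrite (perm_lengthS l h); lia.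
Qed.

(** Independence of the chosen ascent, by downward induction on the length. If two ascents are far
    apart, both descents are continued to a common permutation and [dd_comm] applies; if they are
    adjacent, both are continued to the longest element of the S_3 they generate, times [w], and
    [dd_braid] applies. *)
Lemma schubert_asc k (w : 'S_k) i : (i.+1 < k)%N -> asc w i ->
  schubertA w = dd i (schubertA (sref k i * w)%g).
Proof.
elim/asc_ind: w i => w IH i li hi; case: (schubert_step w) => [na|[j [lj hj ej]]].
  by rewrite (negbTE (na _ li)) in hi.
have [ij|nij] := eqVneq i j; first by rewrite ij.
have lwi : (perm_length w < perm_length (sref k i * w)%g)%N by rewrite perm_lengthS.
have lwj : (perm_length w < perm_length (sref k j * w)%g)%N by rewrite perm_lengthS.
have [far|near] := boolP ((i.+1 < j)%N || (j.+1 < i)%N).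
  have hij : asc (sref k j * w)%g i.
    by rewrite /asc !pnatM !pnat_sref // !swapn_id //; lia.
  have hji : asc (sref k i * w)%g j.
    by rewrite /asc !pnatM !pnat_sref // !swapn_id //; lia.
  rewrite ej (IH _ lwj i) // (IH _ lwi j) // dd_comm ?[X in X || _]orbC //; last by rewrite orbC.
  by rewrite !mulgA sref_comm.
suff main a : (a.+2 < k)%N -> asc w a -> asc w a.+1 ->
    dd a (schubertA (sref k a * w)%g) = dd a.+1 (schubertA (sref k a.+1 * w)%g).
  have [eij|eji] : j = i.+1 \/ i = j.+1 by lia.
    by rewrite ej eij -main // -eij.
  by rewrite ej main // -?eji.
move=> la h1 h2; have la' := ltnW la.
have L1 : (perm_length w < perm_length (sref k a * w)%g)%N by rewrite perm_lengthS.
have L2 : (perm_length w < perm_length (sref k a.+1 * w)%g)%N by rewrite perm_lengthS.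
have n1 : swapn a.+1 a = a by rewrite swapn_id //; lia.
have n2 : swapn a a.+2 = a.+2 by rewrite swapn_id //; lia.
move: (h1) (h2); rewrite /asc => h1' h2'.
have A1 : asc (sref k a * w)%g a.+1.
  by rewrite /asc !pnatM !pnat_sref // swapn_r n2; lia.
have A2 : asc (sref k a.+1 * (sref k a * w))%g a.
  by rewrite /asc !pnatM !pnat_sref // n1 ?swapn_l ?swapn_r ?n2.
have B1 : asc (sref k a.+1 * w)%g a.
  by rewrite /asc !pnatM !pnat_sref // swapn_l n1; lia.
have B2 : asc (sref k a * (sref k a.+1 * w))%g a.+1.
  by rewrite /asc !pnatM !pnat_sref // swapn_r n2 swapn_r n1.
have L1' : (perm_length w < perm_length (sref k a.+1 * (sref k a * w))%g)%N.
  by rewrite perm_lengthS // ltnW.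
have L2' : (perm_length w < perm_length (sref k a * (sref k a.+1 * w))%g)%N.
  by rewrite perm_lengthS // ltnW.
rewrite (IH _ L1 a.+1) // (IH _ L1' a) // (IH _ L2 a) // (IH _ L2' a.+1) //.
rewrite dd_braid //; congr (pdd _ (pdd _ (pdd _ (schubertA _)))).
by rewrite !mulgA -[(sref k a * _ * _)%g]mulgA sref_braid // !mulgA.
Qed.

Lemma dd_schubert k (w : 'S_k) i : (i.+1 < k)%N ->
  dd i (schubertA w) = if asc w i then 0 else schubertA (sref k i * w)%g.
Proof.
move=> l; case: ifP => h; first by rewrite (schubert_asc l h) dd_dd.
by rewrite (schubert_asc l (asc_sref l (negbT h))) mulg_srefK.
Qed.


Lemma dhomog_xX k i e : hom e (x k i ^+ e).
Proof. by rewrite -{1}(mul1n e); apply: homX; apply: phom_x. Qed.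

Lemma xdel_homog k : hom 'C(k, 2) (xdel k).
Proof.
have -> : 'C(k, 2) = (\sum_(i < k) (k.-1 - i))%N.
  rewrite -bin2_sum big_mkord (reindex_inj rev_ord_inj) /=.
  by apply: eq_bigr => i _; have := ltn_ord i; lia.
by apply: hom_prod => i _; rewrite dhomog_xX.
Qed.

Lemma schubert_homog k (w : 'S_k) : hom (perm_length w) (schubertA w).
Proof.
elim/asc_ind: w => w IH; case: (schubert_step w) => [na|[i [l h e]]].
  by rewrite schubert_top // perm_length_noasc // xdel_homog.
rewrite e; have hl := perm_lengthS l h.
by have := phom_dd l (IH (sref k i * w)%g _); rewrite hl /=; exact.
Qed.

(* If i is the first ascent of w, then code w i = code w i.+1 and s_i w is again
   dominant, with one more inversion at i. *)
Lemma schubert_dominant k (w : 'S_k) :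
  (forall i, (i.+1 < k)%N -> (code w i.+1 <= code w i)%N) ->
  schubertA w = \prod_(i < k) x k i ^+ code w i.
Proof.
elim/asc_ind: w => w IH dom.
have [/existsP ex|na] := boolP [exists i : 'I_k, (i.+1 < k)%N && asc w i]; last first.
  have na' i : (i.+1 < k)%N -> ~~ asc w i.
    move=> l; apply: contra na => h; apply/existsP; exists (Ordinal (ltnW l)).
    by rewrite /= l.
  rewrite schubert_top //; apply: eq_bigr => i _; congr (_ ^+ _).
  have lik := ltn_ord i.
  rewrite /code (eq_bigr (fun j : 'I_k => nat_of_bool (i < j)%N)); last first.
    move=> j _; case: (ltnP i j) => //= ij.
    by rewrite (noasc_decr na') // ij ltn_ord.
  have -> : (\sum_(j < k) (i < j) = \sum_(0 <= j < k) (i < j))%N by rewrite big_mkord.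
  rewrite (big_cat_nat (n := i.+1)) //= big_nat_cond big1 => [|j]; last by lia.
  rewrite big_nat_cond (eq_bigr (fun=> 1%N)) => [|j]; last by lia.
  rewrite -big_nat_cond sum_nat_const_nat; lia.
have {}ex : exists i, (i.+1 < k)%N && asc w i by case: ex => i; exists i.
case: (ex_minnP ex) => i /andP[l h] imin.
have cc : code w i = code w i.+1.
  by apply/eqP; rewrite eqn_leq code_le_asc // dom.
set w' := (sref k i * w)%g.
have cw' j : code w' j = (code w j + (j == i))%N.
  rewrite code_swap //; case: eqP => [->|_]; first by rewrite cc addn1.
  by rewrite addn0; case: eqP => [->|].
have -> : schubertA w = dd i (schubertA w') by apply: schubert_asc.
rewrite IH; first last.
- move=> j lj; rewrite !cw'; case: (ltngtP j.+1 i) => [ji|ji|ji]; last first.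
  + have nj : ~~ asc w j.
      by apply/negP => hj; have := imin j; rewrite lj hj => /(_ isT); lia.
    by have := code_lt_desc lj nj; rewrite ji; case: eqP; lia.
  + by have := dom j lj; lia.
  by have := dom j lj; lia.
- by rewrite perm_lengthS.
set P := \prod_(j < k) _ ^+ code w j.
have -> : \prod_(j < k) x k j ^+ code w' j = x k i * P.
  rewrite (eq_bigr (fun j : 'I_k => x k j ^+ (j == i :> nat) * x k j ^+ code w j)).
    rewrite big_split /=; congr (_ * _).
    rewrite (bigD1 (Ordinal (ltnW l))) //= eqxx expr1 big1 ?mulr1 // => j.
    by rewrite -val_eqE /= => /negbTE ->.
  by move=> j _; rewrite cw' exprD mulrC.
have sP : sy (sref k i) P = P.
  rewrite /P rmorph_prod /= [RHS](reindex_inj (@perm_inj _ (sref k i))) /=.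
  apply: eq_bigr => j _; rewrite rmorphXn /= psy_x.
  have -> : nat_of_ord (sref k i j) = swapn i j by rewrite -(pnat_sref j l) pnatE.
  rewrite pnat_sref //; congr (_ ^+ _).
  by rewrite /swapn; case: eqP => [->//|_]; case: eqP => [->|].
by apply: dd_uniq => //; rewrite rmorphM /= sP psy_x pnat_sref // swapn_l mulrBl.
Qed.

Lemma schubert1 k : schubertA (1%g : 'S_k) = 1.
Proof.
have c0 i : code (1%g : 'S_k) i = 0%N.
  by apply: big1 => j _; rewrite !pnat1; lia.
rewrite schubert_dominant => [|i l]; last by rewrite !c0.
by apply: big1 => i _; rewrite c0 expr0.
Qed.


(** Separates one variable x_j in order to measure the degree in it. *)
Definition onevar k j : {rmorphism PA k -> {poly PA k}} :=
  pmm k (@polyC (PA k) \o cst k)%FUN (fun l => if l == j then 'X else (x k l)%:P).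

Lemma onevar_c k j c : onevar k j (cst k c) = (cst k c)%:P.
Proof. exact: pmm_c. Qed.

Lemma onevar_x k j i : (i < k)%N -> onevar k j (x k i) = if i == j then 'X else (x k i)%:P.
Proof. exact: pmm_x. Qed.

Lemma onevar_sy k j i (f : PA k) : (i.+1 < k)%N ->
  onevar k j (sy (sref k i) f) = map_poly (sy (sref k i)) (onevar k (swapn i j) f).
Proof.
move=> l; move: f; apply: (@pext S k _ (onevar k j \o sy (sref k i))%FUN
  (map_poly (sy (sref k i)) \o onevar k (swapn i j))%FUN) => [c|a la] /=.
  by rewrite psy_c !onevar_c map_polyC /= psy_c.
rewrite sy_sx // !onevar_x ?swapn_lt //.
have -> : (swapn i a == j) = (a == swapn i j) by rewrite -(inj_eq (can_inj (swapnK i))) swapnK.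
by case: eqP => _; rewrite ?map_polyX // map_polyC /= sy_sx.
Qed.

(** The staircase bound, degree in x_j at most k-1-j, survives divided differences. The swap mixes
    the bounds for i and i+1, which differ by one; division by x_i - x_{i+1} lowers the degree in
    either of these variables by one and makes up for it. *)
Lemma size_onevar_dd k i (f : PA k) : (i.+1 < k)%N ->
  (forall j, (j < k)%N -> (size (onevar k j f : {poly PA k}) <= k - j)%N) ->
  forall j, (j < k)%N -> (size (onevar k j (dd i f) : {poly PA k}) <= k - j)%N.
Proof.
move=> l hf j lj; have [->|g0] := eqVneq (dd i f) 0; first by rewrite rmorph0 size_poly0.
have [->|n0] := eqVneq (onevar k j (dd i f)) 0; first by rewrite size_poly0.
have := congr1 (fun p => size (onevar k j p : {poly PA k})) (pddP f l).
rewrite /= rmorphM !rmorphB /= onevar_sy // !onevar_x //; last exact: ltnW.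
have hs : leq (size ((onevar k j f : {poly PA k}) - map_poly (sy (sref k i)) (onevar k (swapn i j) f)))
           (maxn (k - j) (k - swapn i j)).
  apply: leq_trans (size_polyD _ _) _; rewrite size_polyN size_map_inj_poly ?rmorph0 //.
    by rewrite geq_max !leq_max hf // hf ?swapn_lt // orbT.
  by apply: can_inj (syK2 l).
case: eqP => [eij|nij].
  have -> : (i.+1 == j) = false by apply/eqP; lia.
  rewrite size_mul ?polyXsubC_eq0 // size_XsubC /= => e.
  by move: hs; rewrite -e -eij swapn_l; lia.
case: eqP => [eij|nij'].
  rewrite -opprB mulNr size_polyN size_mul ?polyXsubC_eq0 // size_XsubC /= => e.
  by move: hs; rewrite -e -eij swapn_r; lia.
rewrite -polyCB mul_polyC size_scale ?xS_neq0 // => ->.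
by move: hs; rewrite swapn_id; try lia; rewrite maxnn.
Qed.

Lemma size_onevar_schubert k (w : 'S_k) j : (j < k)%N ->
  (size (onevar k j (schubertA w) : {poly PA k}) <= k - j)%N.
Proof.
move: j; elim/asc_ind: w => w IH; case: (schubert_step w) => [na|[i [l h e]]] j lj.
  rewrite schubert_top // /xdel rmorph_prod (bigD1 (Ordinal lj)) //=.
  rewrite rmorphXn /= onevar_x // eqxx.
  rewrite (eq_bigr (fun i : 'I_k => (x k i ^+ (k.-1 - i))%:P)) => [|i].
    rewrite -rmorph_prod /=; move: (\prod_(i < k | i != _) _) => C.
    apply: leq_trans (size_polyMleq _ _) _.
    by have := size_polyC_leq1 C; rewrite size_polyXn /=; move: (size C%:P) => z; lia.
  by rewrite -val_eqE /= => ne; rewrite rmorphXn /= onevar_x // (negbTE ne) -rmorphXn.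
rewrite e; apply: size_onevar_dd => //; apply: IH; by rewrite perm_lengthS.
Qed.

(** By the staircase bound the last variable does not occur. [ev y] follows [A] except that it sends
    the last variable to [y], so its value on a Schubert polynomial does not depend on [y]. *)
Lemma schubert_free k (T : comNzRingType) (A B : {rmorphism PA k.+1 -> T}) (w : 'S_k.+1) :
  (forall c, A (cst k.+1 c) = B (cst k.+1 c)) ->
  (forall i, (i < k)%N -> A (x k.+1 i) = B (x k.+1 i)) -> A (schubertA w) = B (schubertA w).
Proof.
move=> hc hx.
pose ev y : {rmorphism PA k.+1 -> T} := (horner_eval y \o (map_poly A \o onevar k.+1 k))%FUN.
have evE y : (forall i, (i < k)%N -> ev y (x k.+1 i) = A (x k.+1 i)) /\ ev y (x k.+1 k) = y.
  rewrite /ev /=; split=> [i l|].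
    by rewrite onevar_x 1?ltnW // ltn_eqF // map_polyC /= /horner_eval hornerC.
  by rewrite onevar_x // eqxx map_polyX /horner_eval hornerX.
have evc y c : ev y (cst k.+1 c) = A (cst k.+1 c).
  by rewrite /ev /= onevar_c map_polyC /= /horner_eval hornerC.
have indep y z : ev y (schubertA w) = ev z (schubertA w).
  have := @size_onevar_schubert k.+1 w k (ltnSn k); rewrite subSnn => /size1_polyC e.
  by rewrite /ev /= e map_polyC /= /horner_eval !hornerC.
have -> : A (schubertA w) = ev (A (x k.+1 k)) (schubertA w).
  move: (schubertA w); apply: (@pext S k.+1 _ A (ev (A (x k.+1 k)))) => [c|i]; first by rewrite evc.
  by rewrite ltnS leq_eqVlt => /orP[/eqP ->|l]; rewrite ?(evE _).2 ?(evE _).1.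
have -> : B (schubertA w) = ev (B (x k.+1 k)) (schubertA w).
  move: (schubertA w); apply: (@pext S k.+1 _ B (ev (B (x k.+1 k)))) => [c|i]; first by rewrite evc hc.
  by rewrite ltnS leq_eqVlt => /orP[/eqP ->|l]; rewrite ?(evE _).2 ?(evE _).1 ?hx.
exact: indep.
Qed.

Definition io (m a b : nat) : {rmorphism PA a -> PA b} :=
  pmm a (cst b) (fun i => x b (m + i)).

Lemma io_c m a b c : io m a b (cst a c) = cst b c.
Proof. exact: pmm_c. Qed.

Lemma io_x m a b i : (i < a)%N -> io m a b (x a i) = x b (m + i).
Proof. exact: pmm_x. Qed.

Lemma io_hom m a b d f : hom d f -> hom d (io m a b f).
Proof. by apply: mm_hom => [c|i l]; rewrite ?io_c // io_x // phom_x. Qed.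

Lemma io_sy m a b i f : (i.+1 < a)%N -> (m + a <= b)%N ->
  io m a b (sy (sref a i) f) = sy (sref b (m + i)) (io m a b f).
Proof.
move=> l lb; have l' : ((m + i).+1 < b)%N by lia.
move: f; apply: (@pext S a _ (io m a b \o sy (sref a i))%FUN
   (sy (sref b (m + i)) \o io m a b)%FUN) => [c|j lj] /=; first by rewrite psy_c !io_c psy_c.
rewrite sy_sx // !io_x ?swapn_lt // sy_sx //; congr x.
by rewrite /swapn; do !case: eqP; lia.
Qed.

Lemma io_dd m a b i f : (i.+1 < a)%N -> (m + a <= b)%N ->
  io m a b (dd i f) = dd (m + i) (io m a b f).
Proof.
move=> l lb; have l' : ((m + i).+1 < b)%N by lia.
apply/esym; apply: dd_uniq => //; rewrite -io_sy // -rmorphB -(pddP f l) rmorphM rmorphB /=.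
by rewrite !io_x //; [rewrite addnS | exact: ltnW].
Qed.

(** This takes the place of stability: seen in a larger ring, a Schubert polynomial of S_a has
    vanishing divided differences at all positions outside S_a, because its last variable is
    absent. *)
Lemma io0_schubert_inv a b i (w : 'S_a) : (i.+1 < b)%N -> (a <= i.+1)%N ->
  dd i (io 0 a b (schubertA w)) = 0.
Proof.
move=> l la; apply: dd_inv => //; case: a la w => [|a] la w.
  have := schubert_homog w; have -> : perm_length w = 0%N.
    by apply: eq_card0 => -[[]].
  by case/hom0_const => c ->; rewrite io_c psy_c.
apply: (@schubert_free a _ (sy (sref b i) \o io 0 a.+1 b)%FUN (io 0 a.+1 b)) => [c|j lj] /=.
  by rewrite io_c psy_c.
by rewrite io_x 1?ltnW // sy_sx // swapn_id //; lia.
Qed.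

End Schubert.

(** * Alternants over Young subgroups *)

Section Alternants.
Variable S : polyFamily.
Variable N : nat.
Local Notation M := N.+1.
Local Notation RA := (pR S).
Local Notation PA k := (pP S k).
Local Notation q := (pq S).
Local Notation cst := (pcst S M).
Local Notation x := (px S M).
Local Notation sy := (psy S).
Local Notation hom d f := (phom d f).
Local Notation dd i f := (pdd i f).
Implicit Types (J K : {set 'I_N}) (f g h : PA M).

(** Membership for letters given as natural numbers; the letter t is the swap of positions t and t+1
    among N+1 positions. *)
Definition inJ J (t : nat) : bool := if insub t is Some i then i \in J else false.

Lemma inJE J (i : 'I_N) : inJ J i = (i \in J).
Proof. by rewrite /inJ valK. Qed.

Lemma inJ_lt J t : inJ J t -> (t < N)%N.
Proof. by rewrite /inJ; case: insubP. Qed.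

Lemma inJ_ord J t (l : (t < N)%N) : inJ J t = (Ordinal l \in J).
Proof. by rewrite -inJE. Qed.

Definition blk J (i j : nat) : bool := all (inJ J) (iota i (j - i)).

Lemma blkP J i j : reflect (forall t, (i <= t < j)%N -> inJ J t) (blk J i j).
Proof.
apply: (iffP allP) => h t; last by rewrite mem_iota => ht; apply: h; lia.
by move=> ht; apply: h; rewrite mem_iota; lia.
Qed.

Lemma blk_ge J i j : (j <= i)%N -> blk J i j.
Proof. by move=> h; apply/blkP => t; lia. Qed.

Definition grp J : {group 'S_M} := <<[set sref M (val i) | i in J]>>%G.

Lemma grp_sref J (i : 'I_N) : i \in J -> sref M i \in grp J.
Proof. by move=> h; apply: mem_gen; apply/imsetP; exists i. Qed.

Lemma grp_ind J (P : 'S_M -> Prop) : P 1%g ->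
  (forall (i : 'I_N) w, i \in J -> w \in grp J -> P w -> P (sref M i * w)%g) ->
  forall w, w \in grp J -> P w.
Proof.
move=> P1 PS w /gen_prodgP[n [c hc ->]].
suff : (\prod_(i < n) c i)%g \in grp J /\ P (\prod_(i < n) c i)%g by case.
elim: n c hc => [|n IH] c hc; first by rewrite big_ord0 group1.
rewrite big_ord_recl; have /imsetP[i iJ ->] := hc ord0.
have [h1 h2] := IH (fun j => c (lift ord0 j)) (fun j => hc _).
by split; [rewrite groupM ?grp_sref | apply: PS].
Qed.

Lemma grpS J K : K \subset J -> grp K \subset grp J.
Proof. by move=> h; apply: genS; apply: imsetS. Qed.

Lemma tperm_grp J (i j : 'I_M) : blk J i j -> blk J j i -> tperm i j \in grp J.
Proof.
wlog ij : i j / (i <= j)%N => [hw h1 h2|].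
  by have [|] := leqP i j => h; [|move/ltnW in h; rewrite tpermC]; apply: hw.
move=> h _; move Ed : (j - i)%N => d; elim: d i j ij h Ed => [|d IH] i j ij h Ed.
  have -> : i = j by apply: val_inj => /=; lia.
  by rewrite tperm1 group1.
have li : (i.+1 < M)%N by have := ltn_ord j; lia.
have lN : (i < N)%N by [].
have iJ : Ordinal lN \in J by rewrite -inJ_ord; apply: (blkP _ _ _ h); lia.
pose i' : 'I_M := Ordinal li.
have e : tperm i i' = sref M i.
  by rewrite (sref_tperm (ltnW li) li); congr tperm; apply: val_inj.
have [d0|d1] := posnP d.
  have -> : j = i' by apply: val_inj => /=; lia.
  by rewrite e (grp_sref iJ).
have t1 : tperm i' j \in grp J.
  apply: IH => /=; [lia| |lia].
  by apply/blkP => t ht; apply: (blkP _ _ _ h); lia.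
have -> : tperm i j = (tperm i' j ^ tperm i i')%g.
  rewrite tpermJ tpermR tpermD //; rewrite -val_eqE /=; lia.
by rewrite groupJ // e (grp_sref iJ).
Qed.

Definition Alt J f : PA M := \sum_(w in grp J) (-1) ^+ odd_perm w * sy w f.

Lemma AltD J f g : Alt J (f + g) = Alt J f + Alt J g.
Proof. by rewrite -big_split; apply: eq_bigr => w _; rewrite rmorphD mulrDr. Qed.

Lemma Alt0 J : Alt J 0 = 0.
Proof. by apply: big1 => w _; rewrite rmorph0 mulr0. Qed.

Lemma AltN J f : Alt J (- f) = - Alt J f.
Proof. by rewrite -sumrN; apply: eq_bigr => w _; rewrite rmorphN mulrN. Qed.

Lemma AltB J f g : Alt J (f - g) = Alt J f - Alt J g.
Proof. by rewrite AltD AltN. Qed.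

Lemma Alt_sum J (I : Type) (r : seq I) (P : pred I) (F : I -> PA M) :
  Alt J (\sum_(i <- r | P i) F i) = \sum_(i <- r | P i) Alt J (F i).
Proof. by apply: big_morph; [exact: AltD | exact: Alt0]. Qed.

Lemma Alt_invM J f g : (forall w, w \in grp J -> sy w f = f) ->
  Alt J (f * g) = f * Alt J g.
Proof.
move=> hf; rewrite /Alt mulr_sumr; apply: eq_bigr => w hw.
by rewrite rmorphM hf // mulrCA.
Qed.

Lemma Alt_cst J c f : Alt J (cst c * f) = cst c * Alt J f.
Proof. by apply: Alt_invM => w _; rewrite psy_c. Qed.

Lemma inv_grp J f : (forall i : 'I_N, i \in J -> sy (sref M i) f = f) ->
  forall w, w \in grp J -> sy w f = f.
Proof.
move=> hf; apply: grp_ind => [|i w iJ _ IH]; first by rewrite psy1.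
by rewrite psyM hf.
Qed.

Lemma Alt_sy J w f : w \in grp J -> Alt J (sy w f) = (-1) ^+ odd_perm w * Alt J f.
Proof.
move=> hw; rewrite /Alt [in RHS](reindex_inj (mulgI w)) mulr_sumr.
apply: eq_big => [u|u _] /=; first by rewrite groupMl.
by rewrite psyM odd_permM signr_addb !mulrA -expr2 sqrr_sign mul1r.
Qed.

Lemma sy_Alt J w f : w \in grp J -> sy w (Alt J f) = (-1) ^+ odd_perm w * Alt J f.
Proof.
move=> hw; rewrite /Alt rmorph_sum [in RHS](reindex_inj (mulIg w)) mulr_sumr /=.
apply: eq_big => [u|u _] /=; first by rewrite groupMr.
rewrite psyM odd_permM signr_addb rmorphM rmorphXn rmorphN rmorph1.
by rewrite [X in _ = _ * (X * _)]mulrC !mulrA -expr2 sqrr_sign mul1r.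
Qed.

Lemma hom_Alt J d f : hom d f -> hom d (Alt J f).
Proof.
move=> hf; apply: hom_sum => w _.
by case: (odd_perm w); rewrite ?mulN1r ?mul1r; [apply: homN|]; apply: hom_sy.
Qed.

Definition npairs J := #|[set p : 'I_M * 'I_M | (p.1 < p.2)%N && blk J p.1 p.2]|.

(* In an antisymmetric polynomial every monomial has distinct exponents on each
   block of J, hence degree at least npairs J. *)
Lemma Alt_small J d f : hom d f -> (d < npairs J)%N -> Alt J f = 0.
Proof.
move=> hf hd.
apply: (@panti_zero S M d (fun i j => blk J i j && blk J j i)); last first.
- apply: leq_trans hd _; rewrite /npairs; apply: subset_leq_card; apply/subsetP => p.
  by rewrite !inE => /andP[h ->]; rewrite h blk_ge // ltnW.
- exact: hom_Alt.
- move=> i j ij /andP[h1 h2].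
  by rewrite sy_Alt ?tperm_grp // odd_tperm ij mulN1r.
- move=> j i k /andP[/blkP a /blkP b] /andP[/blkP c /blkP d'].
  apply/andP; split; apply/blkP => t ht.
    by case: (ltnP t j) => h; [apply: a | apply: c]; lia.
  by case: (ltnP t j) => h; [apply: d' | apply: b]; lia.
by move=> i j; rewrite andbC.
Qed.

(** Average over the subgroup first: #|grp K| times the left side is the sum over u in [grp K] of
    [Alt J] applied to the signed u-translates of X f, that is [Alt J] of X times [Alt K f]. *)
Lemma Alt_sub J K X f : K \subset J -> (forall w, w \in grp K -> sy w X = X) ->
  Alt K f = 0 -> Alt J (X * f) = 0.
Proof.
move=> KJ hX hf; have : #|grp K|%:R * Alt J (X * f) = 0.
  transitivity (\sum_(u in grp K) Alt J (sy u ((-1) ^+ odd_perm u * (X * f)))).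
    rewrite mulr_natl -sumr_const; apply: eq_bigr => u hu.
    have hu' : u \in grp J by apply: (subsetP (grpS KJ)).
    rewrite rmorphM rmorphXn rmorphN rmorph1 [RHS]Alt_invM; last first.
      by move=> w _; rewrite rmorphXn rmorphN rmorph1.
    by rewrite Alt_sy // mulrA -expr2 sqrr_sign mul1r.
  rewrite -Alt_sum (eq_bigr (fun u => X * ((-1) ^+ odd_perm u * sy u f))).
    by rewrite -mulr_sumr -/(Alt K f) hf mulr0 Alt0.
  by move=> u hu; rewrite !rmorphM rmorphXn rmorphN rmorph1 hX // mulrCA.
move/eqP; rewrite mulf_eq0 => /orP[|/eqP //].
by case: #|grp K| (cardG_gt0 (grp K)) => // n _; rewrite (negbTE (PA_char0 _ _ _)).
Qed.

(** What remains of all factors q x_i - x_j within blocks once the adjacent ones have cancelled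
    against the denominator of the symmetrization. *)
Definition gapprod J : PA M :=
  \prod_(p : 'I_M * 'I_M | (p.1.+1 < p.2)%N && blk J p.1 p.2) (cst q * x p.1 - x p.2).

Definition ngap J := #|[set p : 'I_M * 'I_M | (p.1.+1 < p.2)%N && blk J p.1 p.2]|.

Lemma qx_hom i j : hom 1 (cst q * x i - x j).
Proof. by rewrite homB ?phom_x //; apply: homZ; apply: phom_x. Qed.

Lemma gapprod_hom J : hom (ngap J) (gapprod J).
Proof.
rewrite /ngap -sum1dep_card /gapprod; apply: hom_prod => p _; exact: qx_hom.
Qed.

Lemma ngapE J : (ngap J + #|J|)%N = npairs J.
Proof.
pose g (i : 'I_N) : 'I_M * 'I_M := (widen_ord (leqnSn N) i, lift ord0 i).
have ginj : injective g by move=> i j /(congr1 (fun p => val p.1)) /= e; apply: val_inj.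
rewrite /npairs -(card_imset J ginj) /ngap -cardsUI [X in (_ + X)%N]eq_card0 ?addn0; last first.
  move=> p; rewrite !inE; apply/negP => /andP[/andP[h _] /imsetP[i _ e]].
  by move: h; rewrite e /= /bump /=; lia.
apply: eq_card => -[a b]; rewrite !inE /=.
apply/idP/idP => [/orP[/andP[h ->]|/imsetP[i iJ [-> ->]]]|/andP[h hb]].
- by rewrite andbT; lia.
- rewrite /= /bump /= add1n ltnSn /=; apply/blkP => t ht.
  by rewrite (_ : t = i) ?inJE //; lia.
rewrite hb andbT; case: ltnP => //= h'; apply/imsetP.
have lN : (a < N)%N by have := ltn_ord b; lia.
exists (Ordinal lN); first by rewrite -inJ_ord; apply: (blkP _ _ _ hb); lia.
by congr (_, _); apply: val_inj; rewrite //= /bump /=; lia.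
Qed.

(* Up to the factor vander J, this is the q-divided symmetrization over the
   Young subgroup grp J. *)
Definition Lam J f := Alt J (f * gapprod J).

Lemma LamD J f g : Lam J (f + g) = Lam J f + Lam J g.
Proof. by rewrite /Lam mulrDl AltD. Qed.

Lemma LamB J f g : Lam J (f - g) = Lam J f - Lam J g.
Proof. by rewrite /Lam mulrBl AltB. Qed.

Lemma LamZ J c f : Lam J (cst c * f) = cst c * Lam J f.
Proof. by rewrite /Lam -mulrA Alt_cst. Qed.

Lemma Lam_small J e f : hom e f -> (e < #|J|)%N -> Lam J f = 0.
Proof.
move=> hf he; apply: (@Alt_small _ (e + ngap J)); first by apply: phomM; rewrite ?gapprod_hom.
by rewrite -ngapE; lia.
Qed.

Definition ysum (b : nat) : PA M := \sum_(t < M | (t <= b)%N) x t.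

Local Notation Y := ysum.

Lemma Y_hom b : hom 1 (Y b).
Proof. by apply: hom_sum => t _; apply: phom_x. Qed.

Lemma YS b : (b < N)%N -> Y b.+1 = Y b + x b.+1.
Proof.
move=> l; rewrite /ysum (bigD1 (Ordinal (l : b.+1 < M)%N)) //= addrC; congr (_ + _).
by apply: eq_bigl => t; rewrite -val_eqE /=; lia.
Qed.

Lemma Y0 : Y 0 = x 0.
Proof.
rewrite /ysum (bigD1 ord0) //= big1 ?addr0 // => t /andP[h]; rewrite -val_eqE /=; lia.
Qed.

Lemma sref_ltE (i : nat) (t : 'I_M) : (i < N)%N -> nat_of_ord (sref M i t) = swapn i t.
Proof. by move=> l; rewrite -(@pnat_sref M i t) // pnatE. Qed.

Lemma sy_Y i b : (i < N)%N -> i != b -> sy (sref M i) (Y b) = Y b.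
Proof.
move=> l ib; rewrite /ysum rmorph_sum [RHS](reindex_inj (@perm_inj _ (sref M i))) /=.
apply: eq_big => [t|t _].
  by rewrite sref_ltE // /swapn; do !case: eqP; lia.
by rewrite psy_x pnat_sref // sref_ltE.
Qed.

(** y_b is invariant under every s_i with i != b, so for b outside [J] it factors out of the
    alternating sum and leaves too small a degree. *)
Lemma Lam_Y J b e h : ~~ inJ J b -> hom e h -> (e < #|J|)%N -> Lam J (Y b * h) = 0.
Proof.
move=> bJ hh he; rewrite /Lam -mulrA Alt_invM.
  by rewrite -/(Lam J h) (Lam_small hh he) mulr0.
apply: inv_grp => i iJ; apply: sy_Y => //.
by apply: contraNneq bJ => <-; rewrite inJE.
Qed.

(** The factors of the pairs whose positions are separated when the letter [i] is removed from
    [J]. *)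
Definition cross J (i : nat) : PA M :=
  \prod_(p : 'I_M * 'I_M | (p.1 <= i < p.2)%N && blk J p.1 p.2) (cst q * x p.1 - x p.2).

Lemma blk_swap J (t : 'I_N) l m : t \in J -> blk J l m -> blk J (swapn t l) (swapn t m).
Proof.
move=> tJ /blkP h; apply/blkP => u.
have [->|ne] := eqVneq u t; first by rewrite inJE.
by move=> hu; apply: h; move: hu; rewrite /swapn; do !case: eqP; lia.
Qed.

Lemma blk_swapE J (t : 'I_N) l m : t \in J -> blk J (swapn t l) (swapn t m) = blk J l m.
Proof.
move=> tJ; apply/idP/idP => [/(blk_swap tJ)|]; last exact: blk_swap.
by rewrite !swapnK.
Qed.

Definition sref2 i (p : 'I_M * 'I_M) := (sref M i p.1, sref M i p.2).

Lemma sref2_inj i : injective (sref2 i).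
Proof. by move=> [a b] [c d] [/perm_inj -> /perm_inj ->]. Qed.

Lemma sy_prod_pairs (i : 'I_N) (P : pred ('I_M * 'I_M)) :
  (forall p, P (sref2 i p) = P p) ->
  sy (sref M i) (\prod_(p | P p) (cst q * x p.1 - x p.2)) = \prod_(p | P p) (cst q * x p.1 - x p.2).
Proof.
move=> hP; rewrite rmorph_prod [RHS](reindex_inj (@sref2_inj i)) /=.
apply: eq_big => [p|p _]; first by rewrite hP.
have l := ltn_ord i; by rewrite /sref2 rmorphB rmorphM /= psy_c !psy_x !pnat_sref // !sref_ltE.
Qed.

Lemma sy_cross J (i t : 'I_N) : t \in J -> t != i -> sy (sref M t) (cross J i) = cross J i.
Proof.
move=> tJ ti; apply: sy_prod_pairs => p; have lt := ltn_ord t; rewrite /sref2 /= !sref_ltE // blk_swapE //; congr (_ && _).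
by move: ti; rewrite -val_eqE /= /swapn; do !case: eqP; lia.
Qed.

Lemma blkD1 J (i : 'I_N) l m : blk (J :\ i) l m = blk J l m && ~~ (l <= i < m)%N.
Proof.
have e t : inJ (J :\ i) t = inJ J t && (t != i).
  rewrite /inJ; case: insubP => // j _ <-; by rewrite !inE andbC -val_eqE.
apply/blkP/andP => [h|[/blkP h n] t ht].
  split; first by apply/blkP => t /h; rewrite e => /andP[].
  by apply/negP => /h; rewrite e eqxx andbF.
by rewrite e h //=; apply: contra n => /eqP <-.
Qed.

Lemma gapprod_cross J (i : 'I_N) : i \in J ->
  gapprod J * (cst q * x i - x i.+1) = gapprod (J :\ i) * cross J i.
Proof.
move=> iJ; have l : (i.+1 < M)%N by rewrite ltnS.
pose a : 'I_M := Ordinal (ltnW l); pose b : 'I_M := Ordinal l.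
have ab : blk J i i.+1 by apply/blkP => t ht; rewrite (_ : t = i) ?inJE //; lia.
pose Q (p : 'I_M * 'I_M) := blk J p.1 p.2 && ((p.1.+1 < p.2)%N || (p == (a, b))).
transitivity (\prod_(p | Q p) (cst q * x p.1 - x p.2)).
  rewrite [RHS](bigD1 (a, b)) /=; last by rewrite /Q /= ab eqxx orbT.
  rewrite mulrC; congr (_ * _); apply: eq_bigl => -[c d]; rewrite /Q /=.
  have [[-> ->]|_] := eqVneq (c, d) (a, b); first by rewrite /= ltnn andbF.
  by rewrite orbF andbT andbC.
rewrite (bigID (fun p : 'I_M * 'I_M => (p.1 <= i < p.2)%N)) /= mulrC; congr (_ * _).
  apply: eq_bigl => -[c d]; rewrite /Q /= blkD1; case: (blk J c d); rewrite /= ?andbF //.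
  case: (boolP (c <= i < d)%N) => h; rewrite ?andbF // !andbT.
  case: eqP => [[ec ed]|]; rewrite ?orbF //.
  by move: h; rewrite ec ed /=; lia.
apply: eq_bigl => -[c d]; rewrite /Q /=; case: (blk J c d); rewrite ?andbF //=.
rewrite andbT; apply/idP/idP => [/andP[] //|h]; rewrite h andbT.
case: ltnP => //= h'; apply/eqP; congr (_, _); apply: val_inj => /=; lia.
Qed.

(** If [i] is in [J], the factor q x_i - x_{i+1} completes [gapprod J] to [gapprod (J :\ i)] times
    [cross J i]. Since y_i and [cross J i] are invariant under the subgroup of [J :\ i], [Alt_sub]
    reduces to that subgroup, where [h] has too small a degree. Otherwise [Lam_Y] applies. *)
Lemma Lam_rel J (i : 'I_N) e h : hom e h -> (e.+1 < #|J|)%N ->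
  Lam J (Y i * (cst q * x i - x i.+1) * h) = 0.
Proof.
move=> hh he; case: (boolP (i \in J)) => iJ; last first.
  rewrite -mulrA; apply: (@Lam_Y _ _ (1 + e)) => //; first by rewrite inJE.
  by apply: phomM; rewrite ?qx_hom.
rewrite /Lam; have -> : Y i * (cst q * x i - x i.+1) * h * gapprod J =
    (Y i * cross J i) * (h * gapprod (J :\ i)).
  transitivity (Y i * h * (gapprod J * (cst q * x i - x i.+1))); last rewrite gapprod_cross //.
    by move: (Y i) (cst q * _ - _) (gapprod J) => ? ? ?; ring.
  by move: (Y i) (gapprod _) (cross _ _) => ? ? ?; ring.
apply: (@Alt_sub _ (J :\ i)); first exact: subD1set.
  apply: inv_grp => t; rewrite !inE => /andP[ti tJ].
  by rewrite rmorphM sy_cross // sy_Y.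
by apply: (Lam_small hh); move: he; rewrite (cardsD1 i J) iJ add1n ltnS.
Qed.

(** Everything except [gapprod J2] is invariant under [grp J2], and [gapprod J2] alone has degree
    below [npairs J2] when [J2] is nonempty, so its alternating sum is 0. *)
Lemma Lam_component J1 J2 f : J1 :&: J2 = set0 ->
  (forall a b : 'I_N, a \in J1 -> b \in J2 -> (a.+1 < b)%N || (b.+1 < a)%N) ->
  J2 != set0 -> (forall i : 'I_N, i \in J2 -> sy (sref M i) f = f) ->
  Lam (J1 :|: J2) f = 0.
Proof.
move=> dis sep J2n hf.
have inU t : inJ (J1 :|: J2) t = inJ J1 t || inJ J2 t.
  by rewrite /inJ; case: insubP => // j _ _; rewrite inE.
have sepn s t : inJ J1 s -> inJ J2 t -> (s.+1 < t)%N || (t.+1 < s)%N.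
  move=> hs ht; have ls := inJ_lt hs; have lt := inJ_lt ht.
  by rewrite (inJ_ord _ ls) in hs; rewrite (inJ_ord _ lt) in ht; have := sep _ _ hs ht.
have blkU l m : blk (J1 :|: J2) l m = blk J1 l m || blk J2 l m.
  apply/idP/idP; last first.
    by case/orP => /blkP h; apply/blkP => t /h; rewrite inU => ->; rewrite ?orbT.
  move=> /blkP h; case: (ltnP l m) => lm; last by rewrite blk_ge.
  have := h l; rewrite leqnn lm inU => /(_ isT)/orP[hl|hl]; apply/orP; [left|right];
    apply/blkP => t; elim: t => [|t IH] ht.
  - by have -> : 0%N = l by lia.
  - have [e|ne] := eqVneq l t.+1; first by rewrite -e.
    have := h t.+1 ht; rewrite inU => /orP[//|h2].
    have := IH _; have -> : (l <= t < m)%N by lia.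
    by move=> /(_ isT) h1; have := sepn _ _ h1 h2; lia.
  - by have -> : 0%N = l by lia.
  have [e|ne] := eqVneq l t.+1; first by rewrite -e.
  have := h t.+1 ht; rewrite inU => /orP[h2|//].
  have := IH _; have -> : (l <= t < m)%N by lia.
  by move=> /(_ isT) h1; have := sepn _ _ h2 h1; lia.
have blk12 l m : (l < m)%N -> blk J1 l m -> blk J2 l m = false.
  move=> lm /blkP h1; apply/negP => /blkP h2.
  have hl : (l <= l < m)%N by rewrite leqnn.
  by have := sepn _ _ (h1 l hl) (h2 l hl); lia.
pose g1 : PA M := \prod_(p : 'I_M * 'I_M | (p.1.+1 < p.2)%N && blk J1 p.1 p.2) (cst q * x p.1 - x p.2).
have gE : gapprod (J1 :|: J2) = g1 * gapprod J2.
  rewrite /gapprod (bigID (fun p : 'I_M * 'I_M => blk J1 p.1 p.2)) /=; congr (_ * _).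
    by apply: eq_bigl => p; rewrite blkU; case: (blk J1 _ _); rewrite ?andbT ?andbF.
  apply: eq_bigl => p; rewrite blkU; case: (boolP (blk J1 _ _)) => h /=; last by rewrite andbT.
  by rewrite andbF; case: ltnP => //= h'; rewrite blk12 // ltnW.
rewrite /Lam gE mulrA; apply: (@Alt_sub _ J2); first exact: subsetUr.
  apply: inv_grp => i iJ; rewrite rmorphM hf //; congr (_ * _); apply: sy_prod_pairs => p; rewrite /sref2 /=.
  rewrite !sref_ltE //.
  have key l m : (l < m)%N -> blk J1 l m -> swapn i l = l /\ swapn i m = m.
    move=> lm /blkP h1; have iJ' : inJ J2 i by rewrite inJE.
    have hl := sepn _ _ (h1 l _) iJ'; have hm := sepn _ _ (h1 m.-1 _) iJ'.
    have {}hl := hl ltac:(lia); have {}hm := hm ltac:(lia).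
    by split; rewrite swapn_id //; lia.
  apply/andP/andP => [[h1 h2]|[h1 h2]].
    have [e1 e2] := key _ _ (ltnW h1) h2; rewrite !swapnK in e1 e2.
    by rewrite -e1 -e2 in h1 h2 *.
  by have [-> ->] := key _ _ (ltnW h1) h2.
apply: (@Alt_small _ (ngap J2)); first exact: gapprod_hom.
by rewrite -ngapE -[X in (X < _)%N]addn0 ltn_add2l card_gt0.
Qed.

(** On polynomials of degree e, words of e divided differences take constant values; for e = #|J|,
    two polynomials agreeing on all words in [J] have the same [Lam J]. *)
Fixpoint ddkill J (e : nat) (f : PA M) : Prop :=
  match e with
  | 0 => f = 0
  | e'.+1 => forall i : 'I_N, i \in J -> ddkill J e' (dd i f)
  end.

(** Replacing f - s_i f by (x_i - x_{i+1}) dd_i f trades one degree of [f] for one degree of the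
    cofactor [p], so only the total c + e is constrained. By induction [Alt J] of p times w f does
    not depend on w; after averaging, the symmetrized [f] factors out and [Alt J p] vanishes by
    degree. *)
Lemma Alt_ddkill J e c p f : hom e f -> ddkill J e f -> hom c p ->
  (c + e <= npairs J)%N -> Alt J (p * f) = 0.
Proof.
elim: e c p f => [|e IH] c p f hf kf hp hc; first by rewrite kf mulr0 Alt0.
have key w : w \in grp J -> forall c p, hom c p -> (c + e.+1 <= npairs J)%N ->
    Alt J (p * sy w f) = Alt J (p * f).
  move=> hw {c p hp hc}; elim/(@grp_ind J): w / hw => [|i w iJ hw IHw] c p hp hc.
    by rewrite psy1.
  have l : (i.+1 < M)%N by rewrite ltnS.
  rewrite psyM.
  have -> : sy (sref M i) f = f - (x i - x i.+1) * dd i f by rewrite pddP // subKr.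
  rewrite rmorphB mulrBr AltB (IHw c) //.
  have -> : p * sy w ((x i - x i.+1) * dd i f) =
            sy w ((sy w^-1%g p * (x i - x i.+1)) * dd i f).
    by rewrite !rmorphM /= -(psyM w^-1%g) mulVg psy1 mulrA.
  have h1 : hom e (dd i f) := phom_dd l hf.
  have h2 : hom (c + 1) (sy w^-1%g p * (x i - x i.+1)).
    by apply: phomM; [apply: hom_sy | apply: xB_hom].
  rewrite Alt_sy // (IH _ _ _ h1 (kf i iJ) h2) ?mulr0 ?subr0 //; lia.
have : #|grp J|%:R * Alt J (p * f) = 0.
  transitivity (Alt J (p * \sum_(w in grp J) sy w f)).
    rewrite [in RHS]mulr_sumr [RHS]Alt_sum mulr_natl -sumr_const; apply: eq_bigr => w hw.
    by rewrite (key w hw c).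
  rewrite mulrC Alt_invM; first by rewrite (Alt_small hp) ?mulr0 //; lia.
  move=> w hw; rewrite rmorph_sum [RHS](reindex_inj (mulIg w)) /=.
  by apply: eq_big => [u|u _]; rewrite ?groupMr // psyM.
move/eqP; rewrite mulf_eq0 => /orP[|/eqP //].
by case: #|grp J| (cardG_gt0 (grp J)) => // n _; rewrite (negbTE (PA_char0 _ _ _)).
Qed.

Lemma Lam_ddkill J f : hom #|J| f -> ddkill J #|J| f -> Lam J f = 0.
Proof.
move=> hf kf; rewrite /Lam mulrC; apply: (Alt_ddkill hf kf (gapprod_hom J)).
by rewrite ngapE.
Qed.

Definition q1 : {rmorphism PA M -> PA M} := pmm M (cst \o pspec S)%FUN x.

Lemma q1_x i : (i < M)%N -> q1 (x i) = x i.
Proof. exact: pmm_x. Qed.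

Lemma q1_q : q1 (cst q) = 1.
Proof. by rewrite /q1 pmm_c /= pspecq rmorph1. Qed.

Lemma q1_sy w f : q1 (sy w f) = sy w (q1 f).
Proof.
move: f; apply: (@pext S M _ (q1 \o sy w)%FUN (sy w \o q1)%FUN) => [c|i l] /=.
  by rewrite psy_c /q1 pmm_c /= psy_c.
by rewrite psy_x !q1_x ?psy_x // pnat_lt.
Qed.

Definition vander J : PA M :=
  \prod_(p : 'I_M * 'I_M | (p.1 < p.2)%N && blk J p.1 p.2) (x p.1 - x p.2).

Lemma sy_vander J w : w \in grp J -> sy w (vander J) = (-1) ^+ odd_perm w * vander J.
Proof.
move: w; apply: grp_ind => [|i w iJ _ IH]; first by rewrite psy1 odd_perm1 mul1r.
have l : (i.+1 < M)%N by rewrite ltnS.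
rewrite psyM odd_permM odd_sref // signr_addb -mulrA -IH.
have -> : sy (sref M i) (vander J) = - vander J.
  pose a : 'I_M := Ordinal (ltnW l); pose b : 'I_M := Ordinal l.
  have ab : blk J i i.+1 by apply/blkP => t ht; rewrite (_ : t = i) ?inJE //; lia.
  rewrite /vander (bigD1 (a, b)) /=; last by rewrite ltnSn ab.
  rewrite rmorphM rmorphB /= !sy_sx // swapn_l swapn_r -mulNr opprB; congr (_ * _).
  rewrite rmorph_prod [RHS](reindex_inj (@sref2_inj i)) /=.
  apply: eq_big => [[c d]|[c d] _] /=.
    rewrite !sref_ltE // blk_swapE // -!andbA andbC [RHS]andbC -!andbA; congr (_ && _).
    rewrite /sref2 /= -[a]/(a) !xpair_eqE -!val_eqE /= !sref_ltE //.
    by rewrite /swapn; do !case: eqP => //=; lia.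
  by rewrite /sref2 rmorphB /= !psy_x !pnat_sref // !sref_ltE.
by rewrite rmorphN expr1 mulN1r.
Qed.

Lemma vander_neq0 J : vander J != 0.
Proof.
apply/prodf_neq0 => p /andP[h _]; apply: px_sub_neq0; first exact: ltn_ord.
by rewrite neq_ltn h.
Qed.

(** For full [J] this is the denominator of the symmetrization; in general it is a test polynomial
    of the right degree on which [Lam J] is visibly nonzero. *)
Definition adjprod J : PA M := \prod_(i in J) (cst q * x i - x i.+1).

Lemma adjprod_hom J : hom #|J| (adjprod J).
Proof. rewrite -sum1_card; apply: hom_prod => i _; exact: qx_hom. Qed.

Lemma adjprod_gap J : adjprod J * gapprod J =
  \prod_(p : 'I_M * 'I_M | (p.1 < p.2)%N && blk J p.1 p.2) (cst q * x p.1 - x p.2).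
Proof.
rewrite [RHS](bigID (fun p : 'I_M * 'I_M => (p.1.+1 < p.2)%N)) /= mulrC; congr (_ * _).
  by apply: eq_bigl => p; case: (blk _ _ _); rewrite ?andbF //= !andbT; lia.
pose g (i : 'I_N) : 'I_M * 'I_M := (widen_ord (leqnSn N) i, lift ord0 i).
have ginj : injective g by move=> i j /(congr1 (fun p => val p.1)) /= e; apply: val_inj.
have -> : adjprod J = \prod_(p in g @: J) (cst q * x p.1 - x p.2).
  by rewrite big_imset /=; [apply: eq_bigr => i _ | move=> i j _ _; apply: ginj].
apply: eq_bigl => -[a b] /=; apply/imsetP/idP => [[i iJ [-> ->]]|/andP[/andP[h hb] h']].
  rewrite /= /bump /= add1n ltnSn /= ltnn andbT; apply/blkP => t ht.
  by rewrite (_ : t = i) ?inJE //; lia.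
have lN : (a < N)%N by have := ltn_ord b; lia.
exists (Ordinal lN); first by rewrite -inJ_ord; apply: (blkP _ _ _ hb); lia.
by congr (_, _); apply: val_inj; rewrite //= /bump /=; lia.
Qed.

(* At q = 1 this is #|grp J| times the product of the x_i - x_j. *)
Lemma Lam_adjprod J : Lam J (adjprod J) != 0.
Proof.
rewrite /Lam adjprod_gap; apply/eqP => /(congr1 q1); rewrite rmorph0 /Alt rmorph_sum.
rewrite (eq_bigr (fun=> vander J)) => [|w hw].
  rewrite sumr_const => /eqP; rewrite -mulr_natl mulf_eq0 (negbTE (vander_neq0 J)) orbF.
  by case: #|grp J| (cardG_gt0 (grp J)) => // n _; rewrite (negbTE (PA_char0 _ _ _)).
rewrite rmorphM rmorphXn rmorphN rmorph1 q1_sy.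
have -> : q1 (\prod_(p : 'I_M * 'I_M | (p.1 < p.2)%N && blk J p.1 p.2) (cst q * x p.1 - x p.2)) = vander J.
  rewrite rmorph_prod; apply: eq_bigr => p _.
  by rewrite rmorphB rmorphM q1_q mul1r /= !q1_x ?ltn_ord.
by rewrite sy_vander // mulrA -expr2 sqrr_sign mul1r.
Qed.

End Alternants.

(** * Reduction to squarefree products of partial sums *)

Section Reduction.
Variable S : polyFamily.
Local Notation RA := (pR S).
Local Notation PA k := (pP S k).
Local Notation q := (pq S).
Local Notation hom d f := (phom d f).

Definition qi (m : nat) : RA := \sum_(i < m) q ^+ i.

Lemma qiS m : qi m.+1 = qi m + q ^+ m.
Proof. by rewrite /qi big_ord_recr. Qed.

Lemma qi0 : qi 0 = 0.
Proof. by rewrite /qi big_ord0. Qed.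

Lemma qiD m k : qi (m + k) = qi m + q ^+ m * qi k.
Proof.
elim: k => [|k IH]; first by rewrite addn0 qi0 mulr0 addr0.
by rewrite addnS !qiS IH mulrDr exprD addrA.
Qed.

Lemma qi_neq0 m : qi m.+1 != 0.
Proof.
apply/eqP => /(congr1 (pspec S)); rewrite /qi rmorph_sum rmorph0.
rewrite (eq_bigr (fun=> 1)) => [|i _]; last by rewrite rmorphXn pspecq expr1n.
by rewrite sumr_const card_ord => /eqP; rewrite (negbTE (pchar0 _ _)).
Qed.

Variable N : nat.
Local Notation M := N.+1.
Local Notation cst := (pcst S M).
Local Notation x := (px S M).
Local Notation Y := (@ysum S N).
Implicit Types (I J : {set 'I_N}) (f g h : PA M).

(** The functionals to which the reduction applies. The relations are required in total degree [d]
    only, since [Lam J] satisfies them only there. The flag [b] adds the relation y_N = 0, which the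
    evaluation at powers of q violates. [T] varies because the functionals have different target
    rings. *)
Record good (T : nat) (b : bool) (d : nat) (L : PA M -> PA T) : Prop := Good {
  goodD : forall f g, L (f + g) = L f + L g;
  goodZ : forall c f, L (cst c * f) = pcst S T c * L f;
  good_rel : forall (i : 'I_N) e h, hom e h -> e.+2 = d ->
    L (Y i * (cst q * x i - x i.+1) * h) = 0;
  good_top : b -> forall e h, hom e h -> e.+1 = d -> L (Y N * h) = 0 }.

Definition YI I : PA M := \prod_(i in I) Y i.

Lemma YI_hom I : hom #|I| (YI I).
Proof. rewrite -sum1_card; apply: hom_prod => i _; exact: Y_hom. Qed.

(* Modulo the relations, a nonzero multiple of f is a combination of the y_I
   with #|I| = d. *)
Definition redu b d f : Prop := exists k (c : {set 'I_N} -> RA), k != 0 /\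
  forall T (L : PA M -> PA T), good b d L ->
    pcst S T k * L f = \sum_(I : {set 'I_N} | #|I| == d) pcst S T (c I) * L (YI I).

Section Closure.
Variables (b : bool) (d : nat).

Lemma good0 T (L : PA M -> PA T) : good b d L -> L 0 = 0.
Proof.
by case=> _ hZ _ _; have := hZ 0 0; rewrite !rmorph0 !mul0r.
Qed.

Lemma goodN T (L : PA M -> PA T) f : good b d L -> L (- f) = - L f.
Proof.
case=> _ hZ _ _; have := hZ (-1) f; by rewrite !rmorphN1 !mulN1r.
Qed.

Lemma redu_eq f g : (forall T (L : PA M -> PA T), good b d L -> L f = L g) ->
  redu b d f -> redu b d g.
Proof.
move=> e [k [c [k0 h]]]; exists k, c; split=> // T L gL.
by rewrite -(e T L gL) h.
Qed.

Lemma redu0 : redu b d 0.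
Proof.
exists 1, (fun=> 0); split; first exact: oner_neq0.
move=> T L gL; rewrite (good0 gL) mulr0 big1 // => I _.
by rewrite rmorph0 mul0r.
Qed.

Lemma reduD f g : redu b d f -> redu b d g -> redu b d (f + g).
Proof.
move=> [k [c [k0 h]]] [k' [c' [k0' h']]].
exists (k * k'), (fun I => k' * c I + k * c' I); split; first exact: mulf_neq0.
move=> T L gL; have [hD _ _ _] := gL; rewrite hD mulrDr.
have -> : pcst S T (k * k') * L f = pcst S T k' * (pcst S T k * L f).
  by rewrite rmorphM mulrAC mulrC.
have -> : pcst S T (k * k') * L g = pcst S T k * (pcst S T k' * L g).
  by rewrite rmorphM mulrA.
rewrite (h T L gL) (h' T L gL) !mulr_sumr -big_split; apply: eq_bigr => I _ /=.
by rewrite rmorphD !rmorphM mulrDl !mulrA.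
Qed.

Lemma reduZ a f : redu b d f -> redu b d (cst a * f).
Proof.
move=> [k [c [k0 h]]]; exists k, (fun I => a * c I); split=> // T L gL.
have [_ hZ _ _] := gL; rewrite hZ mulrCA (h T L gL) mulr_sumr.
by apply: eq_bigr => I _; rewrite rmorphM mulrA.
Qed.

Lemma reduN f : redu b d f -> redu b d (- f).
Proof. by move/(reduZ (-1)); rewrite rmorphN1 mulN1r. Qed.

Lemma redu_cancel a f : a != 0 -> redu b d (cst a * f) -> redu b d f.
Proof.
move=> a0 [k [c [k0 h]]]; exists (k * a), c; split; first exact: mulf_neq0.
move=> T L gL; have [_ hZ _ _] := gL.
by rewrite rmorphM -mulrA -hZ h.
Qed.

Lemma redu_YI I : #|I| = d -> redu b d (YI I).
Proof.
move=> hI; exists 1, (fun I' => (I' == I)%:R); split; first exact: oner_neq0.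
move=> T L gL; rewrite rmorph1 mul1r (bigD1 I) /=; last exact/eqP.
rewrite eqxx rmorph1 mul1r big1 ?addr0 // => I' /andP[_ /negbTE ->].
by rewrite rmorph0 mul0r.
Qed.

End Closure.

Definition Ym (a : nat) : PA M := if a is a'.+1 then Y a' else 0.

Lemma Y_Ym j : (j <= N)%N -> Y j = Ym j + x j.
Proof. by case: j => [|j] h /=; rewrite ?add0r ?Y0 // YS. Qed.

Lemma YI_remove I (i : 'I_N) : i \in I -> YI I = Y i * YI (I :\ i).
Proof. by move=> h; rewrite /YI (big_setD1 i). Qed.

(** Each y_t with t in the run is a factor of [YI I], so the relation turns x_{t+1} into q x_t; the
    right end [c] itself need not be in [I]. *)
Lemma run_x T b d (L : PA M -> PA T) I h e a c : good b d L -> hom e h ->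
  (e + #|I|).+1 = d -> blk I a c -> forall t, (a <= t <= c)%N ->
  L (h * YI I * x t) = pcst S T (q ^+ (t - a)) * L (h * YI I * x a).
Proof.
move=> gL hh hd /blkP hI; elim=> [|t IH] ht.
  by (have -> : a = 0%N by lia); rewrite rmorph1 mul1r.
have [->|ne] := eqVneq a t.+1; first by rewrite subnn rmorph1 mul1r.
have hat : (a <= t < c)%N by lia.
have tI := hI t hat; have lt := inJ_lt tI; pose i := Ordinal lt.
have iI : i \in I by rewrite -inJE.
rewrite subSn; last lia.
rewrite exprS rmorphM -[RHS]mulrA -IH; last lia.
have [hD hZ hR _] := gL; rewrite -hZ.
apply/esym/eqP; rewrite -subr_eq0 -(goodN _ gL) -hD; apply/eqP.
have -> : cst q * (h * YI I * x t) - h * YI I * x t.+1 =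
   Y i * (cst q * x i - x i.+1) * (h * YI (I :\ i)).
  rewrite (YI_remove iI) /=; move: (Y t) (x t) (x t.+1) (cst q) (YI _) => y x1 x2 c1 z; ring.
apply: (hR i (e + #|I :\ i|)%N).
  by apply: phomM; rewrite ?YI_hom.
by rewrite -hd (cardsD1 i I) iI add1n addnS.
Qed.

(** Summing the geometric progression of [run_x]. The instances at t and at [c], with x_a
    eliminated, are the exchange relation that moves a repeated y_t to the two ends of its run. *)
Lemma run_Y T b d (L : PA M -> PA T) I h e a c : good b d L -> hom e h ->
  (e + #|I|).+1 = d -> blk I a c -> forall t, (a <= t <= c)%N -> (t <= N)%N ->
  L (h * YI I * Y t) = L (h * YI I * Ym a) + pcst S T (qi (t - a).+1) * L (h * YI I * x a).
Proof.
move=> gL hh hd hI; have [hD _ _ _] := gL.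
have base t : (t <= N)%N -> L (h * YI I * Y t) = L (h * YI I * Ym t) + L (h * YI I * x t).
  by move=> lt; rewrite -hD -mulrDr -Y_Ym.
elim=> [|t IH] ht lt; rewrite base //.
  by (have -> : a = 0%N by lia); rewrite qiS qi0 add0r rmorph1 mul1r.
have [->|ne] := eqVneq a t.+1; first by rewrite subnn qiS qi0 add0r rmorph1 mul1r.
rewrite /= IH; [|lia|lia].
rewrite (run_x gL hh hd hI ht) -addrA; congr (_ + _).
rewrite subSn; last lia.
by rewrite -mulrDl -rmorphD [in RHS]qiS.
Qed.

(** Write a variable as y_j - y_{j-1} and absorb each y into [YI I]: directly if its index is new,
    by the exchange relation otherwise. [B] bounds all indices in play and grows by one per absorbed
    variable; with [B + size s <= N] the index N is never reached, so the flag can be false. *)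
Lemma redu_mono b d s B I : all (fun j => j < M)%N s -> (size s + #|I|)%N = d ->
  b || [&& (B + size s <= N)%N, all (fun j => j < B)%N s & [forall i in I, (i < B)%N]] ->
  redu b d ((\prod_(j <- s) x j) * YI I).
Proof.
elim: s B I => [|j s IH] B I; first by rewrite big_nil mul1r => _ hI _; exact: redu_YI.
move=> /= /andP[jM sM] hd hB; rewrite big_cons.
set h := \prod_(i <- s) x i.
have hh : hom (size s) h.
  by rewrite -count_predT; apply: hom_prod1 => i _; apply: phom_x.
have hd' : (size s + #|I|).+1 = d by rewrite -hd addSn.
have addY t : (t <= N)%N -> ~~ inJ I t -> b || (t < B.+1)%N -> redu b d (h * YI I * Y t).
  move=> tN tI tB; have [eN|ltN] : t = N \/ (t < N)%N by lia.
    (* Without the flag t <= B < N, so t = N forces the flag and [good_top] discards the term. *)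
    have bT : b by move: hB tB; case: (b) => //=; lia.
    apply: redu_eq (redu0 b d) => T L gL; rewrite (good0 gL) eN mulrC.
    have [_ _ _ hY] := gL; apply/esym; apply: (hY bT (size s + #|I|)%N) => //.
    by apply: phomM; rewrite ?YI_hom.
  have := IH B.+1 (Ordinal ltN |: I) sM.
  have nI : Ordinal ltN \notin I by rewrite -inJE.
  rewrite cardsU1 nI /YI (big_setU1 _ nI) /= -/(YI I) mulrA mulrAC; apply; first by rewrite -hd' add1n addnS.
  case: (b) hB tB => //= /and3P[h1 /andP[_ h2] /forall_inP h3] tB; apply/and3P; split; first lia.
    by apply/allP => u /(allP h2); lia.
  by apply/forall_inP => i; rewrite !inE => /orP[/eqP -> //|/h3]; lia.
have redY t : (t <= N)%N -> b || (t < B)%N -> redu b d (h * YI I * Y t).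
  move=> tN tB; case: (boolP (inJ I t)) => tI; last first.
    by apply: addY => //; case: (b) tB => //=; lia.
  have exa : exists a, blk I a t.+1 by exists t; apply/blkP => u hu; (have -> : u = t by lia).
  case: (ex_minnP exa) => a ha amin.
  have lat : (a <= t)%N by apply: amin; apply/blkP => u hu; (have -> : u = t by lia).
  have exc : exists c, (t < c)%N && ~~ inJ I c.
    by exists N; rewrite (inJ_lt tI) /=; apply/negP => /inJ_lt; rewrite ltnn.
  case: (ex_minnP exc) => c /andP[tc cI] cmin.
  have cN : (c <= N)%N.
    by apply: cmin; rewrite (inJ_lt tI) /=; apply/negP => /inJ_lt; rewrite ltnn.
  have hac : blk I a c.
    apply/blkP => u hu; have [ut|ut] := leqP u t; first by apply: (blkP _ _ _ ha); lia.
    by apply/negPn/negP => nu; have := cmin u; rewrite ut nu => /(_ isT); lia.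
  (* [Ym a] is 0 or y_{a-1}, and a-1 is outside [I] because [a] is the left end of the run
     containing t. *)
  have R1 : redu b d (h * YI I * Ym a).
    case: a ha amin lat hac => [|a] ha amin lat hac /=; first by rewrite mulr0; exact: redu0.
    apply: addY; first lia.
      apply/negP => aI; have := amin a; apply/implyP; rewrite implybE negb_or; apply/andP; split.
        apply/negPn/blkP => u hu; have [->//|ne] := eqVneq u a; apply: (blkP _ _ _ ha); lia.
      lia.
    by case: (b) tB => //=; lia.
  have R2 : redu b d (h * YI I * Y c).
    apply: addY => //; case: (b) hB => //= /and3P[_ _ /forall_inP h3].
    have cI' : inJ I c.-1 by apply: (blkP _ _ _ hac); lia.
    by have := h3 (Ordinal (inJ_lt cI')); rewrite -inJE => /(_ cI') /=; lia.
  (* Eliminating x_a between [run_Y] at t and at [c] costs the factor [c-a+1]. *)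
  apply: (@redu_cancel _ _ (qi (c - a).+1)); first exact: qi_neq0.
  pose f2 := cst (qi (c - a).+1) * (h * YI I * Ym a) +
             cst (qi (t - a).+1) * (h * YI I * Y c - h * YI I * Ym a).
  apply: (@redu_eq _ _ f2); last first.
    by apply: reduD; apply: reduZ => //; apply: reduD => //; apply: reduN.
  move=> T L gL; have [hD hZ _ _] := gL.
  rewrite /f2 !(hD, hZ) (goodN _ gL).
  rewrite (run_Y gL hh hd' hac (t := c)) ?(run_Y gL hh hd' hac (t := t)) //; try lia.
  move: (L _) (L _) (pcst _ _ _) (pcst _ _ _) => u v c1 c2; ring.
have -> : x j * h * YI I = h * YI I * Y j - h * YI I * Ym j.
  rewrite Y_Ym //; move: (Ym j) (x j) (YI I) => u v w; ring.
have jB : b || (j < B)%N by case: (b) hB => //= /and3P[_ /andP[]].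
apply: reduD; first exact: redY.
apply: reduN; case: j jM jB {hB hd} => [|j] jM jB /=; first by rewrite mulr0; exact: redu0.
by apply: redY; [lia | case: (b) jB => //=; lia].
Qed.

Lemma YI_set0 : YI set0 = 1.
Proof. by rewrite /YI big_set0. Qed.

Lemma redu_hom d f : hom d f -> redu true d f.
Proof.
move: f; apply: phom_ind => [|f g|c s hs hl]; [exact: redu0 | exact: reduD |].
apply: reduZ; have := @redu_mono true d s 0 set0 hl _ isT.
by rewrite cards0 addn0 YI_set0 mulr1; apply.
Qed.

Lemma redu_io r d (f : PA r) : (r + d <= N)%N -> hom d f -> redu false d (io S 0 r M f).
Proof.
move=> hr; move: f; apply: phom_ind => [|f g h1 h2|c s hs hl].
- by rewrite rmorph0; exact: redu0.
- by rewrite rmorphD; exact: reduD.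
rewrite rmorphM io_c rmorph_prod; apply: reduZ.
have -> : \prod_(i <- s) io S 0 r M (px S r i) = \prod_(i <- s) x i.
  rewrite big_seq [RHS]big_seq; apply: eq_bigr => i /(allP hl) li; by rewrite io_x.
have := @redu_mono false d s r set0; rewrite cards0 addn0 YI_set0 mulr1; apply=> //.
  by apply/allP => i /(allP hl); lia.
rewrite /= hs hr hl /=; by apply/forall_inP => i; rewrite inE.
Qed.

Lemma inJ_top J : ~~ inJ J N.
Proof. by apply/negP => /inJ_lt; rewrite ltnn. Qed.

Lemma good_Lam J : good true #|J| (@Lam S N J).
Proof.
split=> [f g|c f|i e h hh he|_ e h hh he]; [exact: LamD | exact: LamZ | |].
  by apply: (Lam_rel _ hh); rewrite -he.
by apply: (Lam_Y (inJ_top J) hh); rewrite -he.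
Qed.

Lemma Lam_YI I J : #|I| = #|J| -> I != J -> Lam J (YI I) = 0.
Proof.
move=> hc ne; have : ~~ (I \subset J).
  by apply: contra ne => sIJ; rewrite eqEcard sIJ hc /=.
case/subsetPn => i iI iJ; rewrite (YI_remove iI); apply: (Lam_Y _ (YI_hom _)); first by rewrite inJE.
by rewrite -hc (cardsD1 i I) iI.
Qed.

Lemma Lam_redu J f k c :
  (pcst S M k * Lam J f = \sum_(I : {set 'I_N} | #|I| == #|J|) cst (c I) * Lam J (YI I)) ->
  cst k * Lam J f = cst (c J) * Lam J (YI J).
Proof.
move=> ->; rewrite (bigD1 J) //= big1 ?addr0 // => I /andP[/eqP hI ne].
by rewrite Lam_YI ?mulr0.
Qed.

(** Under [Lam J] a nonzero multiple of [adjprod J] becomes a multiple of [YI J], and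
    [Lam J (adjprod J)] is nonzero. *)
Lemma Lam_YI_neq0 J : Lam J (YI J) != 0.
Proof.
have [k [c [k0 h]]] := redu_hom (adjprod_hom S J).
have := Lam_redu (h _ _ (good_Lam J)); apply: contra_eq_neq => ->.
by rewrite mulr0 mulf_neq0 ?Lam_adjprod // -(rmorph0 cst) (inj_eq (@pcst_inj S M)).
Qed.

End Reduction.

(** * Windows *)

(** [w] does not preserve the prefix of positions up to [b]; equivalently, the letter s_b occurs in
    the reduced words of [w]. *)
Definition moves k (b : nat) (w : 'S_k) : Prop := exists2 t, (t <= b)%N & (b < pnat w t)%N.

Lemma moves_sref k b i (w : 'S_k) : (i.+1 < k)%N -> i != b -> moves b w ->
  moves b (sref k i * w)%g.
Proof.
move=> l ib [t tb bt]; exists (swapn i t).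
  by move: tb ib; rewrite /swapn; do !case: eqP; lia.
by rewrite pnatM pnat_sref // swapnK.
Qed.

(** Removing a descent i shortens [w] by one and can affect only the prefix ending at i, so [B]
    loses at most one element per step. For indecomposable v this yields p <= d. *)
Lemma moves_length k (w : 'S_k) (B : seq nat) : uniq B ->
  (forall b, b \in B -> moves b w) -> (size B <= perm_length w)%N.
Proof.
move e : (perm_length w) => n; elim: n w B e => [|n IH] w B e uB hB.
  case: B uB hB => // b B _ /(_ b); rewrite inE eqxx (perm_length0 e) => /(_ isT) [t].
  by rewrite pnat1; lia.
have [|[i [l h]]] : (forall i, (i.+1 < k)%N -> asc w i) \/ exists i, (i.+1 < k)%N /\ ~~ asc w i.
- case: (boolP [forall i : 'I_k, (i.+1 < k)%N ==> asc w i]) => [/forallP h|].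
    by left=> i l; have := h (Ordinal (ltnW l)); rewrite /= l.
  by rewrite negb_forall => /existsP[i]; rewrite negb_imply => /andP[]; right; exists i.
- by move=> h; have := perm_length_allasc h; rewrite e.
have hl := perm_length_desc l h; rewrite e in hl; case: hl => hl.
have := IH (sref k i * w)%g (rem i B) (esym hl) (rem_uniq _ uB).
have h' : forall b, b \in rem i B -> moves b (sref k i * w)%g.
  move=> b; rewrite mem_rem_uniq // inE => /andP[bi bB].
  by apply: moves_sref => //; [rewrite eq_sym | apply: hB].
move/(_ h'); case: (boolP (i \in B)) => iB; first by rewrite size_rem //; case: (size B).
by rewrite rem_id // => h2; apply: leqW.
Qed.

Section Windows.
Variable S : polyFamily.
Local Notation RA := (pR S).
Local Notation PA k := (pP S k).
Local Notation q := (pq S).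
Local Notation hom d f := (phom d f).
Local Notation dd i f := (pdd i f).
Local Notation sch w := (schubertA S w).
Local Notation qi := (qi S).

Section Kill.
Variables (N r : nat).
Local Notation M := N.+1.
Hypothesis rM : (r <= M)%N.
Local Notation io0 := (io S 0 r M).
Implicit Types J : {set 'I_N}.

Lemma dd_io0 (w : 'S_r) i : (i.+1 < M)%N ->
  dd i (io0 (sch w)) = if (i.+1 < r)%N && ~~ asc w i then io0 (sch (sref r i * w)%g) else 0.
Proof.
move=> l; case: (ltnP i.+1 r) => h /=; last by rewrite io0_schubert_inv.
by rewrite -[i in LHS]add0n -io_dd // dd_schubert //; case: asc; rewrite //= rmorph0.
Qed.

Lemma ddkill0 J e : ddkill J e (0 : PA M).
Proof.
elim: e => //= e IH i _; have l : (i.+1 < M)%N by rewrite ltnS.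
by rewrite dd_inv // rmorph0.
Qed.

(** Letters other than [b] leave the prefix up to [b] moved, whereas the identity moves no prefix;
    hence no word with letters in [J] descends from [w] to the identity. *)
Lemma ddkill_moves J b e (w : 'S_r) : ~~ inJ J b -> moves b w -> perm_length w = e ->
  ddkill J e (io0 (sch w)).
Proof.
move=> bJ; elim: e w => [|e IH] w mv hw /=.
  by case: mv => t; rewrite (perm_length0 hw) pnat1; lia.
move=> i iJ; rewrite dd_io0 ?ltnS //; case: ifP => [/andP[l h]|_]; last exact: ddkill0.
apply: IH; last by move: hw; rewrite (perm_length_desc l h) => -[].
by apply: moves_sref => //; apply: contraNneq bJ => <-; rewrite inJE.
Qed.

(** Inside the window [w] and the shifted [u] have the same ascents, so each word in [J] acts alike
    on both polynomials, and at length 0 both are 1. *)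
Lemma ddkill_shifted J m a e (w : 'S_r) (u : 'S_a) : (m + a <= M)%N ->
  (forall i : 'I_N, i \in J -> (m <= i)%N && (i.+1 < m + a)%N) ->
  shifted m w u -> perm_length w = e ->
  ddkill J e (io0 (sch w) - io S m a M (sch u)).
Proof.
move=> ma hJ; elim: e w u => [|e IH] w u sh hw /=.
  have hu : u = 1%g by apply: perm_length0; rewrite -(perm_length_shifted sh).
  by rewrite hu (perm_length0 hw) !schubert1 !rmorph1 subrr.
move=> i iJ; have /andP[mi im] := hJ i iJ; have l : (i.+1 < M)%N by rewrite ltnS.
have [i' ei] : exists i', nat_of_ord i = (m + i')%N by exists (i - m)%N; lia.
have l' : (i'.+1 < a)%N by lia.
have [sh1 sh2] := sh.
have eas : asc w i = asc u i' by rewrite /asc ei -addnS !sh1 ltn_add2l.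
rewrite ddB // dd_io0 // [dd i (io S m a M _)](_ : _ = io S m a M (dd i' (sch u))); last first.
  by rewrite ei io_dd.
rewrite dd_schubert // -eas; case: (boolP (asc w i)) => h /=.
  by rewrite andbF rmorph0 subrr; exact: ddkill0.
have lr : (i.+1 < r)%N.
  rewrite ltnNge; apply: contra h => h; rewrite /asc (pnat_ge w h).
  case: (ltnP i r) => h'; last by rewrite pnat_ge //.
  by have := pnat_lt w i; rewrite h'; lia.
rewrite lr /=; apply: IH; last by move: hw; rewrite (perm_length_desc lr h) => -[].
split=> [t|t tm].
  rewrite !pnatM !pnat_sref //.
  have -> : swapn i (m + t) = (m + swapn i' t)%N by rewrite /swapn ei; do !case: eqP; lia.
  exact: sh1.
by rewrite pnatM pnat_sref // swapn_id ?sh2 //; lia.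
Qed.

End Kill.

Lemma card_interval N a c : (c <= N)%N -> #|[set i : 'I_N | (a <= i < c)%N]| = (c - a)%N.
Proof.
move=> cN; rewrite -sum1dep_card -(big_mkord (fun i => a <= i < c)%N (fun=> 1%N)).
rewrite (big_cat_nat (n := c)) //= [X in (_ + X)%N]big_nat_cond [X in (_ + X)%N]big1 ?addn0; last by move=> i; lia.
have [ca|ac] := leqP c a.
  by rewrite big_nat_cond big1; [lia | move=> i; lia].
rewrite (big_cat_nat (n := a)) //=; last exact: ltnW.
rewrite [X in (X + _)%N]big_nat_cond [X in (X + _)%N]big1 ?add0n; last by move=> i; lia.
rewrite big_nat_cond (eq_bigl (fun i => (a <= i < c)%N && true)); last by move=> i; lia.
by rewrite -big_nat_cond sum_nat_const_nat muln1.
Qed.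

Section Window.
Variables (N m d : nat).
Local Notation M := N.+1.
Hypothesis md : (m + d <= N)%N.
Local Notation cst := (pcst S M).
Local Notation x := (px S M).
Local Notation Y := (@ysum S N).
Local Notation Ym := (@Ym S N).

Definition win : {set 'I_N} := [set i : 'I_N | (m <= i < m + d)%N].

Lemma card_win : #|win| = d.
Proof. by rewrite card_interval // addKn. Qed.

Lemma inJ_win t : inJ win t = (m <= t < m + d)%N.
Proof.
case: (ltnP t N) => h; first by rewrite (inJ_ord _ h) inE.
by rewrite /inJ insubF ?[RHS](_ : _ = false) //; lia.
Qed.

Local Notation iom := (io S m d.+1 M).

Lemma io_Y i : (i <= d)%N -> iom (@ysum S d i) = Y (m + i) - Ym m.
Proof.
elim: i => [|i IH] h.
  rewrite Y0 io_x // addn0 (Y_Ym S (j := m)); last by move: md; lia.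
  by rewrite [Ym m + _]addrC addrK.
rewrite YS // rmorphD IH 1?ltnW // addnS YS; last lia.
by rewrite /= io_x // addnS addrAC.
Qed.

Lemma win_kill_m e h : hom e h -> (e < d)%N -> Lam win (Ym m * h) = 0.
Proof.
move=> hh he; case E : m => [|m'] /=; first by rewrite mul0r /Lam mul0r Alt0.
by apply: (Lam_Y _ hh); rewrite ?card_win // inJ_win; lia.
Qed.

Lemma win_kill_top e h : hom e h -> (e < d)%N -> Lam win (Y (m + d) * h) = 0.
Proof. by move=> hh he; apply: (Lam_Y _ hh); rewrite ?card_win // inJ_win; lia. Qed.

(** The shift sends y_i to y_{m+i} - y_{m-1}, and [Lam win] kills the multiples of y_{m-1} and
    y_{m+d}, whose indices border the window. So all relations of the small ring, the top one
    included, are respected, and a Schubert polynomial of S_{d+1} can be reduced there. *)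
Lemma good_win : @good S d M true d (fun f => Lam win (iom f)).
Proof.
split=> [f g|c f|i e h hh he|_ e h hh he].
- by rewrite rmorphD LamD.
- by rewrite rmorphM io_c LamZ.
- have li := ltn_ord i; rewrite rmorphM rmorphM rmorphB rmorphM io_c io_Y 1?ltnW //.
  rewrite !io_x //; last exact: ltnW.
  have lN : (m + i < N)%N by lia.
  have hh' := io_hom m M hh.
  rewrite mulrBl mulrBl LamB addnS.
  rewrite (@Lam_rel S N win (Ordinal lN) e) ?card_win ?he // sub0r -mulrA.
  rewrite (@win_kill_m (1 + e)) ?oppr0 //; last by lia.
  by apply: phomM; rewrite ?qx_hom.
rewrite rmorphM io_Y // mulrBl LamB.
by have hh' := io_hom m M hh; rewrite (win_kill_top hh') ?(win_kill_m hh') ?subrr //; lia.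
Qed.

Lemma Lam_win_prod (s : seq nat) (h : PA M) e : hom e h -> (e + size s = d)%N ->
  Lam win (h * \prod_(i <- s) (Y (m + i) - Ym m)) = Lam win (h * \prod_(i <- s) Y (m + i)).
Proof.
elim: s h e => [|i s IH] h e hh he; first by rewrite !big_nil.
rewrite !big_cons; set P1 := \prod_(j <- s) (_ - _); set P2 := \prod_(j <- s) _.
have hYm : hom 1 (Ym m) by case: (m) => [|m'] /=; [exact: phom0 | exact: Y_hom].
have hP : hom (size s) P1.
  rewrite -count_predT; apply: hom_prod1 => j _; apply: homB => //; exact: Y_hom.
have -> : h * ((Y (m + i) - Ym m) * P1) = h * Y (m + i) * P1 - Ym m * (h * P1).
  by move: (Y _) (Ym m) => a b; ring.
rewrite LamB (@win_kill_m (e + size s)) ?subr0; [|exact: phomM| by move: he; rewrite /=; lia].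
rewrite (IH _ (e + 1)%N) ?mulrA //; first by apply: phomM => //; exact: Y_hom.
by rewrite -he /= addn1 addSnnS.
Qed.

Lemma big_win (R : comNzRingType) (G : nat -> R) : \prod_(i in win) G i = \prod_(i < d) G (m + i)%N.
Proof.
transitivity (\prod_(0 <= i < N | (m <= i < m + d)%N) G i).
  by rewrite big_mkord; apply: eq_bigl => i; rewrite inE.
rewrite [LHS](big_cat_nat (n := m)) //=; last lia.
rewrite [X in X * _ = _]big_nat_cond [X in X * _ = _]big1 ?mul1r; last by move=> i; lia.
rewrite [LHS](big_cat_nat (n := m + d)%N) //=; last lia.
rewrite [X in _ * X = _]big_nat_cond [X in _ * X = _]big1 ?mulr1; last by move=> i; lia.
rewrite [LHS]big_nat_cond [LHS](eq_bigl (fun i => (m <= i < m + d)%N && true)); last by move=> i; lia.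
rewrite -[LHS]big_nat_cond -{1}(add0n m) big_addn addKn big_mkord; apply: eq_bigr => i _; by rewrite addnC.
Qed.

Lemma Lam_win_YI : Lam win (iom (YI S [set: 'I_d])) = Lam win (YI S win).
Proof.
have -> : iom (YI S [set: 'I_d]) = \prod_(i <- iota 0 d) (Y (m + i) - Ym m).
  rewrite /YI rmorph_prod (eq_bigl predT) => [|i]; last by rewrite inE.
  rewrite -[d in iota 0 d]subn0 -/(index_iota 0 d) big_mkord.
  by apply: eq_bigr => i _; rewrite io_Y // ltnW.
rewrite -[\prod_(i <- _) _]mul1r (@Lam_win_prod _ _ 0) ?hom1 ?size_iota // mul1r.
congr (Lam _ _); rewrite /YI.
rewrite -[d in iota 0 d]subn0 -/(index_iota 0 d).
by rewrite big_win big_mkord.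
Qed.

End Window.

End Windows.

(** * Principal specialization *)

Section Specialization.
Variable S : polyFamily.
Local Notation RA := (pR S).
Local Notation PA k := (pP S k).
Local Notation q := (pq S).
Local Notation hom d f := (phom d f).
Local Notation dd i f := (pdd i f).
Local Notation sch w := (schubertA S w).
Local Notation qi := (qi S).

Definition evq k : {rmorphism PA k -> RA} := pmm k (idfun : {rmorphism RA -> RA}) (fun i => q ^+ i).

Lemma evq_c k c : evq k (pcst S k c) = c.
Proof. exact: pmm_c. Qed.

Lemma evq_x k i : (i < k)%N -> evq k (px S k i) = q ^+ i.
Proof. exact: pmm_x. Qed.

Lemma evq_io0 a b f : (a <= b)%N -> evq b (io S 0 a b f) = evq a f.
Proof.
move=> ab; move: f; apply: (@pext S a _ (evq b \o io S 0 a b)%FUN (evq a)) => [c|i l] /=.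
  by rewrite io_c !evq_c.
by rewrite io_x // !evq_x //; apply: leq_trans l ab.
Qed.

Lemma evq_Y N b : (b <= N)%N -> evq N.+1 (ysum S N b) = qi b.+1.
Proof.
elim: b => [|b IH] h; first by rewrite Y0 evq_x // qiS qi0 add0r.
by rewrite YS // rmorphD IH 1?ltnW // evq_x // [in RHS]qiS.
Qed.

(** The relation vanishes because q times q^i is q^(i+1). The flag is false since y_N evaluates to
    [N+1]. *)
Lemma good_evq N T d : @good S N T false d (fun f => pcst S T (evq N.+1 f)).
Proof.
split=> // [f g|c f|i e h _ _]; first by rewrite !rmorphD.
  by rewrite rmorphM evq_c rmorphM.
have li := ltn_ord i.
rewrite !rmorphM rmorphB rmorphM evq_c !evq_x //; last exact: ltnW.
by rewrite -exprS subrr rmorph0 mulr0 mul0r.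
Qed.

Lemma good_weak N T d (L : PA N.+1 -> PA T) : good true d L -> good false d L.
Proof. by case=> h1 h2 h3 _; split. Qed.

Lemma evq_YI N (I : {set 'I_N}) : evq N.+1 (YI S I) = \prod_(i in I) qi i.+1.
Proof.
rewrite /YI rmorph_prod; apply: eq_bigr => i _; rewrite evq_Y //.
exact: ltnW (ltn_ord i).
Qed.

Lemma win_inj N m m' d : (0 < d)%N -> (m + d <= N)%N -> (m' + d <= N)%N ->
  win N m d = win N m' d -> m = m'.
Proof.
move=> d0 h h' e.
have a : (m <= m < m + d)%N = (m' <= m < m' + d)%N by rewrite -(inJ_win h) -(inJ_win h') e.
have b : (m <= m' < m + d)%N = (m' <= m' < m' + d)%N by rewrite -(inJ_win h) -(inJ_win h') e.
by lia.
Qed.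

Definition qfact d : RA := \prod_(i < d) qi i.+1.

Section Support.
Variables (p k d : nat) (v : 'S_p.+1) (w : 'S_(k + p.+1)).
Hypotheses (p0 : (0 < p)%N) (vmoves : forall b, (b < p)%N -> moves b v).
Hypotheses (vd : perm_length v = d) (wv : shifted k w v).
Local Notation r := (k + p.+1)%N.
Local Notation N := (r + d)%N.
Local Notation M := N.+1.

Let rM : (r <= M)%N. Proof. lia. Qed.
Let wd : perm_length w = d. Proof. by rewrite (perm_length_shifted wv). Qed.

Local Notation f := (io S 0 r M (sch w)).

Lemma f_hom : hom d f.
Proof. by apply: io_hom; rewrite -wd; exact: schubert_homog. Qed.

Lemma w_moves b : (k <= b < k + p)%N -> moves b w.
Proof.
move=> kb; have [|t tb bt] := @vmoves (b - k)%N; first lia.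
by exists (k + t)%N; [lia | rewrite wv.1; lia].
Qed.

Lemma Lam_support (J : {set 'I_N}) b : #|J| = d -> (k <= b < k + p)%N -> ~~ inJ J b -> Lam J f = 0.
Proof.
move=> hJ kb bJ; apply: Lam_ddkill; rewrite hJ; first exact: f_hom.
exact: (ddkill_moves S rM bJ (w_moves kb) wd).
Qed.

(** Below k the permutation [w] is the identity, hence has an ascent; from k+p on, the divided
    difference falls outside S_r and gives 0. *)
Lemma f_inv i : (i.+1 < M)%N -> ~~ (k <= i < k + p)%N -> psy S (sref M i) f = f.
Proof.
move=> l ni; apply: (dd0_inv l); rewrite dd_io0 //.
case: ifP => // /andP[lr /negP]; case; rewrite /asc.
have ik : (i < k)%N by lia.
rewrite (wv.2 _ ik); have [e|ne] := eqVneq i.+1 k; first by rewrite e -[k in pnat _ k]addn0 wv.1; lia.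
by rewrite wv.2; lia.
Qed.

(** [J] must contain the whole support k..k+p-1 of [w]. Letters of [J] in other components fix the
    polynomial, so [Lam_component] excludes them; a single component is an interval, and its size is
    d. *)
Lemma Lam_win_only (J : {set 'I_N}) : #|J| = d -> Lam J f != 0 ->
  exists m, [/\ (m <= k)%N, (k + p <= m + d)%N & J = win N m d].
Proof.
move=> hJ Jn.
have sup b : (k <= b < k + p)%N -> inJ J b.
  by move=> kb; apply: contraNT Jn => nb; rewrite (Lam_support hJ kb nb).
(* [J1] is the component of k in [J]. *)
pose J1 := [set t in J | blk J k t && blk J t k]; pose J2 := J :\: J1.
have eJ : J = J1 :|: J2.
  apply/setP => t; rewrite !inE; case: (t \in J) => //=; rewrite ?andbT ?andbF //.
  by case: (blk J k t && _).
have kJ : inJ J k by apply: sup; lia.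
have J20 : J2 = set0.
  apply/eqP; apply: contraNT Jn => J2n; rewrite eJ; apply/eqP; apply: Lam_component => //.
  - by apply/setP => t; rewrite !inE; case: (t \in J); rewrite ?andbF //= andbT andbN.
  - move=> a b; rewrite !inE => /and3P[aJ /blkP ka /blkP ak] /andP[nb bJ].
    apply: contraNT nb => nab; rewrite bJ /=.
    have [e|[e|e]] : (b = a :> nat \/ b = a.+1 :> nat \/ a = b.+1 :> nat) by lia.
    + by apply/andP; split; apply/blkP => t ht; [apply: ka | apply: ak]; lia.
    + apply/andP; split; apply/blkP => t ht; last by apply: ak; lia.
      by have [->|ne] := eqVneq t a; [rewrite inJE | apply: ka; lia].
    apply/andP; split; apply/blkP => t ht; first by apply: ka; lia.
    by have [->|ne] := eqVneq t b; [rewrite inJE | apply: ak; lia].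
  move=> i; rewrite !inE => /andP[ni iJ]; apply: f_inv; first by rewrite ltnS.
  apply: contra ni => ki; rewrite iJ /=; apply/andP; split; apply/blkP => t ht; last lia.
  by apply: sup; lia.
have conn t : inJ J t -> blk J k t && blk J t k.
  move=> tJ; have lt := inJ_lt tJ; have : Ordinal lt \in J2 = false by rewrite J20 inE.
  by rewrite !inE -!inJE tJ andbT => /negbFE.
have exm : exists m, inJ J m by exists k.
case: (ex_minnP exm) => m mJ mmin.
have mk : (m <= k)%N by apply: mmin.
have exc : exists c, (k <= c)%N && ~~ inJ J c.
  by exists N; rewrite inJ_top andbT; lia.
case: (ex_minnP exc) => c /andP[kc cJ] cmin.
have cN : (c <= N)%N by apply: cmin; rewrite inJ_top andbT; lia.
have Jc t : inJ J t = (m <= t < c)%N.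
  apply/idP/idP => [tJ|ht].
    rewrite mmin //= ltnNge; apply: contra cJ => ct.
    have [e|ne] := eqVneq c t; first by rewrite e.
    by have /andP[/blkP h _] := conn t tJ; apply: h; lia.
  case: (ltnP t k) => tk.
    by have /andP[_ /blkP h] := conn m mJ; apply: h; lia.
  by apply/negPn/negP => nt; have := cmin t; rewrite tk nt => /(_ isT); lia.
have eJc : J = [set i : 'I_N | (m <= i < c)%N].
  by apply/setP => i; rewrite inE -Jc inJE.
have cm : c = (m + d)%N.
  have := hJ; rewrite eJc card_interval //; have := Jc m; rewrite mJ => /esym/andP[_]; lia.
exists m; split=> //; last by rewrite eJc cm.
by have := sup (k + p).-1 _; rewrite Jc -cm; lia.
Qed.

(** The numbers [a s] enter only through their last hypothesis: a reduction of the Schubert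
    polynomial of [u s] to a multiple of the full y-product gives [a s] once that product is counted
    as [d]!. The term s belongs to the window starting at k - s, in which v sits at offset s. The
    ring has r + d + 1 variables, so that the reduction of [w] never meets y_N. *)
Lemma abs_main (F : fieldType) (tr : {rmorphism RA -> F}) (u : nat -> 'S_d.+1) (a : nat -> F) :
  injective tr ->
  (forall s, (s <= d - p)%N -> shifted s (u s) v) ->
  (forall s k1 c, (s <= d - p)%N -> k1 != 0 ->
     (forall T (L : PA d.+1 -> PA T), good true d L ->
        pcst S T k1 * L (sch (u s)) = pcst S T c * L (YI S [set: 'I_d])) ->
     tr k1 * a s = tr (c * qfact d)) ->
  tr (evq r (sch w) * qfact d) =
  \sum_(s < (d - p).+1 | (s <= k)%N) a s * tr (\prod_(i < d) qi (k - s + i).+1).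
Proof.
move=> trinj ush ha.
have tr_neq0 c : c != 0 -> tr c != 0 by move=> h; rewrite -(rmorph0 tr) (inj_eq trinj).
have pd : (p <= d)%N.
  have := @moves_length _ v (iota 0 p) (iota_uniq 0 p); rewrite size_iota vd; apply.
  by move=> b; rewrite mem_iota => /vmoves.
have d0 : (0 < d)%N by lia.
have rd : (r + d <= N)%N by [].
have whom : hom d (sch w) by have := schubert_homog S w; rewrite wd.
have [k1 [c [k10 H]]] := redu_io rd whom.
have HL (J : {set 'I_N}) : #|J| = d -> pcst S M k1 * Lam J f = pcst S M (c J) * Lam J (YI S J).
  move=> hJ; apply: Lam_redu; rewrite hJ; apply: H; apply: good_weak.
  by have := good_Lam S J; rewrite hJ.
have cst_neq0 T b : b != 0 -> pcst S T b != 0.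
  by move=> h; rewrite -(rmorph0 (pcst S T)) (inj_eq (@pcst_inj S T)).
have c0 (J : {set 'I_N}) : #|J| = d -> Lam J f = 0 -> c J = 0.
  move=> hJ e; have := HL J hJ; rewrite e mulr0 => /esym/eqP.
  rewrite mulf_eq0 (negbTE (Lam_YI_neq0 _ _)) orbF; apply: contraTeq; exact: cst_neq0.
(* The coefficient at a window is found by expanding the same [Lam J] twice: from S_w in the large
   ring, and from the shifted S_{u s} reduced in its own d+1 variables. *)
have cwin s : (s <= d - p)%N -> (s <= k)%N -> tr k1 * a s = tr (c (win N (k - s) d) * qfact d).
  move=> sd sk; set m := (k - s)%N; set J := win N m d.
  have md : (m + d <= N)%N by lia.
  have hJ : #|J| = d := card_win md.
  have sh : shifted m w (u s).
    have [s1 s2] := ush s sd; split=> [t|t tm]; last by apply: wv.2; lia.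
    have [lt|ge] := ltnP t s; first by rewrite s2 // wv.2 //; lia.
    have -> : t = (s + (t - s))%N by lia.
    rewrite s1 addnA; have -> : (m + s)%N = k by lia.
    by rewrite wv.1 addnA; congr (_ + _)%N; lia.
  have ud : perm_length (u s) = d by rewrite (perm_length_shifted (ush s sd)).
  have uhom : hom d (sch (u s)) by have := schubert_homog S (u s); rewrite ud.
  have eL : Lam J f = Lam J (io S m d.+1 M (sch (u s))).
    apply/eqP; rewrite -subr_eq0 -LamB; apply/eqP; apply: Lam_ddkill; rewrite hJ.
      by apply: homB; [exact: f_hom | exact: io_hom].
    apply: (ddkill_shifted S rM _ _ sh wd); first lia.
    by move=> i; rewrite inE; lia.
  have [k2 [c2 [k20 H2]]] := redu_hom uhom.
  have H2' T (L : PA d.+1 -> PA T) : good true d L ->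
      pcst S T k2 * L (sch (u s)) = pcst S T (c2 [set: 'I_d]) * L (YI S [set: 'I_d]).
    move=> gL; rewrite (H2 T L gL) (bigD1 [set: 'I_d]) /=; last by rewrite cardsT card_ord.
    rewrite big1 ?addr0 // => I /andP[/eqP hI]; case/negP.
    by rewrite eqEcard subsetT cardsT card_ord hI /=.
  have e1 := H2' _ _ (good_win S md).
  rewrite (Lam_win_YI S md) -/J -eL in e1.
  have e2 := HL J hJ.
  have e3 : k1 * c2 [set: 'I_d] = k2 * c J.
    apply: (@pcst_inj S M); apply: (mulIf (Lam_YI_neq0 S J)).
    by rewrite !rmorphM -mulrA -e1 -mulrA -e2 mulrCA.
  apply: (mulfI (tr_neq0 _ k20)); rewrite mulrCA (ha s _ _ sd k20 H2') -!rmorphM mulrA e3.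
  by rewrite mulrA.
apply: (mulfI (tr_neq0 _ k10)); rewrite -rmorphM mulrA.
have Hev : k1 * evq r (sch w) = \sum_(I : {set 'I_N} | #|I| == d) c I * \prod_(i in I) qi i.+1.
  have := H 0%N _ (@good_evq N 0 d); rewrite -rmorphM.
  under eq_bigr => I _ do rewrite -rmorphM evq_YI.
  rewrite -rmorph_sum => /(@pcst_inj S 0) <-; by rewrite evq_io0.
have wN s : (s <= k)%N -> (k - s + d <= N)%N by lia.
pose A := [set s : 'I_(d - p).+1 | (s <= k)%N].
pose h (s : 'I_(d - p).+1) := win N (k - s) d.
have hinj : {in A &, injective h}.
  move=> s s'; rewrite !inE => sk s'k e; apply: val_inj => /=.
  by have := win_inj d0 (wN _ sk) (wN _ s'k) e; lia.
(* Sets other than windows have coefficient 0; a window starting at m with k + p <= m + d has offset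
   s = k - m <= d - p. *)
have Hev2 : k1 * evq r (sch w) = \sum_(s in A) c (h s) * \prod_(i < d) qi (k - s + i).+1.
  rewrite Hev (bigID (mem (h @: A))) /= [X in _ + X]big1 ?addr0; last first.
    move=> I /andP[/eqP hI nI]; rewrite (c0 I hI) ?mul0r //.
    apply/eqP; apply: contraNT nI => nz; have [m [mk kpm e]] := Lam_win_only hI nz.
    have l : (k - m < (d - p).+1)%N by lia.
    apply/imsetP; exists (Ordinal l); rewrite ?inE /= ?leq_subr // e /h /=.
    by congr (win _ _ _); lia.
  rewrite (eq_bigl (mem (h @: A))) => [|I]; last first.
    rewrite /=; case: imsetP => [[s sA ->]|_]; last by rewrite andbF.
    by rewrite /h card_win ?eqxx //; apply: wN; move: sA; rewrite inE.
  rewrite (big_imset _ hinj) /=; apply: eq_bigr => s; rewrite inE => sk.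
  by rewrite /h (big_win (wN _ sk) (fun i => qi i.+1)).
rewrite Hev2 rmorphM rmorph_sum mulr_suml mulr_sumr.
apply: eq_big => [s|s]; first by rewrite inE.
rewrite inE => sk; have sd : (s <= d - p)%N by rewrite -ltnS ltn_ord.
rewrite mulrA (cwin s sd sk) -/(h s) !rmorphM; move: (tr _) (tr _) (tr _) => z1 z2 z3.
by rewrite mulrAC.
Qed.

End Support.

End Specialization.

(** * Sums of Hecke operators *)

(** [pick] returns the least index, so the recursion for T_w always takes the first descent and the
    reduced word it follows is known exactly. *)
Lemma pick_min n (P : pred 'I_n) i : [pick i | P i] = Some i ->
  P i /\ forall j : 'I_n, (j < i)%N -> ~~ P j.
Proof.
move=> e; split; first by move: e; case: pickP => // k hk [<-].
move=> j ji; apply/negP => hj; move: e; rewrite /pick.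
have s : sorted ltn [seq val k | k <- enum (fun k => P k)].
  apply: (subseq_sorted ltn_trans _ (iota_ltn_sorted 0 n)).
  rewrite -(val_enum_ord n); apply: map_subseq; rewrite enumT; exact: filter_subseq.
have jin : j \in enum (fun k => P k) by rewrite mem_enum.
case E : (enum _) s jin => [|a t] //= s + [ea]; rewrite ea inE => /orP[/eqP e|jt].
  by rewrite e ltnn in ji.
have := order_path_min ltn_trans s => /allP /(_ (val j)); rewrite ea map_f // => /(_ isT).
by move: ji => /=; lia.
Qed.

Section Hecke.
Variables (n : nat) (F : fieldType) (q : F) (x : nat -> F).
Variable s : 'S_n -> {rmorphism F -> F}.
Hypothesis s1 : forall g, s 1%g g = g.
Hypothesis sM : forall u w g, s (u * w)%g g = s w (s u g).
Hypothesis s_x : forall w i, (i < n)%N -> s w (x i) = x (pnat w i).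
Hypothesis s_q : forall w, s w q = q.
Hypothesis x_neq : forall i j, (i < n)%N -> (j < n)%N -> i != j -> x i - x j != 0.
Local Notation sr i := (sref n i).

Definition heckeT (i : nat) (g : F) : F :=
  (q - 1) * ((x i * g - s (sr i) (x i * g)) / (x i - x i.+1)) + s (sr i) g.

Fixpoint tw_fuel (fuel : nat) (w : 'S_n) (g : F) : F :=
  match fuel with
  | 0 => g
  | f.+1 =>
      if w == 1%g then g else
      match [pick i : 'I_n | (i.+1 < n)%N && (pnat w i.+1 < pnat w i)%N] with
      | Some i => tw_fuel f (sref n i * w)%g (heckeT i g)
      | None => g
      end
  end.

Definition tw (w : 'S_n) (g : F) : F := tw_fuel 'C(n, 2) w g.

Lemma s_sx i : (i.+1 < n)%N -> forall j, (j < n)%N -> s (sr i) (x j) = x (swapn i j).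
Proof. by move=> l j lj; rewrite s_x // pnat_sref. Qed.

Lemma desc_asc (w : 'S_n) i : (pnat w i.+1 < pnat w i)%N = ~~ asc w i.
Proof.
rewrite /asc -leqNgt [RHS]leq_eqVlt; case: eqP => //= /pnat_inj; lia.
Qed.

Lemma tw_fuel_first f (w : 'S_n) i g : (i.+1 < n)%N -> ~~ asc w i ->
  (forall j, (j < i)%N -> asc w j) ->
  tw_fuel f.+1 w g = tw_fuel f (sref n i * w)%g (heckeT i g).
Proof.
move=> l h hmin /=; case: eqP => [e|_].
  by move: h; rewrite e /asc !pnat1 ltnSn.
case E : [pick _ | _] => [j|]; last first.
  move: E; case: pickP => // /(_ (Ordinal (ltnW l))) /=.
  by rewrite l desc_asc h.
have [/andP[lj hj] jmin] := pick_min E; rewrite desc_asc in hj.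
suff -> : nat_of_ord j = i by [].
have [ji|ij|//] := ltngtP j i; first by rewrite hmin in hj.
by have := jmin (Ordinal (ltnW l)) ij; rewrite /= l desc_asc h.
Qed.

Lemma first_descent (w : 'S_n) : w != 1%g -> exists i, [/\ (i.+1 < n)%N, ~~ asc w i &
  forall j, (j < i)%N -> asc w j].
Proof.
move=> w1; have ex : exists i, (i.+1 < n)%N && ~~ asc w i.
  case: (boolP [exists i : 'I_n, (i.+1 < n)%N && ~~ asc w i]) => [/existsP[i hi]|]; first by exists i.
  rewrite negb_exists => /forallP h; case/eqP: w1; apply: asc_all1 => i l.
  by have := h (Ordinal (ltnW l)); rewrite /= l negbK.
case: (ex_minnP ex) => i /andP[l h] imin; exists i; split=> // j ji.
by apply: contraT => hj; have := imin j; rewrite hj andbT; lia.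
Qed.

Lemma tw_fuel_eq f1 f2 (w : 'S_n) g : (perm_length w <= f1)%N -> (perm_length w <= f2)%N ->
  tw_fuel f1 w g = tw_fuel f2 w g.
Proof.
have t1 f g' : tw_fuel f 1%g g' = g' by case: f => //= f; rewrite eqxx.
elim: f1 f2 w g => [|f1 IH] f2 w g h1 h2.
  by rewrite (@perm_length0 _ w) ?t1 //; lia.
have [->|w1] := eqVneq w 1%g; first by rewrite !t1.
have [i [l h hmin]] := first_descent w1; have hl := perm_length_desc l h.
case: f2 h2 => [|f2] h2; first lia.
by rewrite !(tw_fuel_first _ _ l h hmin); apply: IH; lia.
Qed.

Lemma tw1 g : tw 1%g g = g.
Proof. by rewrite /tw; case: 'C(n, 2) => //= f; rewrite eqxx. Qed.

Lemma tw_first (w : 'S_n) i g : (i.+1 < n)%N -> ~~ asc w i ->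
  (forall j, (j < i)%N -> asc w j) -> tw w g = tw (sref n i * w)%g (heckeT i g).
Proof.
move=> l h hmin; rewrite /tw; have hl := perm_length_desc l h.
have lw : (perm_length w <= 'C(n, 2))%N.
  by rewrite -card_ltn_pairs; apply: subset_leq_card; apply/subsetP => p; rewrite !inE => /andP[].
rewrite (@tw_fuel_eq _ ('C(n, 2)).+1 w) //; last lia.
rewrite (tw_fuel_first _ _ l h hmin); apply: tw_fuel_eq; lia.
Qed.

Lemma heckeTD i g h : heckeT i (g + h) = heckeT i g + heckeT i h.
Proof.
rewrite /heckeT mulrDr !rmorphD; move: (s _ _) (s _ _) (s _ _) (s _ _) (_^-1) => a b c d e; ring.
Qed.

Lemma heckeT0 i : heckeT i 0 = 0.
Proof. by rewrite /heckeT mulr0 rmorph0 subrr mul0r mulr0 addr0. Qed.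

Lemma tw_sum (I : Type) (r : seq I) (P : pred I) (G : I -> F) w :
  tw w (\sum_(i <- r | P i) G i) = \sum_(i <- r | P i) tw w (G i).
Proof.
apply: (big_morph (tw w)).
  rewrite /tw; elim: 'C(n, 2) w => //= f IH w a b; case: eqP => // _.
  by case: pick => // i; rewrite heckeTD IH.
rewrite /tw; elim: 'C(n, 2) w => //= f IH w; case: eqP => // _.
by case: pick => // i; rewrite heckeT0 IH.
Qed.

Definition rho i j : F := (q * x i - x j) / (x i - x j).

Lemma s_rho w i j : (i < n)%N -> (j < n)%N -> s w (rho i j) = rho (pnat w i) (pnat w j).
Proof. by move=> li lj; rewrite /rho fmorph_div !rmorphB rmorphM s_q !s_x. Qed.

(** Equivalently, 1 + T_i is multiplication by [rho i i.+1] followed by 1 + s_i: the rank one case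
    of [sum_tw]. *)
Lemma heckeTE i g : (i.+1 < n)%N ->
  heckeT i g = rho i i.+1 * g + s (sr i) (rho i i.+1 * g) - g.
Proof.
move=> l; have li := ltnW l; rewrite rmorphM s_rho // !pnat_sref // swapn_l swapn_r /heckeT /rho.
rewrite rmorphM s_sx // swapn_l; move: (s _ g) => h.
have n1 : x i - x i.+1 != 0 by apply: x_neq; rewrite // neq_ltn ltnSn.
have n2 : x i.+1 - x i != 0 by apply: x_neq; rewrite // neq_ltn ltnSn orbT.
by field; rewrite n1 n2.
Qed.

Lemma heckeT_inv i g : (i.+1 < n)%N -> s (sr i) g = g -> heckeT i g = q * g.
Proof.
move=> l e; have li := ltnW l; rewrite /heckeT rmorphM e s_sx // swapn_l.
have n1 : x i - x i.+1 != 0 by apply: x_neq; rewrite // neq_ltn ltnSn.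
by field.
Qed.

Definition fixed r (w : 'S_n) : bool := [forall j : 'I_n, (r <= j)%N ==> (w j == j)].

Lemma fixedP r w : reflect (forall j, (r <= j)%N -> pnat w j = j) (fixed r w).
Proof.
apply: (iffP forallP) => h j; last first.
  by apply/implyP => rj; apply/eqP/val_inj => /=; rewrite -pnatE h.
move=> rj; case: (ltnP j n) => lj; last exact: pnat_ge.
by have := h (Ordinal lj); rewrite /= rj => /eqP e; rewrite (pnat_ord _ lj) e.
Qed.

Lemma fixed_lt r w j : fixed r w -> (pnat w j < r)%N = (j < r)%N.
Proof.
move=> /fixedP h; case: (ltnP j r) => jr; last by rewrite h // ltnNge jr.
rewrite ltnNge; apply/negP => hr; have := h _ hr => /pnat_inj e.
by rewrite e leqNgt jr in hr.
Qed.

(* The reduced word chosen by first descents is that of insertion sort: it first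
   sorts the prefix of length r. *)
Lemma tw_mul r (u c : 'S_n) g : (r <= n)%N -> fixed r u ->
  (forall a b, (a < b < r)%N -> (pnat c a < pnat c b)%N) ->
  tw (u * c)%g g = tw c (tw u g).
Proof.
move=> rn fu hc; have [m] := ubnP (perm_length u); elim: m u g fu => // m IH u g fu hm.
have [->|u1] := eqVneq u 1%g; first by rewrite mul1g tw1.
have [i [l h hmin]] := first_descent u1.
have ir : (i.+1 < r)%N.
  rewrite ltnNge; apply: contra h => h; rewrite /asc.
  have [ri|ri] := leqP r i; first by rewrite !(fixedP _ _ fu) //; lia.
  by rewrite (fixedP _ _ fu i.+1) //; have := fixed_lt i fu; rewrite ri; lia.
have as' j : (j.+1 < r)%N -> asc (u * c)%g j = asc u j.
  move=> jr; rewrite /asc !pnatM; have a := fixed_lt j fu; have b := fixed_lt j.+1 fu.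
  rewrite jr in b; rewrite (ltnW jr) in a.
  case: (ltngtP (pnat u j) (pnat u j.+1)) => hj; first by apply: hc; rewrite hj.
    by apply/negbTE; rewrite -leqNgt ltnW // hc // hj.
  by move: (pnat_inj hj); lia.
rewrite (@tw_first (u * c)%g i) //; last 2 first.
- by rewrite as'.
- by move=> j ji; rewrite as' ?hmin //; lia.
rewrite mulgA IH.
- by rewrite (@tw_first u i).
- apply/fixedP => j rj; rewrite pnatM pnat_sref // swapn_id ?(fixedP _ _ fu) //; lia.
by move: hm; rewrite (perm_length_desc l h) ltnS.
Qed.

(** The cycle sending t+k to t and raising t, ..., t+k-1 by one. The [cyc t (r - t)] are the coset
    representatives of S_r in S_{r+1} that are increasing on the first r positions, as [tw_mul]
    requires. *)
Fixpoint cyc (t k : nat) : 'S_n :=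
  if k is k'.+1 then (sref n (t + k') * cyc t k')%g else 1%g.

Lemma pnat_cyc t k j : (t + k < n)%N ->
  pnat (cyc t k) j = if (j < t)%N then j else if (j < t + k)%N then j.+1
                     else if j == (t + k)%N then t else j.
Proof.
elim: k j => [|k IH] j h /=; first by rewrite pnat1; do !case: ifP; lia.
rewrite pnatM pnat_sref ?IH; try lia; rewrite /swapn.
by do !case: ifP; lia.
Qed.

Lemma cyc_head t k : (t + k.+1 < n)%N -> cyc t k.+1 = (cyc t.+1 k * sref n t)%g.
Proof.
move=> h; apply: pnat_permP => j; rewrite pnatM pnat_sref; last lia.
rewrite !pnat_cyc; try lia; rewrite /swapn.
by do !case: ifP; lia.
Qed.

Lemma tw_cyc t k g : (t + k.+1 < n)%N -> tw (cyc t k.+1) g = tw (cyc t k) (heckeT (t + k) g).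
Proof.
move=> h; have l : ((t + k).+1 < n)%N by rewrite -addnS.
rewrite (@tw_first _ (t + k)%N) //.
- by rewrite /= mulg_srefK.
- by rewrite /asc !pnat_cyc // -leqNgt; do !case: ifP; lia.
by move=> j jk; rewrite /asc !pnat_cyc //; do !case: ifP; lia.
Qed.

(** [tw_cyc] splits off the operator applied first; here the operator applied last is split off. *)
Lemma tw_cyc_head t k g : (t + k.+1 < n)%N ->
  tw (cyc t k.+1) g = heckeT t (tw (cyc t.+1 k) g).
Proof.
elim: k g => [|k IH] g h; first by rewrite tw_cyc // !tw1 addn0.
rewrite tw_cyc // IH; last lia.
by rewrite -addSnnS [in RHS]tw_cyc //; lia.
Qed.

Section Insert.
Variables (r : nat) (h : F).
Hypothesis rn : (r < n)%N.
Hypothesis hinv : forall i, (i.+1 < r)%N -> s (sr i) h = h.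

(** [G] and [H] are the two sides of [insert_sum] with all indices restricted to at least k, which
    allows a downward induction on k. *)
Let G k := \sum_(k <= t < r.+1) tw (cyc t (r - t)) h.
Let H k := \sum_(k <= t < r.+1) s (cyc t (r - t)) h * \prod_(k <= i < r.+1 | i != t) rho i t.

Lemma cyc_h_inv k t : (k.+1 < t <= r)%N -> s (sr k) (s (cyc t (r - t)) h) = s (cyc t (r - t)) h.
Proof.
move=> kt; rewrite -sM.
have -> : (cyc t (r - t) * sr k = sr k * cyc t (r - t))%g.
  apply: pnat_permP => j; rewrite !pnatM !pnat_sref; try lia.
  by rewrite !pnat_cyc; try lia; rewrite /swapn; do !case: ifP; lia.
by rewrite sM hinv //; lia.
Qed.

(** Used with a, b, c equal to x_k, x_{k+1}, x_t: it compares the coefficients of [B t] in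
    [insert_step]. *)
Lemma rho_id a b c : a - b != 0 -> b - c != 0 -> a - c != 0 ->
  (q * a - b) / (a - b) * ((q * b - c) / (b - c)) + (q * b - a) / (b - a) * ((q * a - c) / (a - c)) - q
  = (q * a - c) / (a - c) * ((q * b - c) / (b - c)).
Proof.
move=> n1 n2 n3; have n4 : b - a != 0 by rewrite -opprB oppr_eq0.
by field; rewrite n1 n2 n3 n4.
Qed.

(** G k = T_k(G(k+1) - G(k+2)) + G(k+1). As H(k+2) is symmetric in x_k and x_{k+1}, T_k multiplies
    it by q; on H(k+1), [heckeTE] is expanded. The parts with t at most k+1 match directly, the
    others by [rho_id]. *)
Lemma insert_step k : (k < r)%N -> G k.+1 = H k.+1 -> G k.+2 = H k.+2 -> G k = H k.
Proof.
move=> kr e1 e2; have l : (k.+1 < n)%N by lia.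
pose B t := s (cyc t (r - t)) h * \prod_(k.+2 <= i < r.+1 | i != t) rho i t.
have Binv t : (k.+1 < t <= r)%N -> s (sr k) (B t) = B t.
  move=> ht; rewrite /B rmorphM cyc_h_inv // rmorph_prod; congr (_ * _).
  rewrite big_nat_cond [RHS]big_nat_cond; apply: eq_bigr => i hi.
  by rewrite s_rho ?pnat_sref ?swapn_id //; lia.
have H2 : H k.+2 = \sum_(k.+2 <= t < r.+1) B t by [].
pose A := s (cyc k.+1 (r - k.+1)) h * \prod_(k.+2 <= i < r.+1) rho i k.+1.
have prodS a t : (a <= r)%N -> a != t -> \prod_(a <= i < r.+1 | i != t) rho i t =
    rho a t * \prod_(a.+1 <= i < r.+1 | i != t) rho i t.
  by move=> ar ne; rewrite big_ltn_cond // ne.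
have prodT a : (a <= r)%N -> \prod_(a <= i < r.+1 | i != a) rho i a =
    \prod_(a.+1 <= i < r.+1) rho i a.
  move=> ar; rewrite big_ltn_cond // eqxx /= [LHS]big_nat_cond [RHS]big_nat_cond.
  by apply: eq_bigl => i; lia.
have H1 : H k.+1 = A + \sum_(k.+2 <= t < r.+1) rho k.+1 t * B t.
  rewrite /H big_ltn; last lia.
  rewrite prodT; last lia.
  congr (_ + _); rewrite big_nat_cond [RHS]big_nat_cond; apply: eq_bigr => t ht.
  by rewrite prodS /B; [rewrite mulrCA | lia | lia].
have H0 : H k = s (sr k) (rho k k.+1 * A) + rho k k.+1 * A +
    \sum_(k.+2 <= t < r.+1) rho k t * rho k.+1 t * B t.
  rewrite /H big_ltn; last lia.
  rewrite big_ltn; last lia.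
  rewrite prodT; last lia.
  rewrite [in X in _ + (_ * X + _)]prodS; [|lia|lia].
  rewrite [in X in _ + (_ * (_ * X) + _)]prodT; last lia.
  rewrite addrA; congr (_ + _ + _).
  - rewrite rmorphM s_rho //; last lia.
    rewrite !pnat_sref // swapn_l swapn_r /A rmorphM rmorph_prod -sM.
    have -> : (r - k = (r - k.+1).+1)%N by lia.
    rewrite cyc_head; last lia.
    rewrite mulrCA; congr (_ * _); rewrite big_ltn; last lia.
    congr (_ * _); rewrite big_nat_cond [RHS]big_nat_cond; apply: eq_bigr => i hi.
    by rewrite s_rho ?pnat_sref ?swapn_r ?swapn_id //; lia.
  - by rewrite /A mulrCA.
  rewrite big_nat_cond [RHS]big_nat_cond; apply: eq_bigr => t ht.
  rewrite prodS; [|lia|lia].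
  rewrite prodS; [|lia|lia].
  by rewrite /B mulrCA -mulrA [rho k.+1 t * (_ * _)]mulrCA.
(* The difference isolates the term t = k+1, from which T_k produces the term t = k. *)
have G0 : G k = heckeT k (G k.+1 - G k.+2) + G k.+1.
  rewrite {1}/G big_ltn; last lia.
  rewrite -/(G k.+1); congr (_ + _).
  have -> : G k.+1 - G k.+2 = tw (cyc k.+1 (r - k.+1)) h.
    by rewrite /G big_ltn; [rewrite addrK | lia].
  have -> : (r - k = (r - k.+1).+1)%N by lia.
  by rewrite tw_cyc_head //; lia.
have TN g : heckeT k (- g) = - heckeT k g.
  by apply/eqP; rewrite -subr_eq0 opprK -heckeTD addNr heckeT0.
have inv2 : s (sr k) (H k.+2) = H k.+2.
  rewrite H2 rmorph_sum big_nat_cond [RHS]big_nat_cond; apply: eq_bigr => t ht.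
  by rewrite Binv //; lia.
have E2 : s (sr k) (rho k k.+1 * H k.+1) = s (sr k) (rho k k.+1 * A) +
   \sum_(k.+2 <= t < r.+1) rho k.+1 k * rho k t * B t.
  rewrite H1 mulrDr rmorphD; congr (_ + _).
  rewrite mulr_sumr rmorph_sum big_nat_cond [RHS]big_nat_cond; apply: eq_bigr => t ht.
  rewrite rmorphM [s _ (rho k.+1 t * _)]rmorphM Binv; last lia.
  rewrite !s_rho ?pnat_sref ?swapn_l ?swapn_r ?swapn_id ?mulrA //; lia.
have E1 : rho k k.+1 * H k.+1 = rho k k.+1 * A +
   rho k k.+1 * \sum_(k.+2 <= t < r.+1) rho k.+1 t * B t by rewrite H1 mulrDr.
have key : \sum_(k.+2 <= t < r.+1) rho k t * rho k.+1 t * B t =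
    rho k k.+1 * (\sum_(k.+2 <= t < r.+1) rho k.+1 t * B t)
   + \sum_(k.+2 <= t < r.+1) rho k.+1 k * rho k t * B t - q * \sum_(k.+2 <= t < r.+1) B t.
  rewrite !mulr_sumr -big_split -sumrB big_nat_cond [RHS]big_nat_cond; apply: eq_bigr => t ht /=.
  rewrite /rho -rho_id; try (apply: x_neq; lia).
  by move: (B t) (_ / _) (_ / _) (_ / _) (_ / _) => b c1 c2 c3 c4; ring.
rewrite G0 heckeTD TN e2 (heckeT_inv l inv2) e1 heckeTE // E2 E1 H0 key H2.
clear; ring.
Qed.

Lemma insert_sum : \sum_(0 <= t < r.+1) tw (cyc t (r - t)) h =
  \sum_(0 <= t < r.+1) s (cyc t (r - t)) h * \prod_(0 <= i < r.+1 | i != t) rho i t.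
Proof.
suff claim j : (j <= r)%N -> G (r - j) = H (r - j) /\ G (r - j).+1 = H (r - j).+1.
  by have := (claim r (leqnn r)).1; rewrite subnn.
elim: j => [|j IH] jr.
  rewrite subn0 /G /H; split; last by rewrite !big_geq.
  rewrite !big_nat1 subnn /= tw1 s1.
  by rewrite big_ltn_cond // eqxx /= big_geq // mulr1.
have [h1 h2] := IH (ltnW jr); have e : ((r - j.+1).+1 = r - j)%N by lia.
split; last by rewrite e.
by apply: insert_step; rewrite ?e //; lia.
Qed.

End Insert.

Definition rhoprod r : F := \prod_(0 <= j < r) \prod_(0 <= i < j) rho i j.

(** Coset decomposition of S_{r+1} over S_r, sorted by the image t of the position r. *)
Lemma sum_fixedS (R : nmodType) r (Phi : 'S_n -> R) : (r < n)%N ->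
  \sum_(w | fixed r.+1 w) Phi w =
  \sum_(0 <= t < r.+1) \sum_(u | fixed r u) Phi (u * cyc t (r - t))%g.
Proof.
move=> rn; rewrite big_mkord.
have wr w : fixed r.+1 w -> (pnat w r < r.+1)%N by move=> fw; rewrite (fixed_lt _ fw).
rewrite (partition_big (fun w : 'S_n => inord (pnat w r) : 'I_r.+1) xpredT) //=.
apply: eq_bigr => t _; rewrite (reindex_inj (mulIg (cyc t (r - t)))) /=.
have lt : (t <= r)%N by rewrite -ltnS.
have ltn : (t + (r - t) < n)%N by lia.
have cr : pnat (cyc t (r - t)) r = t by rewrite pnat_cyc //; do !case: ifP; lia.
apply: eq_bigl => u; apply/andP/idP => [[fu /eqP e]|fu].
  have ur : pnat u r = r.
    apply: (@pnat_inj _ (cyc t (r - t))); rewrite cr -pnatM.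
    by have := congr1 val e; rewrite /= inordK // wr.
  apply/fixedP => j rj; have [->//|ne] := eqVneq j r.
  have := fixedP _ _ fu j; rewrite pnatM => h; apply: (@pnat_inj _ (cyc t (r - t))).
  rewrite h; last lia.
  by rewrite pnat_cyc //; do !case: ifP; lia.
have fu' : fixed r.+1 (u * cyc t (r - t))%g.
  apply/fixedP => j rj; rewrite pnatM (fixedP _ _ fu); last lia.
  by rewrite pnat_cyc //; do !case: ifP; lia.
split=> //; apply/eqP/val_inj; rewrite /= inordK ?wr //.
by rewrite pnatM (fixedP _ _ fu) // cr.
Qed.

Lemma tw_cyc_mul r t u g : (r < n)%N -> (t <= r)%N -> fixed r u ->
  tw (u * cyc t (r - t))%g g = tw (cyc t (r - t)) (tw u g).
Proof.
move=> rn tr fu; apply: (@tw_mul r) => //; first exact: ltnW.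
move=> a b ab; rewrite !pnat_cyc; try lia.
by do !case: ifP; lia.
Qed.

Lemma fixed0 w : fixed 0 w = (w == 1%g).
Proof.
apply/idP/eqP => [/fixedP h|->]; last by apply/fixedP => j _; rewrite pnat1.
by apply: pnat_permP => j; rewrite h // pnat1.
Qed.

Lemma fixed_sref r i u : (i.+1 < r)%N -> (r <= n)%N -> fixed r (u * sr i)%g = fixed r u.
Proof.
move=> ir rn; have l : (i.+1 < n)%N by lia.
have aux v : fixed r v -> fixed r (v * sr i)%g.
  move=> fv; apply/fixedP => j rj; rewrite pnatM (fixedP _ _ fv) // pnat_sref // swapn_id //; lia.
apply/idP/idP; last exact: aux.
by move/aux; rewrite -mulgA srefK // mulg1.
Qed.

(** Induction on r: split off the coset representative by [tw_cyc_mul] and apply the hypothesis. The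
    inner sum is then invariant under S_r, which is what [insert_sum] asks for, and the new factors
    complete [rhoprod r] to [rhoprod r.+1]. *)
Theorem sum_tw r g : (r <= n)%N ->
  \sum_(w | fixed r w) tw w g = \sum_(w | fixed r w) s w (g * rhoprod r).
Proof.
elim: r => [|r IH] rn.
  rewrite !(eq_bigl (pred1 1%g) _ fixed0) !big_pred1_eq tw1 s1 /rhoprod big_geq // mulr1 //.
have rn' := ltnW rn.
rewrite !sum_fixedS // (eq_big_nat _ _ (F2 := fun t => tw (cyc t (r - t)) (\sum_(u | fixed r u) tw u g))); last first.
  move=> t ht; rewrite tw_sum; apply: eq_bigr => u fu; apply: tw_cyc_mul => //; lia.
rewrite IH //; set h := \sum_(u | fixed r u) s u (g * rhoprod r).
rewrite insert_sum //; last first.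
  move=> i ir; rewrite /h rmorph_sum [RHS](reindex_inj (mulIg (sr i))) /=.
  by apply: eq_big => [u|u _]; rewrite ?fixed_sref // sM.
apply: eq_big_nat => t ht.
set X := \prod_(0 <= i < r) rho i r.
have ltn : (t + (r - t) < n)%N by lia.
(* The cycle sends r to t and the positions below r onto all others, so it carries the factors of
   [X] to those produced by [insert_sum]. *)
have sX : s (cyc t (r - t)) X = \prod_(0 <= i < r.+1 | i != t) rho i t.
  rewrite /X rmorph_prod (@big_cat_nat _ _ _ t) /=; [|lia|lia].
  rewrite [RHS](@big_cat_nat _ _ _ t) /=; [|lia|lia]; congr (_ * _).
    rewrite big_nat_cond [RHS]big_nat_cond; apply: eq_big => [i|i hi]; first lia.
    rewrite s_rho; try lia.
    by rewrite !pnat_cyc //; congr rho; do !case: ifP; lia.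
  rewrite [RHS]big_ltn_cond; last lia.
  rewrite eqxx /= big_add1 /= [LHS]big_nat_cond [RHS]big_nat_cond.
  apply: eq_big => [i|i hi]; first lia.
  rewrite s_rho; try lia.
  by rewrite !pnat_cyc //; congr rho; do !case: ifP; lia.
rewrite -sX -rmorphM /h mulr_suml rmorph_sum; apply: eq_bigr => u fu.
have uX : s u X = X.
  rewrite /X rmorph_prod !big_mkord.
  have lord (i : 'I_r) : (pnat u i < r)%N by rewrite (fixed_lt _ fu).
  pose p (i : 'I_r) : 'I_r := Ordinal (lord i).
  have pinj : injective p by move=> a b [/pnat_inj e]; apply: val_inj.
  rewrite [RHS](reindex_inj pinj); apply: eq_bigr => i _ /=.
  by rewrite s_rho ?(fixedP _ _ fu r) //; have := ltn_ord i; lia.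
rewrite -{1}uX -rmorphM sM; congr (s _ (s _ _)).
by rewrite /rhoprod big_nat_recr //= mulrA.
Qed.

Lemma tw_cyc_const t k c : (t + k < n)%N -> (forall w, s w c = c) ->
  tw (cyc t k) c = q ^+ k * c.
Proof.
move=> + hc; elim: k c hc => [|k IH] c hc l; first by rewrite tw1 expr0 mul1r.
rewrite tw_cyc // heckeT_inv //; last by rewrite -addnS.
rewrite IH; [by rewrite exprSr mulrA | by move=> w; rewrite rmorphM s_q hc | lia].
Qed.

(** T_i multiplies constants by q, so the representative of length k contributes q^k and each new
    coset sum is [r+1]: the Poincare polynomial of the symmetric group. *)
Theorem sum_tw1 r : (r <= n)%N ->
  \sum_(w | fixed r w) tw w 1 = \prod_(i < r) \sum_(j < i.+1) q ^+ j.
Proof.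
elim: r => [|r IH] rn.
  by rewrite (eq_bigl (pred1 1%g) _ fixed0) big_pred1_eq tw1 big_ord0.
rewrite sum_fixedS // big_ord_recr /= mulrC -IH; last exact: ltnW.
set c := \sum_(w | fixed r w) tw w 1.
have hc w : s w c = c.
  rewrite /c IH; last exact: ltnW.
  rewrite rmorph_prod; apply: eq_bigr => i _; rewrite rmorph_sum; apply: eq_bigr => j _.
  by rewrite rmorphXn s_q.
rewrite mulr_suml big_nat_rev /= big_mkord; apply: eq_bigr => t _; rewrite add0n subSS.
rewrite -(@tw_cyc_const (r - t)) //; last by have := ltn_ord t; lia.
rewrite /c tw_sum; apply: eq_bigr => u fu.
have e : (r - (r - t) = t)%N by have := ltn_ord t; lia.
by have := @tw_cyc_mul r (r - t)%N u 1 rn (leq_subr _ _) fu; rewrite e.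
Qed.

End Hecke.

(** * Automorphisms of the fraction field *)

Local Open Scope quotient_scope.

Section FracMap.
Variable A : idomainType.
Local Notation F := {fraction A}.
Local Notation num g := (frac (generic_quotient.repr g)).1.
Local Notation den g := (frac (generic_quotient.repr g)).2.

Lemma pi_den (r : {ratio A}) :
  FracField.mul (\pi_(FracField.type A) r) (FracField.tofrac (frac r).2) = FracField.tofrac (frac r).1.
Proof.
have d0 : (frac r).2 != 0 := denom_ratioP r.
apply/eqP; rewrite !piE /FracField.equivf /FracField.mulf !numden_Ratio ?oner_eq0 ?mulf_neq0 ?oner_eq0 //.
by rewrite !mulr1 mulrC.
Qed.

Lemma den_neq0 (g : F) : den g != 0.
Proof. exact: denom_ratioP. Qed.

Lemma frac_repr (g : F) : g = tofrac (num g) / tofrac (den g).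
Proof.
have d0 : tofrac (den g) != 0 by rewrite tofrac_eq0 den_neq0.
apply: (mulIf d0); rewrite mulfVK //.
have := pi_den (generic_quotient.repr g); rewrite generic_quotient.reprK; exact.
Qed.

Variable f : {rmorphism A -> A}.
Hypothesis f_inj : injective f.

(** Written through the chosen representative exactly as [sF], so that the two agree by conversion;
    [fracmapE] shows that the choice of representative is immaterial. *)
Definition fracmap (g : F) : F := tofrac (f (num g)) / tofrac (f (den g)).

Lemma f_neq0 a : a != 0 -> tofrac (f a) != 0.
Proof. by move=> h; rewrite tofrac_eq0 -(rmorph0 f) (inj_eq f_inj). Qed.

Lemma fracmapE a b : b != 0 -> fracmap (tofrac a / tofrac b) = tofrac (f a) / tofrac (f b).
Proof.
move=> b0; set g := tofrac a / tofrac b; have d0 := den_neq0 g.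
have tb0 : tofrac b != 0 by rewrite tofrac_eq0.
have td0 : tofrac (den g) != 0 by rewrite tofrac_eq0.
have e : num g * b = a * den g.
  apply/eqP; rewrite -tofrac_eq !rmorphM; apply/eqP.
  have := frac_repr g; rewrite {1}/g => /eqP; rewrite eqr_div // => /eqP ->.
  by [].
rewrite /fracmap; apply/eqP; rewrite eqr_div ?f_neq0 // -!rmorphM e mulrC.
by rewrite [den g * _]mulrC.
Qed.

Lemma fracmap_zmod : zmod_morphism fracmap.
Proof.
move=> g h; rewrite {1}(frac_repr g) {1}(frac_repr h).
have [d1 d2] := (den_neq0 g, den_neq0 h).
rewrite -mulNr addf_div ?tofrac_eq0 // -!rmorphN -!rmorphM -rmorphD fracmapE ?mulf_neq0 //.
rewrite /fracmap -mulNr addf_div ?f_neq0 //.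
by rewrite rmorphD !rmorphM rmorphN /= !(rmorphD, rmorphM, rmorphN).
Qed.

Lemma fracmap_tofrac a : fracmap (tofrac a) = tofrac (f a).
Proof.
rewrite -[tofrac a]divr1 -(rmorph1 (@tofrac A)) fracmapE ?oner_eq0 //.
by rewrite !rmorph1 divr1.
Qed.

Lemma fracmap_monoid : monoid_morphism fracmap.
Proof.
split=> [|g h]; first by rewrite -(rmorph1 (@tofrac A)) fracmap_tofrac !rmorph1.
rewrite {1}(frac_repr g) {1}(frac_repr h).
have [d1 d2] := (den_neq0 g, den_neq0 h).
rewrite mulf_div -!rmorphM fracmapE ?mulf_neq0 // !rmorphM /=.
by rewrite /fracmap mulf_div.
Qed.

HB.instance Definition _ := GRing.isZmodMorphism.Build F F fracmap fracmap_zmod.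
HB.instance Definition _ := GRing.isMonoidMorphism.Build F F fracmap fracmap_monoid.

Definition fracmor : {rmorphism F -> F} := fracmap.

End FracMap.

Local Close Scope quotient_scope.

(** * The product of the adjacent factors *)

Section AdjacentProduct.
Variable S : polyFamily.
Variable N : nat.
Local Notation M := N.+1.
Local Notation PA k := (pP S k).
Local Notation q := (pq S).
Local Notation cst := (pcst S M).
Local Notation x := (px S M).
Local Notation Y := (@ysum S N).
Local Notation Ym := (@Ym S N).
Local Notation hom d f := (phom d f).
Local Notation qi := (qi S).

Definition Ypre k : PA M := \prod_(i < k) Y i.
Definition Fpre k : PA M := \prod_(i < k) (cst q * x i - x i.+1).

Lemma Ypre_YI k : (k <= N)%N -> Ypre k = YI S [set i : 'I_N | (0 <= i < 0 + k)%N].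
Proof. by move=> h; rewrite /YI (@big_win N 0 k _ _ Y). Qed.

Lemma Ypre_hom k : hom k (Ypre k).
Proof.
rewrite -[X in phom X _](card_ord k) -sum1_card; apply: hom_prod => i _; exact: Y_hom.
Qed.

(** Induction on k, the last factor being moved into [h]. The variables are written as differences
    of partial sums, and [run_Y] on the run 0..k-1, with nothing to its left, turns y_t into [t+1]
    x_0. At k = N the subtracted term contains y_N and dies. At k = 0 the truncated [k.-1] is
    harmless, as its coefficient is [0]. *)
Lemma adjacent_pre T (L : PA M -> PA T) k h : good true N L -> (k <= N)%N ->
  hom (N - k) h ->
  L (h * Fpre k) = pcst S T (qi k.+1) * L (h * Ypre k) - pcst S T (qi k) * L (h * Ypre k.-1 * Y k).
Proof.
move=> gL; have [hD hZ hR _] := gL.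
have LB a b : L (a - b) = L a - L b by rewrite hD (goodN _ gL).
elim: k h => [|k IH] h kN hh.
  rewrite /Fpre /Ypre !big_ord0 qiS qi0 add0r expr0 rmorph1 mul1r rmorph0 mul0r subr0.
  by [].
have kN' : (k < N)%N by [].
pose z := cst q * x k - x k.+1.
have -> : h * Fpre k.+1 = h * z * Fpre k by rewrite /Fpre big_ord_recr /= mulrA mulrAC.
rewrite IH; [|exact: ltnW|]; last first.
  have -> : (N - k = N - k.+1 + 1)%N by lia.
  by apply: phomM => //; apply: qx_hom.
(* The factor moved into [h] meets y_k and forms a relation. *)
have -> : pcst S T (qi k) * L (h * z * Ypre k.-1 * Y k) = 0.
  case: k IH kN hh kN' @z => [|k] IH kN hh kN' z; first by rewrite qi0 rmorph0 mul0r.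
  have -> : h * z * Ypre k * Y k.+1 = Y k.+1 * z * (h * Ypre k).
    by move: (Y _) z (Ypre _) => a b c; ring.
  rewrite (hR (Ordinal kN') (N - k.+2 + k)%N) ?mulr0 //; last lia.
  by apply: phomM => //; apply: Ypre_hom.
rewrite subr0.
set I : {set 'I_N} := [set i : 'I_N | (0 <= i < 0 + k)%N].
have YI_I : YI S I = Ypre k by rewrite -Ypre_YI // ltnW.
have cI : #|I| = k by rewrite card_interval ?subn0 // ltnW.
have bI : blk I 0 k by apply/blkP => t ht; rewrite (@inJ_win N 0 k) //; lia.
pose D := L (h * Ypre k * x 0).
have RY t : (t <= k)%N -> L (h * Ypre k * Y t) = pcst S T (qi t.+1) * D.
  move=> tk; rewrite -YI_I (run_Y gL hh _ bI (t := t)); [| |lia|lia].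
    by rewrite /= mulr0 (good0 gL) add0r subn0 YI_I.
  by rewrite cI; lia.
have RYm : L (h * Ypre k * Ym k) = pcst S T (qi k) * D.
  case: k @I YI_I cI bI D RY {IH kN hh kN' z} => [|k] I YI_I cI bI D RY /=.
    by rewrite mulr0 (good0 gL) qi0 rmorph0 mul0r.
  by rewrite RY.
have ex : h * z * Ypre k = cst q * (h * Ypre k * Y k) - cst q * (h * Ypre k * Ym k)
     - h * Ypre k * Y k.+1 + h * Ypre k * Y k.
  rewrite YS // /z; have -> : x k = Y k - Ym k by rewrite (Y_Ym S (j := k)) ?(ltnW kN') // addrC addKr.
  by move: (Y _) (Ym _) (x _) (Ypre _) (cst q) => a b c e f; ring.
rewrite ex hD !LB !hZ (RY k (leqnn k)) RYm /=.
have -> : h * Ypre k.+1 = h * Ypre k * Y k by rewrite /Ypre big_ord_recr /= mulrA.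
rewrite (RY k (leqnn k)); move: (L (h * Ypre k * Y k.+1)) => W.
rewrite !qiS exprS !rmorphD !rmorphM; move: (pcst S T q) (pcst S T (qi k)) (pcst S T (q ^+ k)) (D) => a b c e.
clear; ring.
Qed.

Lemma adjacent_full T (L : PA M -> PA T) : good true N L ->
  L (adjprod S [set: 'I_N]) = pcst S T (qi N.+1) * L (YI S [set: 'I_N]).
Proof.
move=> gL; have := @adjacent_pre T L N 1 gL (leqnn N); rewrite subnn hom1 => /(_ isT).
have -> : 1 * Fpre N = adjprod S [set: 'I_N].
  by rewrite mul1r /adjprod; apply: eq_bigl => i; rewrite inE.
have -> : 1 * Ypre N = YI S [set: 'I_N].
  by rewrite mul1r /YI; apply: eq_bigl => i; rewrite inE.
move=> ->; have [hD hZ _ hY] := gL.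
have [N0|N0] := posnP N.
  have -> : qi N = 0 by rewrite N0 qi0.
  by rewrite rmorph0 mul0r subr0.
rewrite [X in _ - _ * X](_ : _ = 0) ?mulr0 ?subr0 //.
rewrite mul1r mulrC; apply: (hY isT N.-1); [exact: Ypre_hom | exact: prednK].
Qed.

End AdjacentProduct.

(** * The q-divided symmetrization as an alternant *)

Section SymmetrizationLink.
Variable S : polyFamily.
Variable d : nat.
Local Notation n := d.+1.
Local Notation A := (pP S n).
Local Notation F := {fraction pP S n}.
Local Notation tf := (@tofrac (pP S n)).
Local Notation cst := (pcst S n).
Local Notation J := [set: 'I_d].

Lemma psy_inj (w : 'S_n) : injective (psy S w).
Proof. by apply: (can_inj (g := psy S w^-1%g)) => f; rewrite -psyM mulgV psy1. Qed.

Definition sfrac (w : 'S_n) : {rmorphism F -> F} := fracmor (@psy_inj w).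
Definition qfrac : F := tf (cst (pq S)).
Definition xfrac (i : nat) : F := tf (px S n i).

Lemma sfrac_tf w a : sfrac w (tf a) = tf (psy S w a).
Proof. exact: (fracmap_tofrac (@psy_inj w)). Qed.

Lemma sfrac1 g : sfrac 1%g g = g.
Proof. by rewrite [RHS]frac_repr /sfrac /= /fracmap !psy1. Qed.

Lemma sfracM u w g : sfrac (u * w)%g g = sfrac w (sfrac u g).
Proof.
rewrite (frac_repr g); move: (frac _).1 (frac _).2 => a b.
rewrite [LHS]fmorph_div [sfrac u _]fmorph_div [RHS]fmorph_div.
by rewrite !sfrac_tf !psyM.
Qed.

Lemma sfrac_x w i : (i < n)%N -> sfrac w (xfrac i) = xfrac (pnat w i).
Proof. by move=> _; rewrite /xfrac sfrac_tf psy_x. Qed.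

Lemma sfrac_q w : sfrac w qfrac = qfrac.
Proof. by rewrite /qfrac sfrac_tf psy_c. Qed.

Lemma xfrac_neq i j : (i < n)%N -> (j < n)%N -> i != j -> xfrac i - xfrac j != 0.
Proof. by move=> li _ ne; rewrite -rmorphB tofrac_eq0 px_sub_neq0. Qed.

Definition awA (f : A) : F := \sum_(w : 'S_n) tw qfrac xfrac sfrac w
  (tf f / \prod_(j < n.-1) (qfrac * xfrac j - xfrac j.+1)).

Lemma blk_setT i j : (j <= d)%N -> blk J i j.
Proof.
move=> jd; apply/blkP => t ht; have l : (t < d)%N by lia.
by rewrite (inJ_ord _ l) inE.
Qed.

Lemma grp_setT (w : 'S_n) : w \in grp J.
Proof.
have [ts -> _] := prod_tpermP w; elim/big_rec: _ => [|t u _ h]; first exact: group1.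
by rewrite groupM // tperm_grp // blk_setT // -ltnS.
Qed.

Lemma fixed_all (w : 'S_n) : fixed n w.
Proof. by apply/fixedP => j h; rewrite pnat_ge. Qed.

Lemma prod_pairs (R : comNzRingType) (G : nat -> nat -> R) :
  \prod_(0 <= j < n) \prod_(0 <= i < j) G i j =
  \prod_(p : 'I_n * 'I_n | (p.1 < p.2)%N && blk J p.1 p.2) G p.1 p.2.
Proof.
rewrite big_mkord (eq_bigr (fun j : 'I_n => \prod_(i < n | (i < j)%N) G i j)).
  rewrite (exchange_big_dep predT) //= pair_big_dep /=; apply: eq_bigl => p.
  by rewrite blk_setT ?andbT // -ltnS.
move=> j _; rewrite (big_nat_widen 0 j n) 1?ltnW // big_mkord.
by apply: eq_bigl => i; rewrite /=.
Qed.

Lemma rhoprodE : rhoprod qfrac xfrac n = tf (adjprod S J * gapprod S J) / tf (vander S J).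
Proof.
rewrite /rhoprod (prod_pairs (rho qfrac xfrac)) adjprod_gap /vander !rmorph_prod -prodf_div.
by apply: eq_bigr => p _; rewrite /rho /qfrac /xfrac !rmorphB rmorphM.
Qed.

Lemma adjprodE : tf (adjprod S J) = \prod_(j < n.-1) (qfrac * xfrac j - xfrac j.+1).
Proof.
rewrite /adjprod rmorph_prod; apply: eq_big => [i|i _]; first by rewrite inE.
by rewrite rmorphB rmorphM.
Qed.

Lemma adjprod_neq0 : tf (adjprod S J) != 0.
Proof.
rewrite tofrac_eq0; apply: contraNneq (Lam_adjprod S J) => ->.
by rewrite /Lam mul0r Alt0.
Qed.

Lemma vander_tf : tf (vander S J) != 0.
Proof. by rewrite tofrac_eq0 vander_neq0. Qed.

(** By [sum_tw] the symmetrization is the sum of the translates of f times [gapprod] over [vander];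
    since [vander] is alternating, it is a common denominator up to the sign of w. *)
Lemma awA_Lam f : awA f * tf (vander S J) = tf (Lam J f).
Proof.
rewrite /awA (eq_bigl (fixed n)) => [|w]; last by rewrite fixed_all.
rewrite (sum_tw sfrac1 sfracM sfrac_x sfrac_q xfrac_neq) // rhoprodE -adjprodE.
have -> : tf f / tf (adjprod S J) * (tf (adjprod S J * gapprod S J) / tf (vander S J)) =
    tf (f * gapprod S J) / tf (vander S J).
  by rewrite !rmorphM mulrA mulrA divfK ?adjprod_neq0.
rewrite mulr_suml /Lam /Alt rmorph_sum; apply: eq_big => [w|w _].
  by rewrite fixed_all grp_setT.
move: (f * gapprod S J) => G; rewrite fmorph_div !sfrac_tf sy_vander ?grp_setT //.
case: (odd_perm w); rewrite ?expr1 ?expr0 ?mulN1r ?mul1r.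
  by rewrite !rmorphN /= invrN mulrN mulNr divfK ?vander_tf.
by rewrite divfK ?vander_tf.
Qed.

(** The adjacent product is symmetrized in two ways: it cancels the denominator, giving [n]! by
    [sum_tw1], and it reduces to [n] times the full y-product. Cancelling [n] leaves [d]!. *)
Lemma Lam_YI_full : Lam J (YI S J) = cst (qfact S d) * vander S J.
Proof.
have gL : good true d (@Lam S d J) by have := good_Lam S J; rewrite cardsT card_ord.
have e1 := adjacent_full gL.
have e2 : awA (adjprod S J) = tf (cst (qfact S n)).
  rewrite /awA -adjprodE divff ?adjprod_neq0 // (eq_bigl (fixed n)) => [|w]; last by rewrite fixed_all.
  rewrite (sum_tw1 sfrac_x sfrac_q xfrac_neq) // /qfact !rmorph_prod.
  apply: eq_bigr => i _; rewrite /qi !rmorph_sum; apply: eq_bigr => j _.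
  by rewrite !rmorphXn.
have := awA_Lam (adjprod S J); rewrite e2 e1 -rmorphM => /eqP; rewrite tofrac_eq => /eqP e3.
have q0 : cst (qi S n) != 0 by rewrite -(rmorph0 cst) (inj_eq (@pcst_inj S n)) qi_neq0.
apply: (mulfI q0); rewrite -e3 /qfact big_ord_recr /= rmorphM.
by rewrite mulrCA mulrA.
Qed.

Definition trfrac : {rmorphism pR S -> F} := (tf \o cst)%FUN.

Lemma trfrac_inj : injective trfrac.
Proof. by move=> a b /eqP; rewrite /trfrac /= tofrac_eq => /eqP/pcst_inj. Qed.

(** Supplies the last hypothesis of [abs_main], by taking [Lam] on the full set as the
    functional. *)
Lemma awA_good f k1 c :
  (forall T (L : pP S n -> pP S T), good true d L -> pcst S T k1 * L f = pcst S T c * L (YI S J)) ->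
  trfrac k1 * awA f = trfrac (c * qfact S d).
Proof.
move=> h; have gL : good true d (@Lam S d J) by have := good_Lam S J; rewrite cardsT card_ord.
apply: (mulIf vander_tf); rewrite -mulrA awA_Lam /trfrac /= -!rmorphM; congr tofrac.
by rewrite h // Lam_YI_full !rmorphM !mulrA.
Qed.

End SymmetrizationLink.

(** * Generating functions and the q-binomial theorem *)

Section GeneratingFunction.
Variable S : polyFamily.
Local Notation RA := (pR S).
Local Notation q := (pq S).
Local Notation qi := (qi S).

Definition tqA n : {poly RA} := \prod_(i < n) (1 - (q ^+ i)%:P * 'X).
Definition qrise d m : RA := \prod_(i < d) qi (m + i).+1.

(** The two products share all but one factor, and [m+d+2] = [d+1] + q^(d+1) [m+1]. *)
Lemma qriseS d m : qrise d.+1 m.+1 - q ^+ d.+1 * qrise d.+1 m = qi d.+1 * qrise d m.+1.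
Proof.
rewrite /qrise big_ord_recr big_ord_recl /=.
rewrite [X in _ - _ * (_ * X)](eq_bigr (fun i : 'I_d => qi (m.+1 + i).+1)); last first.
  by move=> i _; rewrite /bump /= add1n addnS.
rewrite addn0; set P := \prod_(i < d) _.
have -> : qi (m.+1 + d).+1 = qi d.+1 + q ^+ d.+1 * qi m.+1.
  by rewrite -qiD; congr qi; lia.
by move: (qi _) (qi _) (q ^+ _) => a b c; ring.
Qed.

Lemma qrise0 d : qrise d 0 = qfact S d.
Proof. by []. Qed.

Lemma coef_tqA n i : (tqA n.+1)`_i = (tqA n)`_i - q ^+ n * (if i is i'.+1 then (tqA n)`_i' else 0).
Proof.
rewrite /tqA big_ord_recr /= mulrBr mulr1 coefB; congr (_ - _).
rewrite mulrA coefMX mulrC; case: i => [|i] /=; first by rewrite mulr0.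
by rewrite coefCM.
Qed.

(* The q-binomial theorem: (t;q)_(d+1) inverts sum_m [m+1]..[m+d] t^m / [d]!. *)
Lemma qbinomial d k : \sum_(i < k.+1) (tqA d.+1)`_i * qrise d (k - i) = (k == 0%N)%:R * qfact S d.
Proof.
elim: d k => [|d IH] k.
  rewrite /qfact big_ord0 mulr1.
  rewrite (eq_bigr (fun i : 'I_k.+1 => (tqA 1)`_i)); last by move=> i _; rewrite /qrise big_ord0 mulr1.
  rewrite /tqA big_ord_recl big_ord0 mulr1 expr0 mul1r.
  rewrite (eq_bigr (fun i : 'I_k.+1 => ((i == 0 :> nat)%:R - (i == 1 :> nat)%:R))); last first.
    by move=> i _; rewrite coefB coef1 coefX.
  rewrite big_ord_recl /=; case: k => [|k]; first by rewrite big_ord0 subr0 addr0.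
  rewrite big_ord_recl big1 /=; last by move=> i _; rewrite subrr.
  by rewrite subr0 sub0r addr0 subrr.
have qf : qfact S d.+1 = qfact S d * qi d.+1 by rewrite /qfact big_ord_recr.
rewrite (eq_bigr (fun i : 'I_k.+1 => (tqA d.+1)`_i * qrise d.+1 (k - i) -
   q ^+ d.+1 * (if val i is i'.+1 then (tqA d.+1)`_i' else 0) * qrise d.+1 (k - i))); last first.
  by move=> i _; rewrite coef_tqA mulrBl.
rewrite sumrB big_ord_recr /= subnn [X in _ - X]big_ord_recl /= mulr0 mul0r add0r.
case: k => [|k].
  have := IH 0%N; rewrite big_ord_recl big_ord0 subnn !qrise0 addr0 /= => e.
  by rewrite !big_ord0 add0r subr0 qf !mulrA; congr (_ * _); exact: e.
have e := IH k.+1; rewrite big_ord_recr /= mul0r subnn qrise0 in e.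
rewrite [RHS]mul0r addrAC -sumrB.
rewrite (eq_bigr (fun i : 'I_k.+1 => qi d.+1 * ((tqA d.+1)`_i * qrise d (k.+1 - i)))).
  rewrite -mulr_sumr [qrise d.+1 0]qf.
  move/eqP: e; rewrite addr_eq0 => /eqP ->; ring.
move=> i _; rewrite /bump /= add1n add0n subSS.
have -> : (k.+1 - i = (k - i).+1)%N by have := ltn_ord i; lia.
rewrite [RHS]mulrCA -qriseS; move: (tqA _)`_i (qrise _ _) (qrise _ _) (q ^+ _) => a b c e'; ring.
Qed.

Section Assemble.
Variables (p d k : nat) (v : 'S_p.+1) (F : fieldType) (tr : {rmorphism RA -> F}).
Variables (a nuv : nat -> F).
Hypothesis tr_inj : injective tr.
Hypothesis h : forall k', tr (qfact S d) * nuv k' =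
  \sum_(s < (d - p).+1 | (s <= k')%N) a s * tr (qrise d (k' - s)).

(** After exchanging the sums, the inner sum for each s is the coefficient of t^(k-s) in
    [qbinomial], which is [d]! if s = k and 0 otherwise. *)
Lemma assemble : \sum_(i < k.+1) tr (tqA d.+1)`_i * nuv (k - i) =
  if (k <= d - p)%N then a k else 0.
Proof.
have qf0 : tr (qfact S d) != 0.
  rewrite -(rmorph0 tr) (inj_eq tr_inj); apply/prodf_neq0 => i _; exact: qi_neq0.
apply: (mulfI qf0); rewrite mulr_sumr.
rewrite (eq_bigr (fun i : 'I_k.+1 => \sum_(s < (d - p).+1)
    (if (s <= k - i)%N then a s * (tr (tqA d.+1)`_i * tr (qrise d (k - i - s))) else 0))); last first.
  move=> i _; rewrite mulrCA h mulr_sumr big_mkcond; apply: eq_bigr => s _.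
  by case: ifP => _; rewrite // mulrCA.
rewrite exchange_big /=.
rewrite (eq_bigr (fun s : 'I_(d - p).+1 => a s * ((s == k :> nat)%:R * tr (qfact S d)))).
  case: ifP => kd.
    rewrite (bigD1 (Ordinal (kd : k < (d - p).+1)%N)) //= eqxx mul1r big1 ?addr0 1?mulrC // => s.
    by rewrite -val_eqE /= => /negbTE ->; rewrite mul0r mulr0.
  rewrite mulr0 big1 // => s _; have := ltn_ord s; case: eqP => [->|_]; last by rewrite mul0r mulr0.
  by rewrite ltnS kd.
move=> s _; have [sk|ks] := leqP s k; last first.
  rewrite big1 => [|i _]; last by case: ifP => //; lia.
  by rewrite (_ : (s == k :> nat) = false) ?mul0r ?mulr0 //; apply/eqP; lia.
have -> : (s == k :> nat) = (k - s == 0)%N by apply/eqP/eqP; lia.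
rewrite -(rmorph_nat tr) -rmorphM -qbinomial rmorph_sum mulr_sumr.
rewrite (big_ord_widen k.+1 (fun i => a s * tr ((tqA d.+1)`_i * qrise d (k - s - i)))); last lia.
rewrite [RHS]big_mkcond; apply: eq_bigr => i _; have -> : (i < (k - s).+1)%N = (s <= k - i)%N.
  by have := ltn_ord i; lia.
by case: ifP => // _; rewrite rmorphM; congr (_ * (_ * tr (qrise d _))); lia.
Qed.

End Assemble.

End GeneratingFunction.

(** * The main theorem *)

Lemma pnat_ptimes a b (u : 'S_a) (w : 'S_b) i :
  pnat (ptimes u w) i = if (i < a)%N then pnat u i else (a + pnat w (i - a))%N.
Proof.
case: (ltnP i (a + b)) => h; last first.
  by rewrite pnat_ge // ifF ?pnat_ge; lia.
rewrite /ptimes mkpermE // => [j|j l] lj.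
  case: ifP => ja; first by have := pnat_lt u j; rewrite ja; lia.
  by rewrite ltn_add2l pnat_lt; lia.
move=> ll; have uj := pnat_lt u j; have ul := pnat_lt u l.
case: ifP => ja; case: ifP => la; rewrite ja la in uj ul *.
- exact: pnat_inj.
- by lia.
- by lia.
by move/addnI/pnat_inj; lia.
Qed.

Lemma shifted_ptimes k p (v : 'S_p) : shifted k (ptimes (1%g : 'S_k) v) v.
Proof.
split=> [t|t h]; rewrite pnat_ptimes; last by rewrite h pnat1.
by rewrite ltnNge leq_addr /= addKn.
Qed.

Lemma shifted_vshift n p m (v : 'S_p.+1) : (m + p.+1 <= n)%N -> shifted m (vshift n m v) v.
Proof.
move=> h; set P := ptimes (ptimes (1%g : 'S_m) v) (1%g : 'S_(n - p.+1 - m)).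
have e : (m + p.+1 + (n - p.+1 - m) = n)%N by lia.
have E i : pnat (vshift n m v) i = pnat P i.
  case: (ltnP i n) => hi; last by rewrite !pnat_ge // e.
  rewrite /vshift mkpermE // => [j lj|j l _ _]; last exact: pnat_inj.
  by have := pnat_lt P j; move: (pnat P j) => y; lia.
have [s1 s2] := shifted_ptimes m v.
split=> [t|t ht]; rewrite E /P pnat_ptimes.
  case: ltnP => ht; first exact: s1.
  by rewrite pnat1 (pnat_ge v) //; lia.
by rewrite s2 // ifT //; lia.
Qed.

(* A prefix preserved by v splits v as a product. *)
Lemma indecomposable_moves p (v : 'S_p.+1) : indecomposable v ->
  forall b, (b < p)%N -> moves b v.
Proof.
move=> ind b bp; case: (boolP [exists t : 'I_b.+1, (b < pnat v t)%N]) => [/existsP[t ht]|].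
  by exists t => //; rewrite -ltnS.
rewrite negb_exists => /forallP nt; case: ind.
have stab t : (t < b.+1)%N -> (pnat v t < b.+1)%N.
  by move=> lt; have := nt (Ordinal lt); rewrite /= -leqNgt.
pose u : 'S_b.+1 := mkperm b.+1 (pnat v).
have uE t : (t < b.+1)%N -> pnat u t = pnat v t.
  by move=> lt; rewrite mkpermE // => i j _ _; apply: pnat_inj.
have stab' t : (b < t)%N -> (b < pnat v t)%N.
  move=> bt; rewrite ltnNge; apply/negP => h.
  have := pnatVK u (pnat v t).
  have hu : (pnat u^-1%g (pnat v t) < b.+1)%N by rewrite pnat_lt.
  move=> e; have : pnat u (pnat u^-1%g (pnat v t)) = pnat v t.
    by rewrite -pnatM mulVg pnat1.
  by rewrite uE // => /pnat_inj e'; rewrite e' in hu; lia.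
pose w : 'S_(p - b.+1).+1 := mkperm (p - b.+1).+1 (fun i => pnat v (b.+1 + i) - b.+1)%N.
exists b, (p - b.+1)%N, u, w; split; first lia.
move=> i; rewrite pnat_ptimes; case: ltnP => hi; first by rewrite uE.
case: (ltnP i p.+1) => hp; last by rewrite !pnat_ge //; lia.
rewrite mkpermE.
- by rewrite subnKC // subnKC //; apply: stab'.
- move=> j lj; have l : (b.+1 + j < p.+1)%N by lia.
  by have := pnat_lt v (b.+1 + j); rewrite l; lia.
- move=> j l lj ll; have := stab' (b.+1 + j)%N; have := stab' (b.+1 + l)%N => h1 h2 e.
  have : pnat v (b.+1 + j) = pnat v (b.+1 + l) by lia.
  by move/pnat_inj; lia.
by lia.
Qed.

Section Abstract.
Variable S : polyFamily.
Local Notation sch w := (schubertA S w).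

Lemma perm1_trivial (w : 'S_1) : w = 1%g.
Proof. by apply/permP => i; rewrite [LHS]ord1 [RHS]ord1. Qed.

Lemma main_abstract p (v : 'S_p.+1) k (d := perm_length v) :
  (forall b, (b < p)%N -> moves b v) ->
  trfrac S d (\sum_(i < k.+1) (tqA S d.+1)`_i * evq S (k - i + p.+1) (sch (ptimes (1%g : 'S_(k - i)) v)))
  = if (k <= d - p)%N then awA (sch (vshift d.+1 k v)) else 0.
Proof.
move=> mv; rewrite rmorph_sum.
rewrite (eq_bigr (fun i : 'I_k.+1 => trfrac S d (tqA S d.+1)`_i *
   trfrac S d (evq S (k - i + p.+1) (sch (ptimes (1%g : 'S_(k - i)) v))))); last first.
  by move=> i _; rewrite rmorphM.
apply: (@assemble S p d k _ (trfrac S d) (fun s => awA (sch (vshift d.+1 s v)))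
  (fun j => trfrac S d (evq S (j + p.+1) (sch (ptimes (1%g : 'S_j) v)))) (@trfrac_inj S d)) => k'.
rewrite -rmorphM mulrC.
(* For p = 0 one has v = 1 and d = 0: all windows are empty and no longer determine their starting
   points, so [abs_main] does not cover this case. *)
have [p0|p0] := posnP p; last first.
  refine (@abs_main S p k' d v _ p0 mv (erefl d) (shifted_ptimes k' v) _ (trfrac S d)
    (fun s => vshift d.+1 s v) (fun s => awA (sch (vshift d.+1 s v))) (@trfrac_inj S d) _ _).
    move=> s sd; apply: shifted_vshift.
    have pd : (p <= d)%N.
      have := @moves_length _ v (iota 0 p) (iota_uniq 0 p); rewrite size_iota; apply.
      by move=> b; rewrite mem_iota => /mv.
    lia.
  by move=> s k1 c sd k10 hs; apply: awA_good.
subst p; have v1 : v = 1%g := perm1_trivial v.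
have d0 : d = 0%N by rewrite /d v1 perm_length1.
have w1 : ptimes (1%g : 'S_k') v = 1%g.
  by apply: pnat_permP => i; rewrite pnat_ptimes v1 !pnat1; case: ltnP => h; lia.
rewrite w1 schubert1 rmorph1 mul1r.
have u1 : vshift d.+1 0 v = 1%g.
  have [h _] := @shifted_vshift d.+1 0 0 v isT.
  by apply: pnat_permP => i; rewrite -[i in LHS]add0n h v1 !pnat1.
have qf : qfact S d = 1 by rewrite /qfact d0 big_ord0.
have a0 : awA (sch (vshift d.+1 0 v)) = 1.
  have := @awA_good S d (sch (vshift d.+1 0 v)) 1 1; rewrite qf mul1r rmorph1 mul1r; apply.
  move=> T L _; rewrite u1 schubert1; congr (_ * L _).
  by rewrite /YI big1 // => -[i hi]; exfalso; move: (hi); rewrite d0.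
have qr m : qrise S d m = 1 by rewrite /qrise d0 big_ord0.
rewrite qf rmorph1 big_mkcond big_ord_recl /= big1 => [|[i hi] _]; last first.
  by exfalso; move: (hi); rewrite subn0 d0.
by rewrite a0 qr rmorph1 mulr1 addr0.
Qed.

End Abstract.

Lemma schub_fuelAE k f (w : 'S_k) : schub_fuelA mpolyFamily f w = schub_fuel f w.
Proof.
have xd : xdel mpolyFamily k = xdelta k by apply: eq_bigr => i _; rewrite -xvE.
elim: f w => [|f IH] w /=; first exact: xd.
case: ifP => _; first exact: xd.
by case: pick => [i|]; [rewrite IH | exact: xd].
Qed.

Lemma schubertAE k (w : 'S_k) : schubertA mpolyFamily w = schubert w.
Proof. exact: schub_fuelAE. Qed.

Lemma nuE p (v : 'S_p.+1) j :
  nu v j = evq mpolyFamily (j + p.+1) (schubertA mpolyFamily (ptimes (1%g : 'S_j) v)).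
Proof. by rewrite schubertAE. Qed.

Lemma TjE d i (g : Frac d.+1) :
  Tj i g = heckeT (qfrac mpolyFamily d) (xfrac mpolyFamily d) (@sfrac mpolyFamily d) i g.
Proof. by []. Qed.

Lemma Tw_fuelE d f (w : 'S_d.+1) (g : Frac d.+1) :
  Tw_fuel f w g = tw_fuel (qfrac mpolyFamily d) (xfrac mpolyFamily d) (@sfrac mpolyFamily d) f w g.
Proof.
elim: f w g => [|f IH] w g; first by [].
rewrite [LHS]/= [RHS]/=; case: (w == 1%g); first by [].
case: pick => [i|]; last by [].
by rewrite IH TjE.
Qed.

Lemma awE d (w : 'S_d.+1) : aw w = awA (schubertA mpolyFamily w).
Proof.
rewrite schubertAE /aw /qdsym /awA; apply: eq_bigr => u _.
by rewrite /Tw Tw_fuelE.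
Qed.

(** The identity is multiplied by (t;q)_n and read off at t^k. As (t;q)_n has constant term 1, it is
    invertible among power series in t, so nothing is lost. Coefficients are compared in the
    fraction field, where the a's are defined. *)
Theorem mainTheorem18 (p n : nat) (v : 'S_p.+1) :
  indecomposable v -> (perm_length v).+1 = n ->
  forall k : nat,
    tofrac ((\sum_(i < k.+1) (tq n)`_i * nu v (k - i))%:MP_[n])
    = (if (k <= n - p.+1)%N then aw (vshift n k v) else 0).
Proof.
move=> ind <- k; have := @main_abstract mpolyFamily p v k (indecomposable_moves ind).
rewrite awE subSS => <-.
congr (tofrac (mpolyC _ _)); apply: eq_bigr => i _; by rewrite nuE.
Qed.
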